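(* Let $M$ be an $n$-dimensional manifold with a Riemannian metric $g$. Let $S$ be an $(n-1)$-dimensional subspace (embedded hypersurface) of $M$, and let $h$ be the metric induced on $S$ by the embedding of $S$ in $(M,g)$. Consider a pair of nearby points $p,q\in S$ chosen so that they are connected by a unique geodesic in $(S,h)$ and by a unique geodesic in $(M,g)$. Let $\bar L(p,q)$ be the arc-length from $p$ to $q$ of the geodesic in $(M,g)$ and let $\tilde L(p,q)$ be the arc-length from $p$ to $q$ of the geodesic in $(S,h)$. Let $K$ be the second fundamental form of $S$ at $p$, and let $v$ be the unit tangent at $p$ to the geodesic in $(M,g)$ from $p$ to $q$. Then, as $q\to p$ in $S$ with $p$ fixed, $$\tilde L^2(p,q)=\bar L^2(p,q)+\frac{1}{12}\left(K(v,v)\,\bar L^2(p,q)\right)^2+O\!\left(\bar L^5\right),$$ where $\bar L=\bar L(p,q)$.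
   Context: All objects ($M$, $g$, $S$) are smooth. Let $n^\mu$ be a (local) unit normal field to $S$, and let $\bot$ denote orthogonal projection onto directions tangent to $S$ (applied to every index). The second fundamental form (extrinsic curvature) is $K_{\alpha\beta}=\tfrac12\bot\left(n_{\alpha;\beta}+n_{\beta;\alpha}\right)$, where $;$ is the Levi-Civita covariant derivative of $g$. Because of the projection, $K$ is defined on all vectors of $T_pM$: $K(v,v)=K_{\alpha\beta}v^\alpha v^\beta$ depends only on the part of $v$ tangent to $S$. (The sign of $K$ does not matter here.) *)

(* Defs.v *)
From HB Require Import structures.
From mathcomp Require Import all_boot all_order all_algebra.
From mathcomp Require Import all_classical all_reals all_analysis.

Set Implicit Arguments.
Unset Strict Implicit.
Unset Printing Implicit Defensive.

Import Order.TTheory GRing.Theory Num.Theory.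
Import numFieldNormedType.Exports.

Local Open Scope classical_set_scope.
Local Open Scope ring_scope.

Section Calculus.
Context {R : realType} {n : nat} {W : normedModType R}.

Definition basis_vec (i : 'I_n) : 'rV[R]_n := delta_mx 0 i.

Fixpoint Ck (k : nat) (D : set 'rV[R]_n) (f : 'rV[R]_n -> W) : Prop :=
  match k with
  | 0%N => {in D, continuous f}
  | k'.+1 => (forall x, D x -> differentiable f x) /\
             (forall i : 'I_n, Ck k' D ('D_(basis_vec i) f))
  end.

Definition smooth_on (D : set 'rV[R]_n) (f : 'rV[R]_n -> W) : Prop :=
  forall k, Ck k D f.

End Calculus.

(* [param] is total, but only its values on [cmap @` cdom] matter. *)
Record chart (R : realType) (M : topologicalType) (n : nat) := Chart {
  cdom : set M;
  cmap : M -> 'rV[R]_n;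
  param : 'rV[R]_n -> M;
  cdom_open : open cdom;
  cimg_open : open (cmap @` cdom);
  cmap_cont : {in cdom, continuous cmap};
  param_cont : {in cmap @` cdom, continuous param};
  cmapK : {in cdom, cancel cmap param} }.

Definition cimg {R : realType} {M : topologicalType} {n : nat}
  (c : chart R M n) : set 'rV[R]_n := cmap c @` cdom c.

(* A second countable Hausdorff space with a smooth atlas. The atlas need not
   be maximal. [chart_at] selects a chart around each point; the notions below
   that use it do not depend on the selection. *)
Record manifold (R : realType) (M : topologicalType) (n : nat) := Manifold {
  atlas : set (chart R M n);
  chart_at : M -> chart R M n;
  chart_at_atlas : forall p, atlas (chart_at p);
  chart_at_dom : forall p, cdom (chart_at p) p;
  atlas_smooth : forall c d, atlas c -> atlas d ->
    smooth_on (cmap c @` (cdom c `&` cdom d)) (cmap d \o param c);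
  manifold_hausdorff : hausdorff_space M;
  manifold_second_countable : @second_countable M }.

Section LocalGeometry.
Context {R : realType} {n : nat}.
Implicit Types (G : 'rV[R]_n -> 'M[R]_n) (x v w : 'rV[R]_n).

Definition bilin (A : 'M[R]_n) v w : R := (v *m A *m w^T) 0 0.

(* [christoffel G x k i j] is Gamma^k_{ij} of the Levi-Civita connection. *)
Definition christoffel G x (k i j : 'I_n) : R :=
  2^-1 * \sum_l invmx (G x) k l *
    ('D_(basis_vec i) (fun y => G y j l) x
     + 'D_(basis_vec j) (fun y => G y i l) x
     - 'D_(basis_vec l) (fun y => G y i j) x).

Definition lower G (nu : 'rV[R]_n -> 'rV[R]_n) x : 'rV[R]_n := nu x *m G x.

(* n_{a;b} *)
Definition cov_deriv G (nu : 'rV[R]_n -> 'rV[R]_n) x (a b : 'I_n) : R :=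
  'D_(basis_vec b) (fun y => lower G nu y 0 a) x
  - \sum_k christoffel G x k a b * lower G nu x 0 k.

(* Orthogonal projection onto the complement of the unit vector [nu x]. *)
Definition tangential G (nu : 'rV[R]_n -> 'rV[R]_n) x v : 'rV[R]_n :=
  v - bilin (G x) v (nu x) *: nu x.

Definition second_form G (nu : 'rV[R]_n -> 'rV[R]_n) x v w : R :=
  bilin (\matrix_(a, b) (2^-1 * (cov_deriv G nu x a b + cov_deriv G nu x b a)))
    (tangential G nu x v) (tangential G nu x w).

End LocalGeometry.

(* A covariant 2-tensor field, given by its component matrices in each chart. *)
Definition tensor2 (R : realType) (M : topologicalType) (n : nat) :=
  chart R M n -> 'rV[R]_n -> 'M[R]_n.

Section Riemannian.
Context {R : realType} {M : topologicalType} {n : nat}.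
Implicit Types (A : manifold R M n) (g : tensor2 R M n) (c d : chart R M n).
Implicit Types (gamma : R -> M) (U : set M) (p q : M).

(* With row vectors, ['J f x] has entries (i, a) equal to d f^a / d x^i. *)
Definition is_riemannian A g : Prop :=
  [/\ forall c, atlas A c -> smooth_on (cimg c) (g c),
      forall c x, atlas A c -> cimg c x ->
        (g c x)^T = g c x /\ (forall v : 'rV[R]_n, v != 0 -> 0 < bilin (g c x) v v)
    & forall c d p, atlas A c -> atlas A d -> cdom c p -> cdom d p ->
        let J := 'J (cmap d \o param c) (cmap c p) in
        g c (cmap c p) = J *m g d (cmap d p) *m J^T].

Definition velocity c gamma (t : R) : 'rV[R]_n := derive1 (cmap c \o gamma) t.

Definition speed g c gamma (t : R) : R :=
  Num.sqrt (bilin (g c (cmap c (gamma t)))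
              (velocity c gamma t) (velocity c gamma t)).

Definition arc_length A g gamma : R :=
  \int[lebesgue_measure]_(t in `[0, 1]) speed g (chart_at A (gamma t)) gamma t.

(* Components in the chart [c]; meaningful when [gamma] has nonzero speed. *)
Definition unit_tangent g c gamma (t : R) : 'rV[R]_n :=
  (speed g c gamma t)^-1 *: velocity c gamma t.

(* The equation is invariant under changes of coordinates, so that it is
   enough to ask for it in one chart around each point of the curve. *)
Definition geodesic_eq_at A g gamma (t : R) : Prop :=
  {for t, continuous gamma} /\
  exists c, [/\ atlas A c, cdom c (gamma t),
    \forall s \near t, derivable (cmap c \o gamma) s 1,
    derivable (velocity c gamma) t 1
    & forall k : 'I_n,
        derive1 (velocity c gamma) t 0 k
        + \sum_i \sum_j christoffel (g c) (cmap c (gamma t)) k i j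
            * velocity c gamma t 0 i * velocity c gamma t 0 j = 0].

(* Geodesics from [p] to [q] lying in [U], affinely parametrized by [0, 1].
   The equation is imposed slightly beyond [0, 1] so that the derivatives at
   the endpoints are two-sided; every geodesic segment extends in this way. *)
Definition geodesic A g U p q gamma : Prop :=
  [/\ gamma 0 = p, gamma 1 = q,
      forall t, 0 <= t <= 1 -> U (gamma t)
    & exists2 e : R, 0 < e &
        forall t, - e < t < 1 + e -> geodesic_eq_at A g gamma t].

(* Uniqueness is relative to [U]: on a compact manifold, for instance, nearby
   points are joined by a unique geodesic only within small neighbourhoods. *)
Definition unique_geodesic A g U p q gamma : Prop :=
  geodesic A g U p q gamma /\
  forall gamma', geodesic A g U p q gamma' ->
    forall t, 0 <= t <= 1 -> gamma' t = gamma t.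

End Riemannian.

Section Submanifold.
Context {R : realType} {M S : topologicalType} {n m : nat}.
Implicit Types (A : manifold R M n) (B : manifold R S m) (g : tensor2 R M n).
Implicit Types (c : chart R M n) (d : chart R S m) (iota : S -> M).

Definition is_embedding A B iota : Prop :=
  [/\ injective iota,
      continuous iota,
      forall V : set S, open V -> exists2 O : set M, open O & V = iota @^-1` O
    & forall c d, atlas A c -> atlas B d ->
        let D := cmap d @` (cdom d `&` iota @^-1` cdom c) in
        let f := cmap c \o iota \o param d in
        smooth_on D f /\ (forall y, D y -> row_free ('J f y))].

Definition induced_metric A g iota : tensor2 R S m := fun d y =>
  let r := iota (param d y) in
  let c := chart_at A r in
  let J := 'J (cmap c \o iota \o param d) y in
  J *m g c (cmap c r) *m J^T.

(* [nu] gives the components, in the chart [c], of a smooth vector field on an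
   open set that is unit and normal along the hypersurface. The projected
   derivatives at the hypersurface depend only on its values there. *)
Definition local_unit_normal B g iota c (O : set 'rV[R]_n)
    (nu : 'rV[R]_n -> 'rV[R]_n) : Prop :=
  [/\ open O, O `<=` cimg c, smooth_on O nu
    & forall s : S, cdom c (iota s) -> O (cmap c (iota s)) ->
        let x := cmap c (iota s) in
        bilin (g c x) (nu x) (nu x) = 1 /\
        forall d, atlas B d -> cdom d s -> forall w : 'rV[R]_m,
          bilin (g c x) (w *m 'J (cmap c \o iota \o param d) (cmap d s))
            (nu x) = 0].

End Submanifold.

(* Main.v *)
Require Import Defs.
From HB Require Import structures.
From mathcomp Require Import all_boot all_order all_algebra.
From mathcomp Require Import all_classical all_reals all_analysis.
From mathcomp Require Import ring lra.

(* Let delta be the coordinate distance from p to q. Both geodesics are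
   constructed as solutions of a boundary value problem by a contraction
   argument; by the uniqueness hypotheses they are the given ones. Their speeds
   are constant, so that the squared lengths are values of the metric on
   velocities and no integral has to be expanded.

   Let x be the ambient geodesic, X the image of the surface geodesic, and
   w = X - x, which vanishes at both ends. Since third derivatives are
   O(delta^3), w'' = W + O(delta^3) with W constant, hence
   w' = (t - 1/2) W + O(delta^3). The energy of X minus that of x has no part of
   first order in w because x is a geodesic; what remains is the integral of
   |w'|^2 up to O(delta^5), that is |W|^2 / 12. Finally W is the covariant
   acceleration of X at p up to O(delta^3); this vector is normal to S because
   X is a geodesic of S, and differentiating g(X', n) = 0 shows that its normal
   component is - K(X', X'). *)
Set Implicit Arguments.
Unset Strict Implicit.
Unset Printing Implicit Defensive.

Import Order.TTheory GRing.Theory Num.Theory.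
Import numFieldNormedType.Exports.

Local Open Scope classical_set_scope.
Local Open Scope ring_scope.

(** The constant in the error must be fixed before [q], while a given geodesic may a priori wander
    far from [p]: only comparison with a constructed solution, short and contained in [U] or [V],
    locates it. The boundary value solver therefore returns bounds proportional to delta, and the
    asymptotic calculus runs over the family of all its solution pairs at once, so that every
    constant is uniform in [q]. No third derivative of a curve is formed. What is used is that a
    second derivative varies by O(delta^3) in time, which follows from Lipschitz bounds on the
    geodesic equation. The integral of |w'|^2 is not formed either: an explicit function of time has
    a derivative of order delta^5, its boundary terms vanish with w, and 1/12 is the increment of (t
    - 1/2)^3 / 3 over [0, 1]. Since time runs over [0, 1], the constant ambient speed is the length
    itself, so K(v,v) times its square is K on the unnormalized initial velocity. Errors come out in
    powers of delta; the immersion and the positive definite metric give delta <= C times the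
    ambient length, which converts them. *)

(** * Norms, derivatives and mean value estimates for matrix-valued functions *)

Section MatrixCalculus.
Context {R : realType}.

Lemma le_mx_norm m n (A : 'M[R]_(m, n)) i j : `|A i j| <= `|A|.
Proof.
by rewrite [leRHS]/Num.Def.normr /= mx_normrE; apply: (le_bigmax _ _ (i, j)).
Qed.

Lemma mx_norm_le m n (A : 'M[R]_(m, n)) e :
  0 <= e -> (forall i j, `|A i j| <= e) -> `|A| <= e.
Proof.
by move=> e0 H; rewrite [leLHS]/Num.Def.normr /= mx_normrE; apply: bigmax_le.
Qed.

Lemma mulmx_norm_le m n p (A : 'M[R]_(m, n)) (B : 'M[R]_(n, p)) :
  `|A *m B| <= n%:R * (`|A| * `|B|).
Proof.
apply: mx_norm_le => [|i j]; first by rewrite !mulr_ge0.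
rewrite mxE (le_trans (ler_norm_sum _ _ _))//.
rewrite -[X in X%:R * _](card_ord n) mulr_natl -sumr_const ler_sum// => k _.
by rewrite normrM ler_pM// le_mx_norm.
Qed.

Lemma bilin_norm_le n (A : 'M[R]_n) v w :
  `|bilin A v w| <= n%:R ^+ 2 * (`|A| * (`|v| * `|w|)).
Proof.
rewrite /bilin (le_trans (le_mx_norm _ _ _))//.
rewrite (le_trans (mulmx_norm_le _ _))//.
have tr (p q : nat) (B : 'M[R]_(p, q)) : `|B^T| <= `|B|.
  by apply: mx_norm_le => // i j; rewrite mxE le_mx_norm.
have -> : `|w^T| = `|w|.
  by apply/eqP; rewrite eq_le tr -{1}[w]trmxK tr.
rewrite expr2 -[leRHS]mulrA ler_wpM2l//.
apply: (@le_trans _ _ (n%:R * (`|v| * `|A|) * `|w|)).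
  by rewrite ler_wpM2r// mulmx_norm_le.
by rewrite [`|A| * _]mulrCA !mulrA.
Qed.

Lemma bilinDl n (A : 'M[R]_n) u v w : bilin A (u + v) w = bilin A u w + bilin A v w.
Proof. by rewrite /bilin !mulmxDl mxE. Qed.
Lemma bilinDr n (A : 'M[R]_n) u v w : bilin A u (v + w) = bilin A u v + bilin A u w.
Proof. by rewrite /bilin linearD mulmxDr mxE. Qed.
Lemma bilinZl n (A : 'M[R]_n) a v w : bilin A (a *: v) w = a * bilin A v w.
Proof. by rewrite /bilin -!scalemxAl mxE. Qed.
Lemma bilinZr n (A : 'M[R]_n) a v w : bilin A v (a *: w) = a * bilin A v w.
Proof. by rewrite /bilin linearZ -!scalemxAr mxE. Qed.
Lemma bilinNl n (A : 'M[R]_n) v w : bilin A (- v) w = - bilin A v w.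
Proof. by rewrite -scaleN1r bilinZl mulN1r. Qed.
Lemma bilinNr n (A : 'M[R]_n) v w : bilin A v (- w) = - bilin A v w.
Proof. by rewrite -scaleN1r bilinZr mulN1r. Qed.
Lemma bilinBl n (A : 'M[R]_n) u v w : bilin A (u - v) w = bilin A u w - bilin A v w.
Proof. by rewrite bilinDl bilinNl. Qed.
Lemma bilinBr n (A : 'M[R]_n) u v w : bilin A u (v - w) = bilin A u v - bilin A u w.
Proof. by rewrite bilinDr bilinNr. Qed.
Lemma bilinDm n (A B : 'M[R]_n) v w : bilin (A + B) v w = bilin A v w + bilin B v w.
Proof. by rewrite /bilin mulmxDr mulmxDl mxE. Qed.
Lemma bilinZm n (A : 'M[R]_n) a v w : bilin (a *: A) v w = a * bilin A v w.
Proof. by rewrite /bilin -scalemxAr -scalemxAl mxE. Qed.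
Lemma bilinBm n (A B : 'M[R]_n) v w : bilin (A - B) v w = bilin A v w - bilin B v w.
Proof. by rewrite bilinDm -scaleN1r bilinZm mulN1r. Qed.
Lemma bilin0l n (A : 'M[R]_n) w : bilin A 0 w = 0.
Proof. by rewrite /bilin !mul0mx mxE. Qed.
Lemma bilin0r n (A : 'M[R]_n) w : bilin A w 0 = 0.
Proof. by rewrite /bilin trmx0 mulmx0 mxE. Qed.

Lemma bilin_sym n (A : 'M[R]_n) v w : A^T = A -> bilin A v w = bilin A w v.
Proof.
move=> As; rewrite /bilin; have -> : v *m A *m w^T = (w *m A *m v^T)^T.
  by rewrite !trmx_mul trmxK As mulmxA.
by rewrite mxE.
Qed.

Lemma bilinE n (A : 'M[R]_n) v w :
  bilin A v w = \sum_i \sum_j A i j * v 0 i * w 0 j.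
Proof.
rewrite /bilin mxE exchange_big /=; apply: eq_bigr => j _.
rewrite !mxE big_distrl /=; apply: eq_bigr => i _.
by rewrite [v 0 i * _]mulrC.
Qed.

Lemma bilin_mull m n (J : 'M[R]_(m, n)) (A : 'M[R]_n) v w :
  bilin (J *m A *m J^T) v w = bilin A (v *m J) (w *m J).
Proof. by rewrite /bilin trmx_mul !mulmxA. Qed.

Section Derive.
Context {V : normedModType R}.
Implicit Types (x v : V).

Lemma is_derive_ext (W : normedModType R) (f g : V -> W) x v d d' :
  is_derive x v f d -> f =1 g -> d = d' -> is_derive x v g d'.
Proof. by move=> H /funext <- <-. Qed.

Lemma is_derive_mxP m n (M : V -> 'M[R]_(m, n)) x v dM :
  is_derive x v M dM <->
  forall i j, is_derive x v (fun y => M y i j) (dM i j).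
Proof.
split.
  move=> [HM <-] i j; have /derivable_mxP H := HM.
  split; first exact: H.
  by rewrite derive_mx// mxE.
move=> H; have HM : derivable M x v by apply/derivable_mxP => i j; case: (H i j).
by split=> //; rewrite derive_mx//; apply/matrixP => i j; rewrite mxE; case: (H i j).
Qed.

Lemma is_derive_bigsum (W : normedModType R) (I : finType) (h : I -> V -> W) (dh : I -> W) x v :
  (forall i, is_derive x v (h i) (dh i)) ->
  is_derive x v (fun y => \sum_i h i y) (\sum_i dh i).
Proof.
move=> H; have -> : (fun y => \sum_i h i y) = \sum_i h i.
  by apply/funext => y; rewrite fct_sumE.
by elim/big_ind2 : _ => // [|] *; [exact: is_derive_cst|exact: is_deriveD].
Qed.

Lemma is_derive_mulmx m n p (M : V -> 'M[R]_(m, n)) (N : V -> 'M[R]_(n, p)) x v dM dN :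
  is_derive x v M dM -> is_derive x v N dN ->
  is_derive x v (fun y => M y *m N y) (dM *m N x + M x *m dN).
Proof.
move=> /is_derive_mxP HM /is_derive_mxP HN; apply/is_derive_mxP => i j.
rewrite !mxE -big_split /=.
under eq_fun do rewrite mxE.
apply: is_derive_bigsum => k.
apply: is_derive_ext (is_deriveM (HM i k) (HN k j)) _ _ => //.
by rewrite addrC [in RHS]addrC /GRing.scale /= [_ * dM _ _]mulrC addrC.
Qed.

Lemma is_derive_trmx m n (M : V -> 'M[R]_(m, n)) x v dM :
  is_derive x v M dM -> is_derive x v (fun y => (M y)^T) dM^T.
Proof.
move=> /is_derive_mxP HM; apply/is_derive_mxP => i j; rewrite mxE.
by under eq_fun do rewrite mxE.
Qed.

Lemma is_derive_bilin n (A : V -> 'M[R]_n) (u w : V -> 'rV[R]_n) x v dA du dw :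
  is_derive x v A dA -> is_derive x v u du -> is_derive x v w dw ->
  is_derive x v (fun y => bilin (A y) (u y) (w y))
    (bilin dA (u x) (w x) + bilin (A x) du (w x) + bilin (A x) (u x) dw).
Proof.
move=> HA Hu Hw.
have /is_derive_mxP/(_ 0 0) := is_derive_mulmx (is_derive_mulmx Hu HA) (is_derive_trmx Hw).
move=> H; apply: is_derive_ext H _ _ => //.
by rewrite /bilin mulmxDl !mxE; congr (_ + _); rewrite addrC.
Qed.

(** Restricting [phi] to the line through [z] along [u] gives a function of one real variable, for
    which derivability is differentiability; the chain rule for differentials then applies to [f]
    composed with this restriction. *)
Lemma is_derive_comp_diff (U W : normedModType R) (f : V -> W) (phi : U -> V) (z u : U) dphi :
  is_derive z u phi dphi -> differentiable f (phi z) ->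
  is_derive z u (fun y => f (phi y)) ('D_dphi f (phi z)).
Proof.
move=> [Hp <-] Hf.
pose psi (h : R) := phi (h *: u + z).
have /derivable1P Hd := Hp; have /derivable1_diffP Hd' := Hd.
have E0 : psi 0 = phi z by rewrite /psi scale0r add0r.
have Hc : differentiable (f \o psi) 0.
  by apply: differentiable_comp => //; rewrite E0.
have Hder : derivable (fun y => f (phi y)) z u.
  by apply: (derivable1P _ _ _).2; apply/derivable1_diffP.
have DE (X : normedModType R) (k : U -> X) : 'D_u k z = 'D_1 (fun h : R => k (h *: u + z)) 0.
  rewrite /derive; set a := (fun h => _); set b := (fun h => _).
  suff -> : a = b by [].
  by apply/funext => h; rewrite /a /b /= addr0 scale0r add0r [_%:A]mulr1.
split=> //.
rewrite DE -[fun h => f (phi _)]/(f \o psi) deriveE// diff_comp//=; last by rewrite E0.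
by rewrite [RHS]deriveE// E0 DE -/psi deriveE.
Qed.

End Derive.

(** The norm of a matrix is the largest absolute value of its entries, so the scalar mean value
    theorem, with an intermediate point depending on the entry, gives the inequality without a
    dimensional factor. *)
Lemma MVT_norm m n (f df : R -> 'M[R]_(m, n)) (a b C : R) :
  (forall t, a <= t <= b -> is_derive t 1 f (df t)) ->
  (forall t, a <= t <= b -> `|df t| <= C) ->
  forall s t, a <= s <= b -> a <= t <= b -> `|f t - f s| <= C * `|t - s|.
Proof.
move=> fdf dfC.
suff H s t : a <= s <= b -> a <= t <= b -> s <= t -> `|f t - f s| <= C * `|t - s|.
  move=> s t sab tab; have [/H|/ltW/H] := leP s t; first exact.
  by rewrite distrC [`|s - t|]distrC; exact.
move=> sab tab st.
have C0 : 0 <= C by apply: le_trans (dfC _ sab).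
apply: mx_norm_le => [|i j]; first exact: mulr_ge0.
rewrite !mxE.
have inab u : u \in `[s, t]%R -> a <= u <= b.
  by rewrite in_itv /=; move: sab tab => /andP[? ?] /andP[? ?] /andP[? ?]; apply/andP; split; lra.
have D u : u \in `[s, t]%R -> is_derive u 1 (fun y => f y i j) (df u i j).
  by move=> /inab /fdf /is_derive_mxP.
have D' u : u \in `]s, t[%R -> is_derive u 1 (fun y => f y i j) (df u i j).
  by move=> /subset_itv_oo_cc; exact: D.
have cont : {within `[s, t], continuous (fun y => f y i j)}.
  apply: derivable_within_continuous => u /D Du.
  exact: (@ex_derive _ _ _ _ _ _ _ Du).
have [c cst ->] := @MVT_segment R (fun y => f y i j) (fun y => df y i j) s t st D' cont.
rewrite normrM ler_wpM2r// (le_trans (le_mx_norm _ _ _))//.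
by apply: dfC; apply: inab.
Qed.

Lemma MVT_norm_scalar (f df : R -> R) (a b C : R) :
  (forall t, a <= t <= b -> is_derive t 1 f (df t)) ->
  (forall t, a <= t <= b -> `|df t| <= C) ->
  forall s t, a <= s <= b -> a <= t <= b -> `|f t - f s| <= C * `|t - s|.
Proof.
move=> D B s t ss tt.
have D' u : a <= u <= b ->
    is_derive u 1 (fun s => const_mx (f s) : 'M[R]_1) (const_mx (df u)).
  move=> /D Du; apply/is_derive_mxP => i j; rewrite mxE.
  by under eq_fun do rewrite mxE.
have B' u : a <= u <= b -> `|const_mx (df u) : 'M[R]_1| <= C.
  move=> uu; apply: mx_norm_le => [|i j]; last by rewrite mxE B.
  exact: le_trans (B u uu).
by have := le_trans (le_mx_norm _ 0 0) (MVT_norm D' B' ss tt); rewrite !mxE.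
Qed.

(* Rolle gives a zero of each component of [dz], after which [ddz] is integrated twice. *)
Lemma two_point_bound m n (z dz ddz : R -> 'M[R]_(m, n)) (a b C : R) :
  a <= 0 -> 1 <= b -> z 0 = 0 -> z 1 = 0 ->
  (forall t, a <= t <= b -> is_derive t 1 z (dz t)) ->
  (forall t, a <= t <= b -> is_derive t 1 dz (ddz t)) ->
  (forall t, a <= t <= b -> `|ddz t| <= C) ->
  forall t, a <= t <= b ->
    `|dz t| <= C * (b - a) /\ `|z t| <= C * (b - a) ^+ 2.
Proof.
move=> a0 b1 z0 z1 Dz Ddz ddzC.
have in01 (u : R) : 0 <= u <= 1 -> a <= u <= b by move=> /andP[? ?]; apply/andP; split; lra.
have C0 : 0 <= C by apply: le_trans (ddzC 0 _) => //; apply: in01; lra.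
have ba : 0 <= b - a by lra.
have H1 (t : R) : a <= t <= b -> `|dz t| <= C * (b - a).
  move=> tab; apply: mx_norm_le => [|i j]; first exact: mulr_ge0.
  have D (u : R) : 0 <= u <= 1 -> is_derive u 1 (fun y => z y i j) (dz u i j).
    by move=> /in01 /Dz /is_derive_mxP.
  have [||||c c01 [_ dc]] := @Rolle R (fun y => z y i j) 0 1.
  - exact: ltr01.
  - move=> u; rewrite in_itv /= => /andP[u0 u1]; have := D u; rewrite !ltW// => /(_ isT) Du.
    exact: (@ex_derive _ _ _ _ _ _ _ Du).
  - apply: derivable_within_continuous => u; rewrite in_itv /= => /D Du.
    exact: (@ex_derive _ _ _ _ _ _ _ Du).
  - by rewrite z0 z1.
  have cc : 0 <= c <= 1 by move: c01; rewrite in_itv /= => /andP[? ?]; apply/andP; split; lra.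
  have E : dz c i j = 0 by have [_ <-] := D c cc.
  have := MVT_norm Ddz ddzC (in01 _ cc) tab => /(le_trans (le_mx_norm _ i j)).
  rewrite !mxE E subr0 => /le_trans; apply; apply: ler_wpM2l => //.
  have /andP[? ?] := in01 _ cc; move: tab => /andP[? ?]; rewrite ler_norml; apply/andP; split; lra.
move=> t tab; split; first exact: H1.
have a0b : a <= 0 <= b by apply/andP; split; lra.
have := MVT_norm Dz H1 a0b tab; rewrite z0 subr0 => /le_trans; apply.
rewrite subr0 expr2 mulrA; apply: ler_wpM2l; first exact: mulr_ge0.
by move: tab => /andP[? ?]; rewrite ler_norml; apply/andP; split; lra.
Qed.

End MatrixCalculus.

(** * Fixed points of contractions on curves, and primitives of curves *)

Section UniformFixpoint.
Context {R : realType} {n : nat}.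
Implicit Types (f g : R -> 'rV[R]_n).

(** Both bounds survive pointwise limits, so a limit of iterates stays in the class; the Lipschitz
    bound supplies the continuity needed to integrate. *)
Definition bounded_lipschitz (rho L : R) f : Prop :=
  (forall t, `|f t| <= rho) /\ (forall s t, `|f s - f t| <= L * `|s - t|).

Lemma lipschitz_continuous f (L : R) :
  (forall s t, `|f s - f t| <= L * `|s - t|) -> continuous f.
Proof.
move=> fL t; apply/cvgrPdist_le => e e0; near=> s.
have L1 : 0 < `|L| + 1 by rewrite ltr_wpDl.
apply: (le_trans (fL _ _)).
apply: (@le_trans _ _ ((`|L| + 1) * `|t - s|)).
  by rewrite ler_wpM2r// (le_trans (ler_norm _))// lerDl.
rewrite mulrC -ler_pdivlMr//; near: s.
by apply: cvgr_dist_le; [exact: cvg_id|exact: divr_gt0].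
Unshelve. all: by end_near. Qed.

Lemma small_half_power (c e : R) : 0 < e -> exists k, c * 2^-1 ^+ k <= e.
Proof.
move=> e0; have [c0|c0] := leP c 0.
  by exists 0%N; rewrite expr0 mulr1; lra.
have : geometric c (2^-1) @ \oo --> (0 : R).
  by apply: cvg_geometric; rewrite ger0_norm ?invf_lt1 ?ltr1n ?invr_ge0.
move=> /cvgrPdist_le/(_ e e0)[N _ HN]; exists N.
have := HN N; rewrite /= leqnn => /(_ isT).
by rewrite sub0r normrN => /(le_trans (ler_norm _)).
Qed.

(** Picard iteration from 0: the first iterate is bounded by [rho], later increments halve uniformly
    in time, so the pointwise limits are approached uniformly and the limit is a fixed point by the
    contraction property. *)
Lemma contraction_fixpoint (T : (R -> 'rV[R]_n) -> (R -> 'rV[R]_n)) (rho L : R) :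
  0 <= rho -> 0 <= L ->
  (forall f, bounded_lipschitz rho L f -> bounded_lipschitz rho L (T f)) ->
  (forall f g e, bounded_lipschitz rho L f -> bounded_lipschitz rho L g ->
     (forall t, `|f t - g t| <= e) -> forall t, `|T f t - T g t| <= e / 2) ->
  exists2 f, bounded_lipschitz rho L f & forall t, T f t = f t.
Proof.
move=> rho0 L0 TQ Tc.
pose u k := iter k T (fun=> 0).
have uQ k : bounded_lipschitz rho L (u k).
  elim: k => [|k IH]; last exact: TQ.
  by split => [t|s t]; rewrite ?subrr normr0// mulr_ge0.
have u1 k t : `|u k.+1 t - u k t| <= rho * 2^-1 ^+ k.
  elim: k t => [|k IH] t.
    by rewrite expr0 mulr1 /= subr0; have [-> _] := uQ 1%N.
  by rewrite exprSr mulrA; exact: (Tc _ _ _ (uQ k.+1) (uQ k) IH).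
(* The bound is kept as a difference of two geometric terms because this form telescopes and makes
   the induction on [j] close. *)
have ukj k j t : `|u (j + k)%N t - u k t| <= 2 * rho * 2^-1 ^+ k - 2 * rho * 2^-1 ^+ (j + k).
  elim: j => [|j IH]; first by rewrite !add0n !subrr normr0.
  rewrite addSn -(subrKA (u (j + k)%N t)) (le_trans (ler_normD _ _))//.
  apply: le_trans (lerD (u1 _ _) IH) _.
  by rewrite exprS; lra.
have ub k l t : (k <= l)%N -> `|u l t - u k t| <= 2 * rho * 2^-1 ^+ k.
  move=> kl; rewrite -(subnK kl) (le_trans (ukj _ _ _))// lerBlDr lerDl.
  by rewrite !mulr_ge0// exprn_ge0// invr_ge0.
have ucv t : cvg (u k t @[k --> \oo]).
  apply/cauchy_cvgP/cauchy_exP => e e0.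
  have [k Hk] := @small_half_power (2 * rho) (e / 2) (divr_gt0 e0 (ltr0Sn _ _)).
  exists (u k t); exists k => // l /= kl; rewrite -ball_normE /= distrC.
  by have := ub _ _ t kl; lra.
pose f t := lim (u k t @[k --> \oo]).
have fu k t : `|f t - u k t| <= 2 * rho * 2^-1 ^+ k.
  apply/ler_addgt0Pl => e e0.
  have /cvgrPdist_le/(_ e e0)[N _ HN] : u k t @[k --> \oo] --> f t := ucv t.
  have := HN (maxn N k); rewrite /= leq_maxl => /(_ isT) H1.
  have := ub k (maxn N k) t (leq_maxr _ _) => H2.
  by rewrite -(subrKA (u (maxn N k) t)) (le_trans (ler_normD _ _))// lerD.
have fQ : bounded_lipschitz rho L f.
  split => [t|s t]; apply/ler_addgt0Pl => e e0.
    have [k Hk] := @small_half_power (2 * rho) e e0.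
    have := fu k t; have [/(_ t) uk _] := uQ k => H.
    rewrite -[f t](subrK (u k t)) (le_trans (ler_normD _ _))//; lra.
  have [k Hk] := @small_half_power (2 * rho) (e / 2) (divr_gt0 e0 (ltr0Sn _ _)).
  have := fu k t; have := fu k s; have [_ /(_ s t) uk] := uQ k => H1 H2.
  rewrite -(subrKA (u k s)) (le_trans (ler_normD _ _))//.
  rewrite -[u k s - f t](subrKA (u k t)).
  have := ler_normD (u k s - u k t) (u k t - f t).
  rewrite [`|u k t - f t|]distrC; lra.
exists f => // t; apply/eqP; rewrite -subr_eq0 -normr_le0.
apply/ler_addgt0Pl => e e0; rewrite addr0.
have [k Hk] := @small_half_power (2 * rho) (e / 2) (divr_gt0 e0 (ltr0Sn _ _)).
have := Tc _ _ _ fQ (uQ k) (fu k) t; rewrite -/(u k.+1) => H1.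
have := fu k.+1 t; rewrite exprS => H2.
rewrite -(subrKA (u k.+1 t)) (le_trans (ler_normD _ _))//.
rewrite [`|u k.+1 t - f t|]distrC.
have -> : u k.+1 = T (u k) by [].
move: H2; have -> : u k.+1 = T (u k) by [].
lra.
Qed.

(** For [t] below [a] the interval is empty and the value is 0, so this is a primitive only to the
    right of [a]. *)
Definition primitive (a : R) f (t : R) : 'rV[R]_n :=
  \row_j \int[lebesgue_measure]_(s in `[a, t]) f s 0 j.

Lemma is_derive_primitive (a t : R) f :
  (forall s, a <= s -> {for s, continuous f}) -> a < t ->
  is_derive t 1 (primitive a f) (f t).
Proof.
move=> fc at_; apply/is_derive_mxP => i j; rewrite ord1.
under eq_fun do rewrite mxE.
have fjc s : a <= s -> {for s, continuous (fun s => f s 0 j)}.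
  move=> as_; apply: (@continuous_comp _ _ _ f (fun M : 'rV[R]_n => M 0 j) s).
    exact: fc.
  exact: coord_continuous.
have [||||d1 d2] := @continuous_FTC1_closed R (fun s => f s 0 j) a t (t + 1) _ _ _ _.
- by rewrite ltrDl.
- apply: continuous_compact_integrable; first exact: segment_compact.
  apply: continuous_in_subspaceT => s; rewrite inE /= in_itv /= => /andP[as_ _].
  exact: fjc.
- by [].
- by apply: fjc; exact: ltW.
- by split; [exact: d1|rewrite -derive1E; exact: d2].
Qed.

End UniformFixpoint.

Lemma is_derive_line {R : realType} {W : normedModType R} (w : W) (t : R) :
  is_derive t 1 (fun s : R => s *: w) w.
Proof.
have H := is_diff_scalel t w.
split; first by apply: diff_derivable; exact: ex_diff.
by rewrite deriveE; [rewrite diff_val scale1r|exact: ex_diff].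
Qed.

(** * The two-point boundary value problem for equations quadratic in the velocity *)

Section BoundaryValueProblem.
Context {R : realType} {n : nat}.
Variables (F : 'rV[R]_n -> 'rV[R]_n -> 'rV[R]_n) (x0 : 'rV[R]_n) (r K : R).
Hypotheses (r0 : 0 < r) (K0 : 0 <= K).
(** These are the estimates of a quadratic form in the velocity whose coefficients are bounded and
    Lipschitz in the position. Their homogeneity makes the problem a contraction for nearby
    endpoints. *)
Hypothesis F_bound : forall x v, `|x - x0| <= r -> `|F x v| <= K * `|v| ^+ 2.
Hypothesis F_lip : forall x y v w, `|x - x0| <= r -> `|y - x0| <= r ->
  `|F x v - F y w| <= K * (`|x - y| * `|v| ^+ 2 + `|v - w| * (`|v| + `|w|)).

(** The interval [-1, 2] contains [0, 1] in its interior, so derivatives at the endpoints are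
    two-sided and the curve extends as [geodesic] demands. With d the distance of the endpoints, 4d
    is 2d for the straight line at times up to 2 plus 2d for its correction, and 2d is d plus d for
    the velocities. *)
Definition bvp_solution (x1 : 'rV[R]_n) (x dx ddx : R -> 'rV[R]_n) : Prop :=
  [/\ x 0 = x0, x 1 = x1 & forall t : R, -1 <= t <= 2 ->
    [/\ is_derive t 1 x (dx t), is_derive t 1 dx (ddx t),
        ddx t = F (x t) (dx t),
        `|x t - x0| <= 4 * `|x1 - x0| & `|dx t| <= 2 * `|x1 - x0| ]].

(** Freezing the time outside [-1, 2] lets the contraction act on curves that are bounded and
    Lipschitz on the whole line. *)
Let clip (t : R) : R := Num.max (-1) (Num.min t 2).

Let clip_in t : -1 <= clip t <= 2.
Proof. by rewrite /clip le_max lexx /= ge_max ge_min lexx orbT andbT; lra. Qed.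

Let clip_id t : -1 <= t <= 2 -> clip t = t.
Proof. by move=> /andP[t1 t2]; rewrite /clip min_l// max_r. Qed.

Let clip_lip s t : `|clip s - clip t| <= `|s - t|.
Proof.
have h1 := ler_norm (s - t); have h2 := ler_norm (t - s).
rewrite [`|t - s|]distrC in h2; rewrite ler_norml /clip.
have l12 : -1 <= 2 :> R by lra.
case: (leP s 2) => ?; case: (leP t 2) => ?; rewrite ?(max_r l12);
  try case: (leP (-1) s) => ?; try case: (leP (-1) t) => ?; apply/andP; split; lra.
Qed.

(* Corrects the straight line to a prescribed second derivative without moving the endpoints. *)
Lemma two_point_corrector : exists corr dcorr : (R -> 'rV[R]_n) -> R -> 'rV[R]_n,
  forall a : R -> 'rV[R]_n, continuous a -> [/\ corr a 0 = 0, corr a 1 = 0 &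
    forall t : R, -2 < t ->
      is_derive t 1 (corr a) (dcorr a t) /\ is_derive t 1 (dcorr a) (a t)].
Proof.
(* The base points lie to the left of -1 because a primitive is differentiated only beyond its base
   point; the inner base point is smaller so that the inner primitive is continuous from -2 on. *)
pose neg (a : R -> 'rV[R]_n) := primitive (-2) (primitive (-3) a).
exists (fun a t => neg a t - neg a 0 - t *: (neg a 1 - neg a 0)).
exists (fun a t => primitive (-3) a t - (neg a 1 - neg a 0)).
move=> a ac; split; first by rewrite subrr scale0r subr0.
  by rewrite scale1r subrr.
move=> t t2.
have D1 (s : R) : -3 < s -> is_derive s 1 (primitive (-3) a) (a s).
  move=> s3; apply: is_derive_primitive; last exact: s3.
  by move=> u _; exact: ac.
have D2 : is_derive t 1 (neg a) (primitive (-3) a t).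
  apply: is_derive_primitive; last exact: t2.
  move=> s s2; apply/differentiable_continuous/derivable1_diffP.
  have s3 : -3 < s by lra.
  exact: (@ex_derive _ _ _ _ _ _ _ (D1 s s3)).
have D3 : -3 < t by lra.
move: D2 (D1 t D3); move: (primitive _ _) (neg a) => p1 p2 D2 {}D1.
split.
- apply: is_derive_ext (is_deriveB (is_deriveB D2 (is_derive_cst (p2 0) t 1))
    (is_derive_line (p2 1 - p2 0) t)) _ _ => //.
  by rewrite subr0.
- apply: is_derive_ext (is_deriveB D1 (is_derive_cst (p2 1 - p2 0) t 1)) _ _ => //.
  by rewrite subr0.
Qed.

(** The unknown of the fixed point problem is the second derivative. The curve recovered from it by
    the corrector has the right endpoints automatically, and the equation says that the second
    derivative is reproduced. *)
Lemma bvp_exists : exists2 eta, 0 < eta &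
  forall x1, `|x1 - x0| < eta -> exists x dx ddx, bvp_solution x1 x dx ddx.
Proof.
move: (K0) (r0) => K_ge0 r_gt0.
have [corr [dcorr corrP]] := two_point_corrector.
(* For d below these bounds K d <= 1/96 and d <= 1. The contraction estimate below is K (36 d^2 + 12
   d) e, at most 48 e / 96 = e / 2. The bound r / 4 keeps curves within 4d of [x0] in the domain of
   the estimates on [F]. *)
exists (Num.min (Num.min (96 * (K + 1))^-1 1) (r / 4)).
  have K1 : 0 < 96 * (K + 1) by lra.
  by rewrite !lt_min invr_gt0 K1 ltr01 divr_gt0.
move=> x1; set d := `|x1 - x0|; rewrite !lt_min => /andP[/andP[d1 d2] d3].
have d0 : 0 <= d by exact: normr_ge0.
have Kd : K * d <= 96^-1.
  have : (K + 1) * d <= 96^-1.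
    rewrite mulrC -ler_pdivlMr; last lra.
    by rewrite -invfM ltW.
  by nra.
(* [rho] is the bound on [F] at speed 2d, and [L] below is the Lipschitz constant of [F] along a
   curve with speed at most 2d and acceleration at most [rho]. The 9 is the squared length of
   [-1, 2], from [two_point_bound]. *)
pose rho := 4 * K * d ^+ 2.
have rhod : 9 * rho <= 2 * d by rewrite /rho; nra.
have rho0 : 0 <= rho by rewrite /rho !mulr_ge0.
pose L := K * (2 * d * (2 * d) ^+ 2 + rho * (4 * d)).
have L0 : 0 <= L by rewrite /L mulr_ge0// addr_ge0// !mulr_ge0.
pose X (a : R -> 'rV[R]_n) (t : R) := x0 + t *: (x1 - x0) + corr a t.
pose dX (a : R -> 'rV[R]_n) (t : R) := (x1 - x0) + dcorr a t.
pose T (a : R -> 'rV[R]_n) (t : R) := F (X a (clip t)) (dX a (clip t)).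
have in2 (t : R) : -1 <= t <= 2 -> -2 < t by move=> /andP[? _]; lra.
have XP (a : R -> 'rV[R]_n) : bounded_lipschitz rho L a -> forall t : R, -1 <= t <= 2 ->
  [/\ is_derive t 1 (X a) (dX a t), is_derive t 1 (dX a) (a t),
      `|X a t - x0| <= 4 * d & `|dX a t| <= 2 * d].
  move=> [a1 a2] t t12; have ac := lipschitz_continuous a2.
  have [c0 c1 D] := corrP _ ac.
  have [D1 D2] := D t (in2 _ t12).
  have le1 : (-1 : R) <= 0 by lra.
  have le2 : (1 : R) <= 2 by lra.
  have [B1 B2] := two_point_bound le1 le2 c0 c1
    (fun s h => (D s (in2 s h)).1) (fun s h => (D s (in2 s h)).2)
    (fun s _ => a1 s) t12.
  split.
  - apply: is_derive_ext (is_deriveD (is_deriveD (is_derive_cst x0 t 1)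
      (is_derive_line (x1 - x0) t)) D1) _ _ => //.
    by rewrite add0r.
  - apply: is_derive_ext (is_deriveD (is_derive_cst (x1 - x0) t 1) D2) _ _ => //.
    by rewrite add0r.
  - rewrite /X -(addrA x0) addrAC subrr add0r (le_trans (ler_normD _ _))// normrZ -/d.
    have : `|t| * d <= 2 * d.
      by rewrite ler_wpM2r// ler_norml; move: t12 => /andP[? ?]; apply/andP; split; lra.
    by move: B2; lra.
  - rewrite /dX (le_trans (ler_normD _ _))// -/d; move: B1; lra.
have inr (x : 'rV[R]_n) : `|x - x0| <= 4 * d -> `|x - x0| <= r by move=> ?; lra.
have [f|f g e|a aQ aT] := contraction_fixpoint (T := T) rho0 L0.
- move=> fQ; split => [t|s t].
    have [_ _ h1 h2] := XP _ fQ _ (clip_in t).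
    rewrite (le_trans (F_bound _ (inr _ h1)))// /rho -mulrA [4 * _]mulrCA ler_wpM2l//.
    by have := normr_ge0 (dX f (clip t)); nra.
  have [_ _ h1 h2] := XP _ fQ _ (clip_in t).
  have [_ _ h3 h4] := XP _ fQ _ (clip_in s).
  rewrite (le_trans (F_lip _ _ (inr _ h3) (inr _ h1)))// /L -mulrA ler_wpM2l//.
  have b1 := MVT_norm (fun u hu => let: And4 p _ _ _ := XP _ fQ u hu in p)
     (fun u hu => let: And4 _ _ _ p := XP _ fQ u hu in p) (clip_in t) (clip_in s).
  have b2 := MVT_norm (fun u hu => let: And4 _ p _ _ := XP _ fQ u hu in p)
     (fun u hu => fQ.1 u) (clip_in t) (clip_in s).
  rewrite mulrDl; apply: lerD.
    rewrite mulrAC ler_pM//; last by rewrite ler_pXn2r// nnegrE ?mulr_ge0.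
    by rewrite (le_trans b1)// ler_wpM2l ?mulr_ge0 ?clip_lip.
  rewrite mulrAC ler_pM ?addr_ge0//.
    by rewrite (le_trans b2)// ler_wpM2l ?clip_lip.
  have -> : 4 * d = 2 * d + 2 * d by ring.
  exact: lerD h4 h2.
- move=> fQ gQ fge t.
  have ct := clip_in t.
  have [_ _ h1 h2] := XP _ fQ _ ct.
  have [_ _ h3 h4] := XP _ gQ _ ct.
  have e0 : 0 <= e by apply: le_trans (fge 0).
  rewrite (le_trans (F_lip _ _ (inr _ h1) (inr _ h3)))//.
  have [cf0 cf1 _] := corrP _ (lipschitz_continuous fQ.2).
  have [cg0 cg1 _] := corrP _ (lipschitz_continuous gQ.2).
  have z0 : X f 0 - X g 0 = 0 by rewrite /X cf0 cg0 subrr.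
  have z1 : X f 1 - X g 1 = 0 by rewrite /X cf1 cg1 subrr.
  have le1 : (-1 : R) <= 0 by lra.
  have le2 : (1 : R) <= 2 by lra.
  have [B1 B2] := two_point_bound (z := fun t => X f t - X g t)
     (dz := fun t => dX f t - dX g t) (ddz := fun t => f t - g t) le1 le2 z0 z1
    (fun u hu => is_deriveB (let: And4 p _ _ _ := XP _ fQ u hu in p)
         (let: And4 p _ _ _ := XP _ gQ u hu in p))
    (fun u hu => is_deriveB (let: And4 _ p _ _ := XP _ fQ u hu in p)
         (let: And4 _ p _ _ := XP _ gQ u hu in p)) (fun u _ => fge u) ct.
  set p := `|X f _ - _| in B2 *; set q := `|dX f _ - _| in B1 *.
  move: h2 h4; set v := `|dX f _|; set w := `|dX g _| => h2 h4.
  have v0 : 0 <= v by exact: normr_ge0.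
  have w0 : 0 <= w by exact: normr_ge0.
  have p0 : 0 <= p by exact: normr_ge0.
  have q0 : 0 <= q by exact: normr_ge0.
  have H1 : p * v ^+ 2 <= (9 * e) * (2 * d) ^+ 2.
    rewrite ler_pM// ?exprn_ge0//; first by move: B2; lra.
    by rewrite ler_pXn2r// nnegrE ?mulr_ge0.
  have H2 : q * (v + w) <= (3 * e) * (4 * d).
    apply: ler_pM => //; first exact: addr_ge0.
      by rewrite mulrC; apply: le_trans B1 _; lra.
    by have -> : 4 * d = 2 * d + 2 * d by [ring]; apply: lerD.
  apply: (@le_trans _ _ (K * ((9 * e) * (2 * d) ^+ 2 + (3 * e) * (4 * d)))).
    by rewrite ler_wpM2l// lerD.
  have H3 : K * d * e <= 96^-1 * e by rewrite ler_wpM2r.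
  have H4 : K * d * e * d <= 96^-1 * e * 1.
    by rewrite ler_pM// ?mulr_ge0// ltW.
  by lra.
have [c0 c1 _] := corrP _ (lipschitz_continuous aQ.2).
exists (X a), (dX a), a; split => [||t t12].
- by rewrite /X scale0r c0 !addr0.
- by rewrite /X scale1r c1 addr0 addrC subrK.
- have [h1 h2 h3 h4] := XP _ aQ _ t12; split => //.
  by rewrite -[LHS]aT /T clip_id.
Qed.

End BoundaryValueProblem.

(** * Functions that are Lipschitz near a point *)

Section LocallyLipschitz.
Context {R : realType}.

(** Stands in for smoothness in the estimates: it passes to products, inverses and composites by
    direct norm bounds, whereas [Ck] would have to be propagated through iterated partial
    derivatives. *)
Definition lip_near (V W : normedModType R) (x0 : V) (f : V -> W) : Prop :=
  exists r C : R, [/\ 0 < r, 0 <= C & forall x y, `|x - x0| < r -> `|y - x0| < r ->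
    `|f x - f y| <= C * `|x - y|].

Section Closure.
Context {V : normedModType R}.

Lemma lip_near_bounded (W : normedModType R) (x0 : V) (f : V -> W) : lip_near x0 f ->
  exists r B : R, [/\ 0 < r, 0 <= B & forall x, `|x - x0| < r -> `|f x| <= B].
Proof.
move=> [r [C [r0 C0 H]]]; exists r, (C * r + `|f x0|); split=> [//||x xr].
  by rewrite addr_ge0 ?mulr_ge0 // ltW.
rewrite -[f x](subrK (f x0)) (le_trans (ler_normD _ _))// lerD2r.
have /(_ x x0 xr) := H; rewrite subrr normr0 => /(_ r0) /le_trans; apply.
by rewrite ler_wpM2l// ltW.
Qed.

Lemma lip_near_cst (W : normedModType R) (x0 : V) (a : W) : lip_near x0 (fun=> a).
Proof. by exists 1, 0; split=> // x y _ _; rewrite subrr normr0 mul0r. Qed.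

Lemma lip_near_eq (W : normedModType R) (x0 : V) (f g : V -> W) (r : R) : 0 < r ->
  (forall x, `|x - x0| < r -> f x = g x) -> lip_near x0 f -> lip_near x0 g.
Proof.
move=> r0 fg [r' [C [r'0 C0 H]]]; exists (Num.min r r'), C; split=> // [|x y].
  by rewrite lt_min r0.
by rewrite !lt_min => /andP[x1 x2] /andP[y1 y2]; rewrite -!fg//; exact: H.
Qed.

Lemma lip_nearD (W : normedModType R) (x0 : V) (f g : V -> W) :
  lip_near x0 f -> lip_near x0 g -> lip_near x0 (fun x => f x + g x).
Proof.
move=> [r [C [r0 C0 H]]] [r' [C' [r'0 C'0 H']]]; exists (Num.min r r'), (C + C').
split=> // [|| x y]; rewrite ?lt_min ?r0 ?addr_ge0//.
move=> /andP[x1 x2] /andP[y1 y2]; rewrite opprD addrACA mulrDl.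
by rewrite (le_trans (ler_normD _ _))// lerD ?H ?H'.
Qed.

Lemma lip_nearZl (W : normedModType R) (x0 : V) (f : V -> R) (a : W) :
  lip_near x0 f -> lip_near x0 (fun x => f x *: a).
Proof.
move=> [r [C [r0 C0 H]]]; exists r, (C * `|a|); split=> [//||x y x1 y1].
  by rewrite mulr_ge0.
by rewrite -scalerBl normrZ mulrAC ler_wpM2r// H.
Qed.

Lemma lip_nearZ (W : normedModType R) (x0 : V) (a : R) (f : V -> W) :
  lip_near x0 f -> lip_near x0 (fun x => a *: f x).
Proof.
move=> [r [C [r0 C0 H]]]; exists r, (`|a| * C); split=> [//||x y x1 y1].
  by rewrite mulr_ge0.
by rewrite -scalerBr normrZ -mulrA ler_wpM2l// H.
Qed.

Lemma lip_nearN (W : normedModType R) (x0 : V) (f : V -> W) :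
  lip_near x0 f -> lip_near x0 (fun x => - f x).
Proof.
move=> H; apply: (lip_near_eq (r := 1)) (lip_nearZ (-1) H) => // x _.
by rewrite scaleN1r.
Qed.

Lemma lip_nearB (W : normedModType R) (x0 : V) (f g : V -> W) :
  lip_near x0 f -> lip_near x0 g -> lip_near x0 (fun x => f x - g x).
Proof. by move=> Hf Hg; apply: lip_nearD => //; exact: lip_nearN. Qed.

Lemma lip_nearM (x0 : V) (f g : V -> R) :
  lip_near x0 f -> lip_near x0 g -> lip_near x0 (fun x => f x * g x).
Proof.
move=> Hf Hg; have [rf [Bf [rf0 Bf0 Bfx]]] := lip_near_bounded Hf.
have [rg [Bg [rg0 Bg0 Bgx]]] := lip_near_bounded Hg.
move: Hf Hg => [r [C [r0 C0 H]]] [r' [C' [r'0 C'0 H']]].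
exists (Num.min (Num.min r r') (Num.min rf rg)), (Bf * C' + Bg * C); split.
- by rewrite !lt_min r0 r'0 rf0.
- by rewrite addr_ge0// mulr_ge0.
move=> x y; rewrite !lt_min => /andP[/andP[x1 x2] /andP[x3 x4]].
move=> /andP[/andP[y1 y2] /andP[y3 y4]].
have -> : f x * g x - f y * g y = f x * (g x - g y) + g y * (f x - f y) by ring.
rewrite (le_trans (ler_normD _ _))// !normrM mulrDl -!mulrA lerD// ler_pM//.
- exact: Bfx.
- exact: H'.
- exact: Bgx.
- exact: H.
Qed.

Lemma lip_near_sum (W : normedModType R) (x0 : V) (I : Type) (s : seq I) (P : pred I) (f : I -> V -> W) :
  (forall i, lip_near x0 (f i)) -> lip_near x0 (fun x => \sum_(i <- s | P i) f i x).
Proof.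
move=> H; elim: s => [|i s IH].
  by under eq_fun do rewrite big_nil; exact: lip_near_cst.
under eq_fun do rewrite big_cons.
by case: (P i) => //; apply: lip_nearD.
Qed.

Lemma lip_near_prod (x0 : V) (I : Type) (s : seq I) (P : pred I) (f : I -> V -> R) :
  (forall i, lip_near x0 (f i)) -> lip_near x0 (fun x => \prod_(i <- s | P i) f i x).
Proof.
move=> H; elim: s => [|i s IH].
  by under eq_fun do rewrite big_nil; exact: lip_near_cst.
under eq_fun do rewrite big_cons.
by case: (P i) => //; apply: lip_nearM.
Qed.

Lemma lip_nearV (x0 : V) (f : V -> R) : f x0 != 0 -> lip_near x0 f ->
  lip_near x0 (fun x => (f x)^-1).
Proof.
move=> fx0 [r [C [r0 C0 H]]].
have f0 : 0 < `|f x0| by rewrite normr_gt0.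
have C1 : 0 < 2 * (C + 1) by rewrite mulr_gt0// ltr_wpDl.
(* On this radius |f| stays above half of |f x0|, whence the factor 4 / |f x0|^2; adding 1 to [C]
   avoids a division by 0. *)
exists (Num.min r (`|f x0| / (2 * (C + 1)))), (C * 4 / `|f x0| ^+ 2).
have lo x : `|x - x0| < r -> `|x - x0| < `|f x0| / (2 * (C + 1)) -> `|f x0| / 2 <= `|f x|.
  move=> x1; rewrite ltr_pdivlMr// => x2.
  have /(_ x x0 x1) := H; rewrite subrr normr0 => /(_ r0) H1.
  have H2 : `|f x0| <= `|f x0 - f x| + `|f x|.
    by rewrite -{1}[f x0](subrK (f x)) ler_normD.
  rewrite distrC in H2.
  have := normr_ge0 (x - x0); move: x2 H1 H2 C0.
  move: (`|x - x0|) (`|f x - f x0|) (`|f x0|) (`|f x|) => a b c d *; nra.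
split.
- by rewrite lt_min r0 divr_gt0.
- by rewrite !mulr_ge0// invr_ge0 exprn_ge0.
move=> x y; rewrite !lt_min => /andP[x1 x2] /andP[y1 y2].
have := lo x x1 x2; have := lo y y1 y2 => ly lx.
have fx : 0 < `|f x| by apply: lt_le_trans lx; rewrite divr_gt0.
have fy : 0 < `|f y| by apply: lt_le_trans ly; rewrite divr_gt0.
have -> : (f x)^-1 - (f y)^-1 = (f y - f x) / (f x * f y).
  by field; rewrite -!normr_gt0 fx fy.
rewrite normrM normfV normrM ler_pdivrMr ?mulr_gt0// distrC.
apply: (le_trans (H x y x1 y1)).
have -> : C * 4 / `|f x0| ^+ 2 * `|x - y| * (`|f x| * `|f y|)
  = C * `|x - y| * ((`|f x| * `|f y|) / (`|f x0| / 2) ^+ 2).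
  by field; rewrite -normr_gt0 normr_id f0.
rewrite ler_peMr ?mulr_ge0// ler_pdivlMr ?exprn_gt0 ?divr_gt0// mul1r expr2.
by rewrite ler_pM// divr_ge0.
Qed.

Lemma lip_near_comp (U W : normedModType R) (z0 : U) (g : U -> V) (f : V -> W) :
  lip_near z0 g -> lip_near (g z0) f -> lip_near z0 (fun z => f (g z)).
Proof.
move=> [r [C [r0 C0 H]]] [r' [C' [r'0 C'0 H']]].
have C1 : 0 < C + 1 by rewrite ltr_wpDl.
exists (Num.min r (r' / (C + 1))), (C' * C); split.
- by rewrite lt_min r0 divr_gt0.
- exact: mulr_ge0.
have in' x : `|x - z0| < r -> `|x - z0| < r' / (C + 1) -> `|g x - g z0| < r'.
  move=> x1; rewrite ltr_pdivlMr// => x2.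
  have /(_ x z0 x1) := H; rewrite subrr normr0 => /(_ r0) /le_lt_trans; apply.
  by apply: le_lt_trans x2; rewrite mulrC ler_wpM2l// lerDl.
move=> x y; rewrite !lt_min => /andP[x1 x2] /andP[y1 y2].
rewrite (le_trans (H' _ _ (in' _ x1 x2) (in' _ y1 y2)))// -mulrA ler_wpM2l//.
exact: H.
Qed.

Lemma lip_near_mxP m n (x0 : V) (M : V -> 'M[R]_(m, n)) :
  lip_near x0 M <-> forall i j, lip_near x0 (fun x => M x i j).
Proof.
split=> [[r [C [r0 C0 H]]] i j|H].
  exists r, C; split=> // x y x1 y1; apply: le_trans (H x y x1 y1).
  by have := le_mx_norm (M x - M y) i j; rewrite !mxE.
apply: (lip_near_eq (r := 1) (f := fun x => \sum_i \sum_j M x i j *: delta_mx i j)) => //.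
  by move=> x _; rewrite -matrix_sum_delta.
by apply: lip_near_sum => i; apply: lip_near_sum => j; exact: lip_nearZl.
Qed.

Lemma lip_near_mulmx m n p (x0 : V) (M : V -> 'M[R]_(m, n)) (N : V -> 'M[R]_(n, p)) :
  lip_near x0 M -> lip_near x0 N -> lip_near x0 (fun x => M x *m N x).
Proof.
move=> /lip_near_mxP HM /lip_near_mxP HN; apply/lip_near_mxP => i j.
by under eq_fun do rewrite mxE; apply: lip_near_sum => k; exact: lip_nearM.
Qed.

Lemma lip_near_trmx m n (x0 : V) (M : V -> 'M[R]_(m, n)) :
  lip_near x0 M -> lip_near x0 (fun x => (M x)^T).
Proof.
by move=> /lip_near_mxP HM; apply/lip_near_mxP => i j; under eq_fun do rewrite mxE.
Qed.

Lemma lip_near_det n (x0 : V) (M : V -> 'M[R]_n) :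
  lip_near x0 M -> lip_near x0 (fun x => \det (M x)).
Proof.
move=> /lip_near_mxP HM; apply: lip_near_sum => s.
by apply: lip_nearM; [exact: lip_near_cst|exact: lip_near_prod].
Qed.

Lemma lip_near_invmx n (x0 : V) (M : V -> 'M[R]_n) : M x0 \in unitmx ->
  lip_near x0 M -> lip_near x0 (fun x => invmx (M x)).
Proof.
move=> Mu HM; have d0 : \det (M x0) != 0 by rewrite -unitfE -unitmxE.
have Hd := lip_near_det HM.
have [r [C [r0 C0 H]]] := Hd.
have HV := lip_nearV d0 Hd.
have Hadj : lip_near x0 (fun x => \adj (M x)).
  apply/lip_near_mxP => i j; under eq_fun do rewrite mxE.
  apply: lip_nearM; first exact: lip_near_cst.
  apply: lip_near_det; apply/lip_near_mxP => k l.
  by under eq_fun do rewrite !mxE; move/lip_near_mxP : HM; exact.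
have f0 : 0 < `|\det (M x0)| by rewrite normr_gt0.
have C1 : 0 < C + 1 by rewrite ltr_wpDl.
apply: (lip_near_eq (r := Num.min r (`|\det (M x0)| / (C + 1)))
  (f := fun x => (\det (M x))^-1 *: \adj (M x))).
- by rewrite lt_min r0 divr_gt0.
- move=> x; rewrite lt_min ltr_pdivlMr// => /andP[x1 x2].
  rewrite /invmx unitmxE unitfE ifT//; apply/negP => /eqP E.
  have := H x x0 x1; rewrite subrr normr0 => /(_ r0).
  rewrite E sub0r normrN; apply/negP; rewrite -ltNge.
  by apply: le_lt_trans x2; rewrite mulrC ler_wpM2l// lerDl.
- apply/lip_near_mxP => i j; under eq_fun do rewrite mxE.
  by apply: lip_nearM => //; move/lip_near_mxP : Hadj; exact.
Qed.

End Closure.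
End LocallyLipschitz.

(** * Smooth maps: Lipschitz and first-order Taylor estimates *)

Section Smooth.
Context {R : realType} {n : nat}.
Implicit Types (D : set 'rV[R]_n) (x y u v : 'rV[R]_n).

Lemma open_ball_in D (x0 : 'rV[R]_n) : open D -> D x0 ->
  exists2 r : R, 0 < r & forall x, `|x - x0| < r -> D x.
Proof.
move=> oD Dx0; have /nbhs_ballP[r r0 H] := open_nbhs_nbhs (conj oD Dx0).
by exists r => // x xr; apply: H; rewrite -ball_normE /= distrC.
Qed.

Section Target.
Context {W : normedModType R}.
Implicit Types (f : 'rV[R]_n -> W).

Lemma smooth_diff D f x : smooth_on D f -> D x -> differentiable f x.
Proof. by move=> /(_ 1%N)[H _]; exact: H. Qed.

Lemma smooth_partial D f i : smooth_on D f -> smooth_on D ('D_(basis_vec i) f).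
Proof. by move=> H k; have [_] := H k.+1; apply. Qed.

Lemma smooth_on_sub D D' f : D' `<=` D -> smooth_on D f -> smooth_on D' f.
Proof.
move=> DD' H k; have := H k; elim: k f {H} => [|k IH] f /=.
  by move=> H x; rewrite inE => /DD' Dx; apply: H; rewrite inE.
by move=> [H1 H2]; split=> [x /DD'|i]; [exact: H1|exact: IH].
Qed.

Lemma derive_partials f x v : differentiable f x ->
  'D_v f x = \sum_i v 0 i *: 'D_(basis_vec i) f x.
Proof.
move=> df; rewrite deriveE// {1}[v]row_sum_delta linear_sum /=.
by apply: eq_bigr => i _; rewrite linearZ /= deriveE.
Qed.

End Target.

Section MatrixTarget.
Context {p q : nat}.
Implicit Types (f : 'rV[R]_n -> 'M[R]_(p, q)).

Lemma is_derive_segment f x y (s : R) : differentiable f (y + s *: (x - y)) ->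
  is_derive s 1 (fun s : R => f (y + s *: (x - y))) ('D_(x - y) f (y + s *: (x - y))).
Proof.
move=> df; have D : is_derive s 1 (fun s : R => y + s *: (x - y)) (x - y).
  have := is_deriveD (is_derive_cst y s 1) (is_derive_line (x - y) s).
  by rewrite add0r.
exact: (is_derive_comp_diff D).
Qed.

Lemma segment_ball (x0 x y : 'rV[R]_n) (s r : R) : 0 <= s <= 1 ->
  `|x - x0| < r -> `|y - x0| < r -> `|y + s *: (x - y) - x0| < r.
Proof.
move=> /andP[s0 s1] xr yr.
have -> : y + s *: (x - y) - x0 = s *: (x - x0) + (1 - s) *: (y - x0).
  by apply/rowP => i; rewrite !mxE; ring.
rewrite (le_lt_trans (ler_normD _ _))// !normrZ !ger0_norm ?subr_ge0//.
move: xr yr; move: `|x - x0| `|y - x0| => a b ? ?.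
have [->|s2] := eqVneq s 0; first lra.
have s3 : 0 < s by rewrite lt_neqAle eq_sym s2.
nra.
Qed.

Lemma derive_norm_le f x v (B : R) : differentiable f x ->
  (forall i, `|'D_(basis_vec i) f x| <= B) -> `|'D_v f x| <= n%:R * B * `|v|.
Proof.
move=> df HB; rewrite derive_partials// (le_trans (ler_norm_sum _ _ _))//.
rewrite -mulrA -[X in X%:R * _](card_ord n) mulr_natl -sumr_const ler_sum// => k _.
by rewrite normrZ mulrC ler_pM// le_mx_norm.
Qed.

(** Finitely many local bounds are merged by taking the minimum of the radii and the sum of the
    constants, whence the monotonicity assumption. Estimates on pairs of points fit by taking a
    product for [V]. *)
Lemma common_radius (I : finType) (V : normedModType R) (x0 : V) (P : I -> R -> V -> Prop) :
  (forall i (B B' : R) (x : V), B <= B' -> P i B x -> P i B' x) ->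
  (forall i, exists r B : R, [/\ 0 < r, 0 <= B & forall x : V, `|x - x0| < r -> P i B x]) ->
  exists r B : R, [/\ 0 < r, 0 <= B & forall i (x : V), `|x - x0| < r -> P i B x].
Proof.
move=> Pm H.
have [r [B [r0 B0 HrB]]] : exists r B : R, [/\ 0 < r, 0 <= B &
    forall i, i \in enum I -> forall x : V, `|x - x0| < r -> P i B x].
  elim: (enum I) => [|i s [r [B [r0 B0 IH]]]]; first by exists 1, 0.
  have [r' [B' [r'0 B'0 IH']]] := H i.
  exists (Num.min r r'), (B + B'); split; rewrite ?lt_min ?r0 ?addr_ge0//.
  move=> j; rewrite inE => /orP[/eqP ->|js] x; rewrite lt_min => /andP[x1 x2].
    by apply: Pm (IH' x x2); rewrite lerDr.
  by apply: Pm (IH j js x x1); rewrite lerDl.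
by exists r, B; split=> // i; apply: HrB; rewrite mem_enum.
Qed.

Lemma C1_lip_near D f (x0 : 'rV[R]_n) : open D -> D x0 -> Ck 1 D f -> lip_near x0 f.
Proof.
move=> oD Dx0 [df cf].
have [r1 r10 rD] := open_ball_in oD Dx0.
have [i|r [B [r0 B0 HB]]] := @common_radius 'I_n _ x0
  (fun i B x => `|'D_(basis_vec i) f x| <= B) (fun i B B' x h h' => le_trans h' h).
  have /cvgrPdist_le/(_ 1 ltr01) := cf i x0 (mem_set Dx0).
  move=> /nbhs_ballP[r r0 Hr]; exists r, (1 + `|'D_(basis_vec i) f x0|).
  split=> [//||x xr]; first exact: addr_ge0.
  have := Hr x; rewrite -ball_normE /= distrC => /(_ xr) => H.
  rewrite -['D__ f x](subrK ('D_(basis_vec i) f x0)) (le_trans (ler_normD _ _))//.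
  by rewrite lerD2r distrC.
exists (Num.min r1 r), (n%:R * B); split; rewrite ?lt_min ?r10 ?mulr_ge0// => x y.
rewrite !lt_min => /andP[x1 x2] /andP[y1 y2].
have Dseg (s : R) : 0 <= s <= 1 -> differentiable f (y + s *: (x - y)).
  by move=> s01; apply: df; apply: rD; exact: segment_ball.
have := @MVT_norm R p q (fun s : R => f (y + s *: (x - y)))
   (fun s => 'D_(x - y) f (y + s *: (x - y))) 0 1 (n%:R * B * `|x - y|)
   (fun s h => is_derive_segment (Dseg s h)).
have H s : 0 <= s <= 1 -> `|'D_(x - y) f (y + s *: (x - y))| <= n%:R * B * `|x - y|.
  move=> s01; apply: derive_norm_le; first exact: Dseg.
  by move=> i; apply: HB; exact: segment_ball.
move=> /(_ H 0 1); rewrite scale0r addr0 scale1r [y + _]addrC subrK subr0 normr1 mulr1.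
by apply; rewrite lexx ler01.
Qed.

Lemma smooth_lip_near D f (x0 : 'rV[R]_n) : open D -> D x0 -> smooth_on D f -> lip_near x0 f.
Proof. by move=> oD Dx0 H; exact: C1_lip_near oD Dx0 (H 1%N). Qed.

Lemma taylor1 D f (x0 : 'rV[R]_n) : open D -> D x0 -> smooth_on D f ->
  exists r C : R, [/\ 0 < r, 0 <= C & forall x y, `|x - x0| < r -> `|y - x0| < r ->
    `|f x - f y - 'D_(x - y) f y| <= C * `|x - y| ^+ 2].
Proof.
move=> oD Dx0 sf.
have [r1 r10 rD] := open_ball_in oD Dx0.
have Hp i : lip_near x0 ('D_(basis_vec i) f).
  by apply: (smooth_lip_near oD Dx0); exact: smooth_partial.
have [i B B' z h h'|i|r [B [r0 B0 HB]]] := @common_radius 'I_n _ (x0, x0)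
  (fun i B z => `|'D_(basis_vec i) f z.1 - 'D_(basis_vec i) f z.2| <= B * `|z.1 - z.2|).
- by apply: le_trans h' _; rewrite ler_wpM2r.
- have [r [C [r0 C0 H]]] := Hp i; exists r, C; split=> // z.
  by rewrite prod_normE/= gt_max => /andP[h1 h2]; exact: H.
have HB' i x y : `|x - x0| < r -> `|y - x0| < r ->
    `|'D_(basis_vec i) f x - 'D_(basis_vec i) f y| <= B * `|x - y|.
  by move=> x1 x2; apply: (HB i (x, y)); rewrite prod_normE /= gt_max x1.
exists (Num.min r1 r), (n%:R * B); split; rewrite ?lt_min ?r10 ?mulr_ge0// => x y.
rewrite !lt_min => /andP[x1 x2] /andP[y1 y2].
have Dseg (s : R) : 0 <= s <= 1 -> differentiable f (y + s *: (x - y)).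
  by move=> s01; apply: (smooth_diff sf); apply: rD; exact: segment_ball.
have Dy : differentiable f y by apply: (smooth_diff sf); exact: rD.
(* Subtracting the linear term in [s] makes the remainder an increment whose derivative is a
   difference of first derivatives; their Lipschitz bound contributes the second factor of |x -
   y|. *)
have := @MVT_norm R p q (fun s : R => f (y + s *: (x - y)) - s *: 'D_(x - y) f y)
   (fun s => 'D_(x - y) f (y + s *: (x - y)) - 'D_(x - y) f y) 0 1 (n%:R * B * `|x - y| ^+ 2)
   (fun s h => is_deriveB (is_derive_segment (Dseg s h)) (is_derive_line _ s)).
have H s : 0 <= s <= 1 ->
    `|'D_(x - y) f (y + s *: (x - y)) - 'D_(x - y) f y| <= n%:R * B * `|x - y| ^+ 2.
  move=> s01; rewrite !derive_partials//; last exact: Dseg.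
  rewrite -sumrB (le_trans (ler_norm_sum _ _ _))//.
  rewrite -mulrA -[X in X%:R * _](card_ord n) mulr_natl -sumr_const ler_sum// => k _.
  rewrite -scalerBr normrZ expr2 mulrA mulrC ler_pM//; last exact: le_mx_norm.
  apply: (le_trans (HB' _ _ _ _ _)) => //; first exact: segment_ball.
  rewrite ler_wpM2l// addrC addKr normrZ ler_piMl//.
  by move: s01 => /andP[? ?]; rewrite ger0_norm.
move=> /(_ H 0 1).
rewrite scale0r addr0 !scale1r [y + _]addrC subrK !subr0 scale0r subr0 normr1 mulr1.
by rewrite addrAC; apply; rewrite lexx ler01.
Qed.

End MatrixTarget.
End Smooth.

(** * Symmetry of second partial derivatives *)

(** Uniqueness of the coefficient of h^2: divide h^2 |a - b| <= (C1 + C2) h^3 by h^2 and take h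
    small. *)
Lemma eq_quadratic_term {R : realType} {p q : nat} (a b : 'M[R]_(p, q))
    (d : R -> 'M[R]_(p, q)) (r1 C1 r2 C2 : R) :
  0 < r1 -> 0 <= C1 -> 0 < r2 -> 0 <= C2 ->
  (forall h, 0 < h < r1 -> `|d h - (h * h) *: a| <= C1 * (h * h) * h) ->
  (forall h, 0 < h < r2 -> `|d h - (h * h) *: b| <= C2 * (h * h) * h) -> a = b.
Proof.
move=> r10 C10 r20 C20 H1 H2.
apply/eqP; rewrite -subr_eq0 -normr_le0; apply/ler_addgt0Pl => e e0; rewrite addr0.
have C0 : 0 < C1 + C2 + 1 by rewrite ltr_wpDl// addr_ge0.
have [h [h0 hr1 hr2 he]] : exists h : R, [/\ 0 < h, h < r1, h < r2 & (C1 + C2) * h <= e].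
  exists (Num.min (Num.min r1 r2 / 2) (e / (C1 + C2 + 1))).
  have h0 : 0 < Num.min (Num.min r1 r2 / 2) (e / (C1 + C2 + 1)).
    by rewrite lt_min !divr_gt0// lt_min r10.
  have hr : Num.min (Num.min r1 r2 / 2) (e / (C1 + C2 + 1)) < Num.min r1 r2.
    rewrite (@le_lt_trans _ _ (Num.min r1 r2 / 2))// ?ge_min ?lexx//.
    by rewrite ltr_pdivrMr// ltr_pMr ?lt_min ?r10// ltr1n.
  have he : Num.min (Num.min r1 r2 / 2) (e / (C1 + C2 + 1)) <= e / (C1 + C2 + 1).
    by rewrite ge_min lexx orbT.
  move: h0 hr he; move: (Num.min _ (e / _)) => h h0; rewrite lt_min => /andP[hr1 hr2].
  rewrite ler_pdivlMr// => he; split=> //; apply: le_trans he.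
  by rewrite mulrC ler_wpM2l ?(ltW h0)// lerDl.
have {}H1 : `|d h - (h * h) *: a| <= C1 * (h * h) * h by apply: H1; rewrite h0.
have {}H2 : `|d h - (h * h) *: b| <= C2 * (h * h) * h by apply: H2; rewrite h0.
have hh : 0 < h * h by exact: mulr_gt0.
have E : (h * h) *: (a - b) = (d h - h * h *: b) - (d h - h * h *: a).
  by apply/matrixP => k l; rewrite !mxE; ring.
have : `|(h * h) *: (a - b)| <= C2 * (h * h) * h + C1 * (h * h) * h.
  by rewrite E (le_trans (ler_normB _ _))// lerD.
have -> : C2 * (h * h) * h + C1 * (h * h) * h = h * h * ((C1 + C2) * h) by ring.
rewrite normrZ gtr0_norm// ler_pM2l// => /le_trans; exact.
Qed.

Section Schwarz.
Context {R : realType} {n p q : nat}.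
Variables (D : set 'rV[R]_n) (f : 'rV[R]_n -> 'M[R]_(p, q)) (x : 'rV[R]_n).
Hypotheses (oD : open D) (Dx : D x) (sf : smooth_on D f).

Lemma norm_basis_vec (i : 'I_n) : `|basis_vec i : 'rV[R]_n| <= 1.
Proof. by apply: mx_norm_le => // a b; rewrite mxE; case: (_ && _); rewrite ?normr1 ?normr0. Qed.

(** The mixed difference is the increment over [0, h] of s -> f (x + s u + h v) - f (x + s u). Its
    derivative is an increment of [g] along v, which is expanded by Taylor at x + s u; Lipschitz
    continuity of the derivative of [g] along v then moves the base point to x. *)
Lemma mixed_difference (i j : 'I_n) : exists r C : R, [/\ 0 < r, 0 <= C &
  forall h : R, 0 < h < r ->
   `|f (x + h *: basis_vec i + h *: basis_vec j) - f (x + h *: basis_vec i)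
     - (f (x + h *: basis_vec j) - f x)
     - (h * h) *: 'D_(basis_vec j) ('D_(basis_vec i) f) x| <= C * (h * h) * h].
Proof.
set u : 'rV[R]_n := basis_vec i; set v : 'rV[R]_n := basis_vec j.
set g := 'D_u f.
have sg : smooth_on D g by exact: smooth_partial.
have [r1 r10 rD] := open_ball_in oD Dx.
have [r2 [C2 [r20 C20 H2]]] := taylor1 oD Dx sg.
have [r3 [C3 [r30 C30 H3]]] := smooth_lip_near oD Dx (smooth_partial j sg).
exists (Num.min r1 (Num.min r2 r3) / 2), (C2 + C3); split.
- by rewrite divr_gt0// !lt_min r10 r20.
- exact: addr_ge0.
move=> h /andP[h0]; rewrite ltr_pdivlMr// !lt_min => /andP[h1 /andP[h2 h3]].
have bnd (s w : R) : 0 <= s <= h -> 0 <= w <= h -> `|x + s *: u + w *: v - x| <= h * 2.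
  move=> /andP[s0 sh] /andP[w0 wh]; rewrite -(addrA x) addrAC subrr add0r.
  rewrite (le_trans (ler_normD _ _))// !normrZ !ger0_norm//.
  have := norm_basis_vec i; have := norm_basis_vec j; rewrite -/u -/v.
  by have := normr_ge0 u; have := normr_ge0 v; move: `|u| `|v| => *; nra.
have hh : 0 <= h <= h by rewrite lexx ltW.
have h00 : (0 : R) <= 0 <= h by rewrite lexx ltW.
have dcomp (w s : R) : 0 <= s <= h -> 0 <= w <= h ->
    is_derive s 1 (fun s : R => f (x + s *: u + w *: v)) (g (x + s *: u + w *: v)).
  move=> sh wh.
  have Dl : is_derive s 1 (fun s : R => x + s *: u + w *: v) u.
    have := is_deriveD (is_deriveD (is_derive_cst x s 1) (is_derive_line u s)) (is_derive_cst (w *: v) s 1).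
    by rewrite add0r addr0.
  apply: (is_derive_comp_diff Dl); apply: (smooth_diff sf); apply: rD.
  by apply: le_lt_trans h1; exact: bnd.
have bs (s : R) : 0 <= s <= h -> `|x + s *: u - x| <= h * 2.
  by move=> sh; have := bnd s 0 sh h00; rewrite scale0r addr0.
set L := 'D_v g x.
have := @MVT_norm R p q (fun s : R => f (x + s *: u + h *: v) - f (x + s *: u) - s *: (h *: L))
  (fun s : R => g (x + s *: u + h *: v) - g (x + s *: u) - h *: L) 0 h ((C2 + C3) * (h * h)).
have Hd (s : R) : 0 <= s <= h -> is_derive s 1
  (fun s : R => f (x + s *: u + h *: v) - f (x + s *: u) - s *: (h *: L))
  (g (x + s *: u + h *: v) - g (x + s *: u) - h *: L).
  move=> sh; have d0 := dcomp 0 s sh h00.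
  apply: is_deriveB (is_derive_line _ _); apply: is_deriveB; first exact: dcomp.
  apply: is_derive_ext d0 _ _ => [y|]; by rewrite scale0r addr0.
have Hb (s : R) : 0 <= s <= h ->
    `|g (x + s *: u + h *: v) - g (x + s *: u) - h *: L| <= (C2 + C3) * (h * h).
  move=> sh; have b1 := bnd s h sh hh; have b2 := bs s sh.
  have dg : differentiable g (x + s *: u).
    by apply: (smooth_diff sg); apply: rD; exact: le_lt_trans h1.
  have nv : `|h *: v| <= h.
    by rewrite normrZ gtr0_norm// ler_piMr ?norm_basis_vec// ltW.
  have E1 := H2 _ _ (le_lt_trans b1 h2) (le_lt_trans b2 h2).
  have Ev : x + s *: u + h *: v - (x + s *: u) = h *: v by rewrite addrAC subrr add0r.
  rewrite Ev in E1.
  have E2 := H3 _ x (le_lt_trans b2 h3); rewrite subrr normr0 in E2.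
  have {}E2 := E2 r30.
  have EZ : 'D_(h *: v) g (x + s *: u) = h *: 'D_v g (x + s *: u).
    by rewrite !deriveE// linearZ.
  rewrite EZ in E1.
  rewrite -(subrKA (h *: 'D_v g (x + s *: u))) -scalerBr.
  rewrite (le_trans (ler_normD _ _))// mulrDl lerD//.
    by apply: (le_trans E1); rewrite ler_wpM2l// expr2 ler_pM.
  rewrite normrZ gtr0_norm// mulrCA ler_wpM2l ?(ltW h0)//.
  apply: (le_trans E2); rewrite ler_wpM2l// addrAC subrr add0r normrZ.
  move: sh => /andP[s0 sh]; rewrite ger0_norm//.
  by rewrite (le_trans _ sh)// ler_piMr// norm_basis_vec.
move=> /(_ Hd Hb 0 h h00 hh); rewrite subr0 gtr0_norm// scalerA !scale0r subr0 addr0.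
by rewrite addrAC.
Qed.

(** The mixed difference is symmetric in [i] and [j], so both second derivatives are its coefficient
    of h^2. *)
Lemma partialC (i j : 'I_n) :
  'D_(basis_vec j) ('D_(basis_vec i) f) x = 'D_(basis_vec i) ('D_(basis_vec j) f) x.
Proof.
have [r1 [C1 [r10 C10 H1]]] := mixed_difference i j.
have [r2 [C2 [r20 C20 H2]]] := mixed_difference j i.
apply: (eq_quadratic_term r10 C10 r20 C20 H1) => h hr.
have := H2 h hr; rewrite (addrAC x).
set A := f _; set B := f _; set C := f _; set E := f _.
by have -> : A - B - (C - E) = A - C - (B - E) by apply/matrixP => k l; rewrite !mxE; ring.
Qed.

End Schwarz.

(** * Geodesic equation, lowered acceleration and second fundamental form in coordinates *)

Section Levi_Civita.
Context {R : realType} {n : nat}.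
Implicit Types (G : 'rV[R]_n -> 'M[R]_n) (x u v a : 'rV[R]_n).

Definition geodesic_rhs G x v : 'rV[R]_n :=
  \row_k - \sum_i \sum_j christoffel G x k i j * v 0 i * v 0 j.

(* The covariant acceleration of a curve with velocity [v] and second derivative
   [a], with its index lowered and evaluated on [u]; no inverse metric occurs. *)
Definition lowered_acc G x v a u : R :=
  bilin (G x) a u + bilin ('D_v G x) v u - 2^-1 * bilin ('D_u G x) v v.

Lemma derive_entry (W : normedModType R) p q (M : W -> 'M[R]_(p, q)) (x v : W) i j :
  derivable M x v -> 'D_v (fun y => M y i j) x = 'D_v M x i j.
Proof. by move=> H; rewrite derive_mx// mxE. Qed.

Lemma derive_entryE G x v i j : differentiable G x ->
  'D_v G x i j = \sum_k v 0 k * 'D_(basis_vec k) G x i j.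
Proof.
by move=> dG; rewrite derive_partials// summxE; apply: eq_bigr => k _; rewrite mxE.
Qed.

Lemma bilin_derive G x u v w : differentiable G x ->
  bilin ('D_u G x) v w = \sum_k u 0 k * bilin ('D_(basis_vec k) G x) v w.
Proof.
move=> dG; rewrite derive_partials// /bilin mulmx_sumr mulmx_suml summxE.
by apply: eq_bigr => k _; rewrite -scalemxAr -scalemxAl mxE.
Qed.

(** Lowering the index cancels the inverse metric in the Christoffel symbols. Of the three
    derivatives of the metric the first two agree after exchanging the summation indices, since both
    are contracted with [v]. *)
Lemma bilin_geodesic_rhs G x v u : differentiable G x -> (G x)^T = G x -> G x \in unitmx ->
  bilin (G x) (geodesic_rhs G x v) u
  = 2^-1 * bilin ('D_u G x) v v - bilin ('D_v G x) v u.
Proof.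
move=> dG sG uG.
have dd k i j : 'D_(basis_vec k) (fun y => G y i j) x = 'D_(basis_vec k) G x i j.
  by apply: derive_entry; exact: diff_derivable.
(* The Christoffel symbols of the first kind, contracted twice with [v]. *)
pose c : 'rV[R]_n := \row_l \sum_i \sum_j 2^-1 *
  ('D_(basis_vec i) G x j l + 'D_(basis_vec j) G x i l - 'D_(basis_vec l) G x i j)
  * v 0 i * v 0 j.
have -> : geodesic_rhs G x v = - (c *m (invmx (G x))^T).
  apply/rowP => k; rewrite !mxE; congr (- _).
  transitivity (\sum_i \sum_j \sum_l (2^-1 *
    ('D_(basis_vec i) G x j l + 'D_(basis_vec j) G x i l - 'D_(basis_vec l) G x i j)
    * v 0 i * v 0 j) * invmx (G x) k l).
    apply: eq_bigr => i _; apply: eq_bigr => j _; rewrite /christoffel mulr_sumr !mulr_suml.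
    by apply: eq_bigr => l _; rewrite !dd; ring.
  rewrite [RHS](eq_bigr (fun l => \sum_i \sum_j (2^-1 *
    ('D_(basis_vec i) G x j l + 'D_(basis_vec j) G x i l - 'D_(basis_vec l) G x i j)
    * v 0 i * v 0 j) * invmx (G x) k l)); last first.
    move=> l _; rewrite !mxE mulr_suml; apply: eq_bigr => i _.
    by rewrite mulr_suml; apply: eq_bigr.
  rewrite [RHS]exchange_big; apply: eq_bigr => i _ /=.
  by rewrite exchange_big.
have E : (invmx (G x))^T *m G x = 1%:M.
  by rewrite -{2}sG -trmx_mul mulmxV// trmx1.
have -> : bilin (G x) (- (c *m (invmx (G x))^T)) u = - \sum_l c 0 l * u 0 l.
  rewrite bilinNl /bilin; congr (- _).
  rewrite -(mulmxA c) E mulmx1 mxE; apply: eq_bigr => l _.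
  by rewrite [u^T _ _]mxE.
rewrite -[RHS]opprB; congr (- _).
rewrite [bilin ('D_u G x) v v]bilin_derive// mulr_sumr.
have -> : bilin ('D_v G x) v u = \sum_l (v *m 'D_v G x) 0 l * u 0 l.
  by rewrite /bilin mxE; apply: eq_bigr => l _; rewrite [u^T _ _]mxE.
rewrite -sumrB; apply: eq_bigr => l _; rewrite mxE.
transitivity (((v *m 'D_v G x) 0 l - 2^-1 * bilin ('D_(basis_vec l) G x) v v) * u 0 l);
  last by ring.
congr (_ * _).
transitivity (2^-1 * ((v *m 'D_v G x) 0 l + (v *m 'D_v G x) 0 l - bilin ('D_(basis_vec l) G x) v v));
  last by field.
have E1 : (v *m 'D_v G x) 0 l = \sum_i \sum_j 'D_(basis_vec j) G x i l * v 0 i * v 0 j.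
  rewrite [LHS]mxE; apply: eq_bigr => i _; rewrite derive_entryE// mulr_sumr.
  by apply: eq_bigr => j _; ring.
have E2 : (v *m 'D_v G x) 0 l = \sum_i \sum_j 'D_(basis_vec i) G x j l * v 0 j * v 0 i.
  by rewrite E1 exchange_big.
rewrite {1}E2 {1}E1 bilinE -big_split -sumrB mulr_sumr /=.
apply: eq_bigr => i _; rewrite -big_split -sumrB mulr_sumr /=.
by apply: eq_bigr => j _; ring.
Qed.

Lemma lowered_acc_geodesic G x v u : differentiable G x -> (G x)^T = G x ->
  G x \in unitmx -> lowered_acc G x v (geodesic_rhs G x v) u = 0.
Proof. by move=> dG sG uG; rewrite /lowered_acc bilin_geodesic_rhs//; ring. Qed.

Lemma is_derive_speed2 G (x v : R -> 'rV[R]_n) (t : R) a :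
  differentiable G (x t) -> (G (x t))^T = G (x t) ->
  is_derive t 1 x (v t) -> is_derive t 1 v a ->
  is_derive t 1 (fun s => bilin (G (x s)) (v s) (v s)) (2 * lowered_acc G (x t) (v t) a (v t)).
Proof.
move=> dG sG dx dv.
apply: is_derive_ext (is_derive_bilin (is_derive_comp_diff dx dG) dv dv) _ _ => //.
by rewrite /lowered_acc [bilin _ (v t) a]bilin_sym//; field.
Qed.

Lemma derive_sym G x u : (\forall y \near x, (G y)^T = G y) -> derivable G x u ->
  ('D_u G x)^T = 'D_u G x.
Proof.
move=> sG dG; have := is_derive_trmx (derivableP dG).
move=> [_ <-]; exact: near_eq_derive.
Qed.

(** The last hypothesis is the derivative of g(X', n) = 0 along a curve with velocity [v] and second
    derivative [a]. It trades the normal part of [a] for the derivative of [nu], which the second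
    fundamental form contains. *)
Lemma second_form_lowered_acc G (nu : 'rV[R]_n -> 'rV[R]_n) x v a :
  differentiable G x -> differentiable nu x ->
  (\forall y \near x, (G y)^T = G y) -> G x \in unitmx ->
  bilin (G x) v (nu x) = 0 ->
  bilin ('D_v G x) v (nu x) + bilin (G x) a (nu x) + bilin (G x) v ('D_v nu x) = 0 ->
  lowered_acc G x v a (nu x) = - second_form G nu x v v.
Proof.
move=> dG dnu sG uG vn0 dvn0.
have sGx : (G x)^T = G x by exact: nbhs_singleton sG.
have sD : ('D_v G x)^T = 'D_v G x.
  by apply: derive_sym => //; exact: diff_derivable.
rewrite /second_form /tangential vn0 scale0r subr0.
set c := \matrix_(_, _) _.
(* Evaluated twice on the same vector, the symmetrization has no effect. *)
have -> : bilin c v v = \sum_a \sum_b cov_deriv G nu x a b * v 0 a * v 0 b.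
  set s := RHS; have E : s = \sum_a \sum_b cov_deriv G nu x b a * v 0 a * v 0 b.
    rewrite /s exchange_big; apply: eq_bigr => i _; apply: eq_bigr => j _; ring.
  transitivity (2^-1 * (s + s)); last by field.
  rewrite {2}E /s bilinE -big_split mulr_sumr; apply: eq_bigr => i _ /=.
  rewrite -big_split mulr_sumr; apply: eq_bigr => j _ /=.
  by rewrite mxE; ring.
have dl u : is_derive x u (lower G nu) ('D_u nu x *m G x + nu x *m 'D_u G x).
  by apply: is_derive_mulmx; apply: derivableP; exact: diff_derivable.
have low (b k : 'I_n) : 'D_(basis_vec b) (fun y => lower G nu y 0 k) x
    = ('D_(basis_vec b) nu x *m G x + nu x *m 'D_(basis_vec b) G x) 0 k.
  by have [] := dl (basis_vec b) => d1 <-; rewrite derive_entry.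
(* The Christoffel term of the covariant derivative is the right-hand side of the geodesic equation
   paired with the lowered normal, so the identity for [bilin_geodesic_rhs] applies to it. *)
have -> : \sum_a \sum_b cov_deriv G nu x a b * v 0 a * v 0 b
  = bilin (G x) ('D_v nu x) v + bilin ('D_v G x) (nu x) v
    + \sum_k geodesic_rhs G x v 0 k * lower G nu x 0 k.
  have -> : bilin (G x) ('D_v nu x) v + bilin ('D_v G x) (nu x) v = \sum_a \sum_b
      ('D_(basis_vec b) nu x *m G x + nu x *m 'D_(basis_vec b) G x) 0 a * v 0 a * v 0 b.
    transitivity ((('D_v nu x *m G x + nu x *m 'D_v G x) *m v^T) 0 0).
      by rewrite mulmxDl [RHS]mxE.
    rewrite [LHS]mxE; apply: eq_bigr => a' _.
    rewrite [v^T _ _]mxE !derive_partials// mulmx_suml mulmx_sumr -big_split.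
    rewrite summxE mulr_suml; apply: eq_bigr => b _ /=.
    by rewrite -scalemxAl -scalemxAr -scalerDr mxE; ring.
  have -> : \sum_k geodesic_rhs G x v 0 k * lower G nu x 0 k = - \sum_a \sum_b
      (\sum_k christoffel G x k a b * lower G nu x 0 k) * v 0 a * v 0 b.
    rewrite -sumrN.
    transitivity (\sum_k \sum_a \sum_b - (christoffel G x k a b * lower G nu x 0 k * v 0 a * v 0 b)).
      apply: eq_bigr => k _; rewrite mxE mulNr mulr_suml -sumrN; apply: eq_bigr => a' _.
      by rewrite mulr_suml -sumrN; apply: eq_bigr => b _; ring.
    rewrite exchange_big; apply: eq_bigr => a' _ /=; rewrite exchange_big -sumrN.
    by apply: eq_bigr => b _; rewrite !mulr_suml -sumrN.
  rewrite -sumrB; apply: eq_bigr => a' _; rewrite -sumrB; apply: eq_bigr => b _.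
  by rewrite /cov_deriv low; ring.
have -> : \sum_k geodesic_rhs G x v 0 k * lower G nu x 0 k
   = bilin (G x) (geodesic_rhs G x v) (nu x).
  rewrite bilin_sym// /bilin [RHS]mxE; apply: eq_bigr => k _.
  by rewrite [_^T _ _]mxE mulrC.
rewrite bilin_geodesic_rhs// /lowered_acc.
rewrite [bilin _ (nu x) v]bilin_sym// [bilin _ ('D_v nu x) v]bilin_sym//.
lra.
Qed.


End Levi_Civita.

(** * The pullback of a metric under an immersion and its derivatives *)

Section Pullback.
Context {R : realType}.

Lemma differentiable_mxP (V : normedModType R) m n (M : V -> 'M[R]_(m, n)) x :
  (forall i j, differentiable (fun y => M y i j) x) -> differentiable M x.
Proof.
move=> H.
have -> : M = \sum_(i < m) \sum_(j < n) (fun y => M y i j *: delta_mx i j).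
  apply/funext => y; rewrite fct_sumE {1}[M y]matrix_sum_delta.
  by apply: eq_bigr => i _; rewrite fct_sumE.
by apply: differentiable_sum => i; apply: differentiable_sum => j; exact: differentiableZl.
Qed.

Lemma differentiable_entry (V : normedModType R) m n (M : V -> 'M[R]_(m, n)) x i j :
  differentiable M x -> differentiable (fun y => M y i j) x.
Proof.
by move=> H; apply: (@differentiable_comp _ _ _ _ M (fun A : 'M[R]_(m, n) => A i j)) => //;
  exact: differentiable_coord.
Qed.

Lemma differentiable_mulmx (V : normedModType R) m n p (M : V -> 'M[R]_(m, n))
    (N : V -> 'M[R]_(n, p)) x :
  differentiable M x -> differentiable N x -> differentiable (fun y => M y *m N y) x.
Proof.
move=> HM HN; apply: differentiable_mxP => i j.
have -> : (fun y => (M y *m N y) i j) = \sum_k (fun y => M y i k * N y k j).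
  by apply/funext => y; rewrite fct_sumE mxE.
by apply: differentiable_sum => k; apply: differentiableM; exact: differentiable_entry.
Qed.

Lemma differentiable_trmx (V : normedModType R) m n (M : V -> 'M[R]_(m, n)) x :
  differentiable M x -> differentiable (fun y => (M y)^T) x.
Proof.
move=> HM; apply: differentiable_mxP => i j; under eq_fun do rewrite mxE.
exact: differentiable_entry.
Qed.

Context {m n : nat}.
Variables (D : set 'rV[R]_m) (E : set 'rV[R]_n) (f : 'rV[R]_m -> 'rV[R]_n)
  (G : 'rV[R]_n -> 'M[R]_n).
Hypotheses (oD : open D) (oE : open E) (fDE : forall y, D y -> E (f y)).
Hypotheses (sf : smooth_on D f) (sG : smooth_on E G).
Implicit Types (y u v a : 'rV[R]_m).

(* Equal to ['J f] only where [f] is differentiable. *)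
Definition partials_mx (f : 'rV[R]_m -> 'rV[R]_n) y : 'M[R]_(m, n) :=
  \matrix_(i, k) 'D_(basis_vec i) f y 0 k.

Definition pullback_metric y : 'M[R]_m :=
  partials_mx f y *m G (f y) *m (partials_mx f y)^T.

Lemma derive_partials_mx y u : differentiable f y -> 'D_u f y = u *m partials_mx f y.
Proof.
move=> df; rewrite derive_partials//; apply/rowP => k; rewrite mxE summxE.
by apply: eq_bigr => i _; rewrite !mxE.
Qed.

Lemma partials_mxE y : differentiable f y -> partials_mx f y = 'J f y.
Proof.
move=> df; apply/row_matrixP => i; rewrite !rowE.
by rewrite -derive_partials_mx// deriveEjacobian.
Qed.

Lemma open_near y : D y -> \forall z \near y, D z.
Proof. by move=> Dy; exact: open_nbhs_nbhs (conj oD Dy). Qed.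

Lemma diff_partials_mx y : D y -> differentiable (partials_mx f) y.
Proof.
move=> Dy; apply: differentiable_mxP => i k; under eq_fun do rewrite mxE.
by apply: differentiable_entry; apply: smooth_diff Dy; exact: smooth_partial.
Qed.

Lemma derive_partials_mxE y u i k : D y ->
  'D_u (partials_mx f) y i k = 'D_u ('D_(basis_vec i) f) y 0 k.
Proof.
move=> Dy; rewrite -derive_entry; last by apply: diff_derivable; exact: diff_partials_mx.
under eq_fun do rewrite mxE.
apply: derive_entry; apply: diff_derivable; apply: smooth_diff Dy.
exact: smooth_partial.
Qed.

(** Both sides are the second derivative of [f] on the pair [u], [v]. *)
Lemma derive_partials_mxC y u v : D y ->
  u *m 'D_v (partials_mx f) y = v *m 'D_u (partials_mx f) y.
Proof.
move=> Dy.
have Ew w z : w *m 'D_z (partials_mx f) y = \sum_i \sum_j (w 0 i * z 0 j) *: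
    'D_(basis_vec j) ('D_(basis_vec i) f) y.
  apply/rowP => k; rewrite mxE summxE; apply: eq_bigr => i _.
  rewrite derive_partials_mxE// derive_partials; last first.
    by apply: smooth_diff Dy; exact: smooth_partial.
  by rewrite !summxE mulr_sumr; apply: eq_bigr => j _; rewrite !mxE mulrA.
rewrite !Ew exchange_big; apply: eq_bigr => i _; apply: eq_bigr => j _ /=.
by rewrite (partialC oD Dy sf) mulrC.
Qed.

Lemma lip_partials_mx y : D y -> lip_near y (partials_mx f).
Proof.
move=> Dy; apply/lip_near_mxP => i k; under eq_fun do rewrite mxE.
have : lip_near y ('D_(basis_vec i) f).
  by apply: smooth_lip_near oD Dy _; exact: smooth_partial.
by move=> /lip_near_mxP; exact.
Qed.

Lemma lip_derive_partials_mx y j : D y -> lip_near y ('D_(basis_vec j) (partials_mx f)).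
Proof.
move=> Dy; have [r r0 rD] := open_ball_in oD Dy; apply/lip_near_mxP => i k.
apply: (lip_near_eq (f := fun z => 'D_(basis_vec j) ('D_(basis_vec i) f) z 0 k) r0).
  by move=> z /rD Dz; rewrite derive_partials_mxE.
have : lip_near y ('D_(basis_vec j) ('D_(basis_vec i) f)).
  by apply: smooth_lip_near oD Dy _; apply: smooth_partial; exact: smooth_partial.
by move=> /lip_near_mxP; exact.
Qed.

Lemma is_derive_pullback_metric y u : D y ->
  is_derive y u pullback_metric
    ('D_u (partials_mx f) y *m G (f y) *m (partials_mx f y)^T
     + partials_mx f y *m 'D_(u *m partials_mx f y) G (f y) *m (partials_mx f y)^T
     + partials_mx f y *m G (f y) *m ('D_u (partials_mx f) y)^T).
Proof.
move=> Dy; have dJ := derivableP (diff_derivable (v := u) (diff_partials_mx Dy)).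
have df : is_derive y u f (u *m partials_mx f y).
  have d := smooth_diff sf Dy; rewrite -derive_partials_mx//.
  by apply: derivableP; exact: diff_derivable.
have dG := is_derive_comp_diff df (smooth_diff sG (fDE Dy)).
apply: is_derive_ext (is_derive_mulmx (is_derive_mulmx dJ dG) (is_derive_trmx dJ)) _ _ => //.
by rewrite mulmxDl.
Qed.

Lemma diff_pullback_metric y : D y -> differentiable pullback_metric y.
Proof.
move=> Dy; have dJ := diff_partials_mx Dy.
apply: differentiable_mulmx; last exact: differentiable_trmx.
apply: differentiable_mulmx => //; apply: differentiable_comp.
  exact: smooth_diff Dy.
by apply: smooth_diff sG _; exact: fDE.
Qed.

Lemma lip_comp_metric y (W : normedModType R) (g : 'rV[R]_n -> W) : D y ->
  lip_near (f y) g -> lip_near y (fun z => g (f z)).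
Proof. by move=> Dy; apply: lip_near_comp; exact: smooth_lip_near oD Dy sf. Qed.

Lemma lip_pullback_metric y : D y -> lip_near y pullback_metric.
Proof.
move=> Dy; have lJ := lip_partials_mx Dy.
apply: lip_near_mulmx; last exact: lip_near_trmx.
apply: lip_near_mulmx => //; apply: lip_comp_metric => //.
exact: (smooth_lip_near oE (fDE Dy) sG).
Qed.

Lemma lip_derive_pullback_metric y j : D y -> lip_near y ('D_(basis_vec j) pullback_metric).
Proof.
move=> Dy; have [r r0 rD] := open_ball_in oD Dy.
have lJ := lip_partials_mx Dy; have ldJ := lip_derive_partials_mx j Dy.
have lG : lip_near y (fun z => G (f z)).
  by apply: lip_comp_metric => //; exact: (smooth_lip_near oE (fDE Dy) sG).
apply: (lip_near_eq (f := fun z =>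
  'D_(basis_vec j) (partials_mx f) z *m G (f z) *m (partials_mx f z)^T
  + partials_mx f z *m (\sum_k partials_mx f z j k *: 'D_(basis_vec k) G (f z))
     *m (partials_mx f z)^T
  + partials_mx f z *m G (f z) *m ('D_(basis_vec j) (partials_mx f) z)^T) r0).
  move=> z /rD Dz; have [_ ->] := is_derive_pullback_metric (basis_vec j) Dz.
  congr (_ + _ *m _ *m _ + _); rewrite derive_partials; last first.
    by apply: smooth_diff sG _; exact: fDE.
  by apply: eq_bigr => k _; rewrite -rowE [in RHS]mxE.
apply: lip_nearD; [apply: lip_nearD|].
- by apply: lip_near_mulmx; [exact: lip_near_mulmx|exact: lip_near_trmx].
- apply: lip_near_mulmx; last exact: lip_near_trmx.
  apply: lip_near_mulmx => //; apply: lip_near_sum => k.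
  have lk : lip_near y (fun z => 'D_(basis_vec k) G (f z)).
    exact: (lip_comp_metric Dy (smooth_lip_near oE (fDE Dy) (smooth_partial k sG))).
  apply/lip_near_mxP => a b; under eq_fun do rewrite mxE.
  by apply: lip_nearM; [move/lip_near_mxP : lJ|move/lip_near_mxP : lk]; exact.
- by apply: lip_near_mulmx; [exact: lip_near_mulmx|exact: lip_near_trmx].
Qed.

(* The second derivatives of [f] occurring on both sides cancel because they are symmetric. *)
Lemma lowered_acc_pullback y v a u : D y -> (G (f y))^T = G (f y) ->
  lowered_acc pullback_metric y v a u
  = lowered_acc G (f y) (v *m partials_mx f y)
      (a *m partials_mx f y + v *m 'D_v (partials_mx f) y) (u *m partials_mx f y).
Proof.
move=> Dy sGy.
have [_ Ev] := is_derive_pullback_metric v Dy.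
have [_ Eu] := is_derive_pullback_metric u Dy.
have Du := derive_partials_mxC u v Dy.
rewrite /lowered_acc Ev Eu {Ev Eu} /pullback_metric.
move: ('D_(v *m _) G _) ('D_(u *m _) G _) => dGv dGu.
move: Du; move: ('D_v (partials_mx f) y) ('D_u (partials_mx f) y) (partials_mx f y) (G (f y)) sGy.
move=> Jv Ju J g sg Du.
have B1 (A : 'M[R]_n) (P Q : 'M[R]_(m, n)) w z :
    bilin (P *m A *m Q^T) w z = bilin A (w *m P) (z *m Q).
  by rewrite /bilin trmx_mul !mulmxA.
rewrite !bilinDm !B1 bilinDl Du.
rewrite [bilin g (v *m J) (v *m Ju)]bilin_sym//.
by field.
Qed.

End Pullback.

(** * Local estimates for the geodesic equation *)

Section GeodesicEquation.
Context {R : realType} {n : nat}.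
Variables (G : 'rV[R]_n -> 'M[R]_n) (p : 'rV[R]_n) (r0 : R).
Hypotheses (r00 : 0 < r0) (dG : forall x, `|x - p| < r0 -> differentiable G x).
Hypotheses (lG : lip_near p G) (ldG : forall i, lip_near p ('D_(basis_vec i) G)).
Hypothesis uG : G p \in unitmx.

Lemma lip_christoffel k : lip_near p (fun x => \matrix_(i, j) christoffel G x k i j).
Proof.
apply/lip_near_mxP => i j; under eq_fun do rewrite mxE.
have lI := lip_near_invmx uG lG.
apply: lip_nearM; first exact: lip_near_cst.
apply: lip_near_sum => l; apply: lip_nearM; first by move/lip_near_mxP : lI.
have lD a b c : lip_near p (fun x => 'D_(basis_vec a) (fun y => G y b c) x).
  apply: (lip_near_eq (f := fun x => 'D_(basis_vec a) G x b c) r00).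
    by move=> x xr; rewrite derive_entry//; apply: diff_derivable; exact: dG.
  by have /lip_near_mxP := ldG a.
by apply: lip_nearB => //; exact: lip_nearD.
Qed.

Lemma geodesic_rhs_entry x v k :
  geodesic_rhs G x v 0 k = - bilin (\matrix_(i, j) christoffel G x k i j) v v.
Proof.
rewrite mxE bilinE; congr (- _); apply: eq_bigr => i _; apply: eq_bigr => j _.
by rewrite mxE.
Qed.

Lemma geodesic_rhs_estimates : exists r K : R, [/\ 0 < r, 0 <= K,
  forall x v, `|x - p| <= r -> `|geodesic_rhs G x v| <= K * `|v| ^+ 2 &
  forall x y v w, `|x - p| <= r -> `|y - p| <= r ->
    `|geodesic_rhs G x v - geodesic_rhs G y w|
      <= K * (`|x - y| * `|v| ^+ 2 + `|v - w| * (`|v| + `|w|))].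
Proof.
pose Gam k x := \matrix_(i, j) christoffel G x k i j.
have [k B B' z BB' [h1 h2]|k|r [B [rp B0 HB]]] := @common_radius R 'I_n _ (p, p)
  (fun k B z => `|Gam k z.1| <= B /\ `|Gam k z.1 - Gam k z.2| <= B * `|z.1 - z.2|).
- split; first exact: le_trans BB'.
  by apply: le_trans h2 _; rewrite ler_wpM2r.
- have [r1 [C [r10 C0 H]]] := lip_christoffel k.
  have [r2 [B [r20 B0 H']]] := lip_near_bounded (lip_christoffel k).
  exists (Num.min r1 r2), (B + C); split; rewrite ?lt_min ?r10 ?addr_ge0// => z.
  rewrite prod_normE/= gt_max !lt_min => /andP[/andP[h1 h2] /andP[h3 h4]]; split.
    by apply: (le_trans (H' _ h2)); rewrite lerDl.
  by apply: (le_trans (H _ _ h1 h3)); rewrite ler_wpM2r// lerDr.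
have HB1 k x : `|x - p| < r -> `|Gam k x| <= B.
  by move=> h; have [] := HB k (x, x) => //; rewrite prod_normE /= gt_max h.
have HB2 k x y : `|x - p| < r -> `|y - p| < r -> `|Gam k x - Gam k y| <= B * `|x - y|.
  by move=> h h'; have [] := HB k (x, y) => //; rewrite prod_normE /= gt_max h.
have rr x : `|x - p| <= r / 2 -> `|x - p| < r.
  by move=> /le_lt_trans; apply; rewrite ltr_pdivrMr// ltr_pMr// ltr1n.
exists (r / 2), (n%:R ^+ 2 * B); split.
- by rewrite divr_gt0.
- by rewrite mulr_ge0// exprn_ge0.
- move=> x v /rr xr; apply: mx_norm_le => [|i k].
    by rewrite !mulr_ge0// exprn_ge0.
  rewrite ord1 geodesic_rhs_entry normrN (le_trans (bilin_norm_le _ _ _))//.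
  by rewrite -mulrA ler_wpM2l ?exprn_ge0// -expr2 ler_wpM2r ?exprn_ge0// HB1.
move=> x y v w /rr xr /rr yr; apply: mx_norm_le => [|i k].
  by rewrite !mulr_ge0// ?exprn_ge0// addr_ge0// mulr_ge0// ?exprn_ge0// addr_ge0.
rewrite ord1 mxE [X in _ + X]mxE !geodesic_rhs_entry opprK addrC.
rewrite -!/(Gam _ _).
(* Changing the symbol and the two arguments one at a time produces exactly the two kinds of terms
   in the required bound. *)
have -> : bilin (Gam k y) w w - bilin (Gam k x) v v =
   bilin (Gam k y - Gam k x) v v - bilin (Gam k y) (v - w) v - bilin (Gam k y) w (v - w).
  by move: (Gam k y) (Gam k x) => A1 A2; rewrite bilinBm bilinBl bilinBr; ring.
have b1 := bilin_norm_le (Gam k y - Gam k x) v v.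
have b2 := bilin_norm_le (Gam k y) (v - w) v.
have b3 := bilin_norm_le (Gam k y) w (v - w).
rewrite (le_trans (ler_normB _ _))//.
apply: le_trans (lerD (le_trans (ler_normB _ _) (lerD b1 b2)) b3) _.
have c1 := HB2 k y x yr xr; have c2 := HB1 k y yr.
rewrite -!mulrDr -mulrA ler_wpM2l ?exprn_ge0//.
rewrite [`|y - x|]distrC in c1.
move: c1 c2; rewrite -expr2.
have := normr_ge0 (v - w); have := normr_ge0 v; have := normr_ge0 w.
have : 0 <= `|v| ^+ 2 by rewrite exprn_ge0.
move: (`|Gam k y - _|) (`|Gam k y|) (`|v - w|) (`|w|) (`|x - y|) (`|v|).
move=> gd g vw nw xy nv h1 h2 h3 h4 h5 h6.
have k1 : gd * nv ^+ 2 <= B * xy * nv ^+ 2 by rewrite ler_wpM2r.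
have k2 : g * (vw * nv) <= B * (vw * nv) by rewrite ler_wpM2r// mulr_ge0.
have k3 : g * (nw * vw) <= B * (nw * vw) by rewrite ler_wpM2r// mulr_ge0.
by lra.
Qed.

End GeodesicEquation.

(** * Positive definite forms *)

Section PositiveDefinite.
Context {R : realType}.

Definition posdef n (A : 'M[R]_n) : Prop := forall v : 'rV[R]_n, v != 0 -> 0 < bilin A v v.

Lemma posdef_unitmx n (A : 'M[R]_n) : posdef A -> A \in unitmx.
Proof.
move=> Ap; rewrite -row_free_unit -kermx_eq0; apply/eqP/row_matrixP => i.
rewrite row0; apply/eqP; apply: contraT => /Ap.
have -> : bilin A (row i (kermx A)) (row i (kermx A)) = 0.
  by rewrite /bilin -row_mul mulmx_ker row0 mul0mx mxE.
by rewrite ltxx.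
Qed.

Lemma posdef_pullback m n (A : 'M[R]_n) (J : 'M[R]_(m, n)) :
  posdef A -> row_free J -> posdef (J *m A *m J^T).
Proof.
move=> Ap fJ v v0; rewrite bilin_mull; apply: Ap.
by apply: contra v0 => /eqP E; apply/eqP; apply: (row_free_inj fJ); rewrite E mul0mx.
Qed.

Lemma continuous_bilin n (A : 'M[R]_n) : continuous (fun v : 'rV[R]_n => bilin A v v).
Proof.
move=> v; apply: differentiable_continuous.
under eq_fun do rewrite /bilin.
apply: differentiable_entry; apply: differentiable_mulmx; last exact: differentiable_trmx.
apply: differentiable_mulmx => //.
Qed.

(** The minimum of the form on the compact unit sphere is such a constant, by homogeneity. *)
Lemma posdef_coercive n (A : 'M[R]_n) : posdef A ->
  exists2 l : R, 0 < l & forall v, l * `|v| ^+ 2 <= bilin A v v.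
Proof.
move=> Ap; pose S := [set v : 'rV[R]_n | `|v| = 1].
(* The sphere is empty only in dimension 0, where every vector vanishes. *)
have [S0|S0] := pselect (S !=set0); last first.
  exists 1 => // v; suff -> : v = 0 by rewrite normr0 expr0n mulr0 bilin0l.
  apply/eqP; apply: contraT => v0; exfalso; apply: S0.
  by exists (`|v|^-1 *: v); rewrite /S /= normrZ normfV normr_id mulVf// normr_eq0.
have Sc : compact S.
  apply: bounded_closed_compact.
    exists 1; split; first exact: num_real.
    by move=> M M1 v /= ->; exact: ltW.
  apply: (@closed_comp _ _ (fun v : 'rV[R]_n => `|v|) [set 1]).
    by move=> v _; exact: norm_continuous.
  exact: closed_eq.
have [v0 Sv0 Hmin] := @EVT_min_rV R n (fun v => bilin A v v) S S0 Sc
  (continuous_subspaceT (@continuous_bilin n A)).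
have v0n : v0 != 0 by apply/eqP => E; move: Sv0; rewrite inE /S /= E normr0 => /esym/eqP; rewrite oner_eq0.
exists (bilin A v0 v0); first exact: Ap.
move=> v; have [->|vn] := eqVneq v 0; first by rewrite normr0 expr0n mulr0 bilin0l.
have nv : `|v| != 0 by rewrite normr_eq0.
have /Hmin : `|v|^-1 *: v \in S.
  by rewrite inE /S /= normrZ normfV normr_id mulVf.
rewrite bilinZl bilinZr mulrA -invfM -expr2 mulrC ler_pdivlMr//.
by rewrite exprn_gt0// normr_gt0.
Qed.

End PositiveDefinite.

(** * Asymptotic calculus, uniform over a family and in time *)

Section BigO.
Context {R : realType} {T : Type}.
Variable delta : T -> R.
Hypothesis delta0 : forall d, 0 <= delta d.

(** [T] will index all pairs of solutions of the two boundary value problems, with [delta] the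
    coordinate distance of their endpoints; a single [eta] thus serves every endpoint. *)
Definition eventually_small (P : T -> Prop) : Prop :=
  exists2 eta : R, 0 < eta & forall d, delta d < eta -> P d.

Lemma eventually_smallT (P : T -> Prop) : (forall d, P d) -> eventually_small P.
Proof. by exists 1. Qed.

Lemma eventually_small2 (P Q S : T -> Prop) : (forall d, P d -> Q d -> S d) ->
  eventually_small P -> eventually_small Q -> eventually_small S.
Proof.
move=> PQS [e e0 HP] [e' e'0 HQ]; exists (Num.min e e'); first by rewrite lt_min e0.
by move=> d; rewrite lt_min => /andP[d1 d2]; apply: PQS; [exact: HP|exact: HQ].
Qed.

Lemma eventually_smallS (P Q : T -> Prop) : (forall d, P d -> Q d) ->
  eventually_small P -> eventually_small Q.
Proof. by move=> PQ [e e0 HP]; exists e => // d /HP; exact: PQ. Qed.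

(** The time interval is that of [bvp_solution]. Quantities independent of time carry a dummy
    argument, and real-valued ones are seen in [R^o]. *)
Definition bigO (W : normedModType R) (k : nat) (F : T -> R -> W) : Prop :=
  exists2 C : R, 0 <= C & eventually_small (fun d =>
    forall t : R, -1 <= t <= 2 -> `|F d t| <= C * delta d ^+ k).

Section Normed.
Context {W : normedModType R}.
Implicit Types F : T -> R -> W.

Lemma bigO_dom (W' : normedModType R) k (C : R) F (F' : T -> R -> W') : 0 <= C ->
  eventually_small (fun d => forall t : R, -1 <= t <= 2 -> `|F d t| <= C * `|F' d t|) ->
  bigO k F' -> bigO k F.
Proof.
move=> C0 H [C' C'0 H']; exists (C * C'); first exact: mulr_ge0.
apply: eventually_small2 H H' => d h h' t tt.
by rewrite (le_trans (h t tt))// -mulrA ler_wpM2l// h'.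
Qed.

Lemma bigO_eq k F F' :
  eventually_small (fun d => forall t : R, -1 <= t <= 2 -> F d t = F' d t) ->
  bigO k F -> bigO k F'.
Proof.
move=> H; apply: (bigO_dom (ler01)); apply: eventually_smallS H => d h t tt.
by rewrite h// mul1r.
Qed.

Lemma bigO_le k l F : (k <= l)%N -> bigO l F -> bigO k F.
Proof.
move=> kl [C C0 H]; exists C => //.
have H1 : eventually_small (fun d => delta d < 1) by exists 1.
apply: eventually_small2 H H1 => d h d1 t tt.
apply: (le_trans (h t tt)); rewrite ler_wpM2l//.
by rewrite -(subnK kl) exprD ler_piMl ?exprn_ge0// exprn_ile1// ltW.
Qed.

Lemma bigO0 k : bigO k (fun _ _ => 0 : W).
Proof.
exists 0 => //; apply: eventually_smallT => d t _.
by rewrite normr0 mul0r.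
Qed.

Lemma bigO_cst (a : W) : bigO 0 (fun _ _ => a).
Proof. by exists `|a| => //; apply: eventually_smallT => d t _; rewrite expr0 mulr1. Qed.

Lemma bigOD k F F' : bigO k F -> bigO k F' -> bigO k (fun d t => F d t + F' d t).
Proof.
move=> [C C0 H] [C' C'0 H']; exists (C + C'); first exact: addr_ge0.
apply: eventually_small2 H H' => d h h' t tt.
by rewrite (le_trans (ler_normD _ _))// mulrDl lerD ?h ?h'.
Qed.

Lemma bigON k F : bigO k F -> bigO k (fun d t => - F d t).
Proof.
apply: (bigO_dom ler01); apply: eventually_smallT => d t _.
by rewrite normrN mul1r.
Qed.

Lemma bigOB k F F' : bigO k F -> bigO k F' -> bigO k (fun d t => F d t - F' d t).
Proof. by move=> H /bigON; exact: bigOD. Qed.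

Lemma bigO_sum k (I : Type) (s : seq I) (F : I -> T -> R -> W) :
  (forall i, bigO k (F i)) -> bigO k (fun d t => \sum_(i <- s) F i d t).
Proof.
move=> H; elim: s => [|i s IH].
  by apply: bigO_eq (bigO0 k); apply: eventually_smallT => d t _; rewrite big_nil.
apply: bigO_eq (bigOD (H i) IH); apply: eventually_smallT => d t _.
by rewrite big_cons.
Qed.

Lemma bigO_at k F (s : R) : -1 <= s <= 2 -> bigO k F -> bigO k (fun d _ => F d s).
Proof. by move=> ss [C C0 H]; exists C => //; apply: eventually_smallS H => d h t _; exact: h. Qed.

Lemma bigOZ k l (q : T -> R -> R) F : bigO k (q : T -> R -> R^o) -> bigO l F ->
  bigO (k + l) (fun d t => q d t *: F d t).
Proof.
move=> [C C0 H] [C' C'0 H']; exists (C * C'); first exact: mulr_ge0.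
apply: eventually_small2 H H' => d h h' t tt.
by rewrite normrZ exprD mulrACA ler_pM// ?h ?h'.
Qed.

Lemma bigO_near k F (z : W) (r : R) : 0 < r -> (0 < k)%N ->
  bigO k (fun d t => F d t - z) ->
  eventually_small (fun d => forall t : R, -1 <= t <= 2 -> `|F d t - z| < r).
Proof.
move=> r0 k0 /(bigO_le k0)[C C0 [e e0 H]].
exists (Num.min e (r / (C + 1))).
  by rewrite lt_min e0 divr_gt0// ltr_wpDl.
move=> d; rewrite lt_min ltr_pdivlMr ?ltr_wpDl// => /andP[d1 d2] t tt.
apply: le_lt_trans (H d d1 t tt) _; rewrite expr1.
by apply: le_lt_trans d2; rewrite mulrC ler_wpM2l// lerDl.
Qed.

Lemma bigO_lip (W' : normedModType R) k (g : W -> W') (z : W) F F' : lip_near z g ->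
  bigO 1 (fun d t => F d t - z) -> bigO 1 (fun d t => F' d t - z) ->
  bigO k (fun d t => F d t - F' d t) -> bigO k (fun d t => g (F d t) - g (F' d t)).
Proof.
move=> [r [C [r0 C0 H]]] /(bigO_near r0 (leqnn _)) HF /(bigO_near r0 (leqnn _)) HF' HB.
have [C' C'0 H'] := HB; exists (C * C'); first exact: mulr_ge0.
have := eventually_small2 (fun d => @conj _ _) HF HF'.
apply: eventually_small2 H' => d h [h1 h2] t tt.
by rewrite (le_trans (H _ _ (h1 t tt) (h2 t tt)))// -mulrA ler_wpM2l// h.
Qed.

End Normed.

Lemma bigO_entry k m n (F : T -> R -> 'M[R]_(m, n)) i j :
  bigO k F -> bigO k ((fun d t => F d t i j) : T -> R -> R^o).
Proof.
apply: (bigO_dom ler01); apply: eventually_smallT => d t _.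
by rewrite mul1r le_mx_norm.
Qed.

Lemma bigO_mulmx m n p k l (A : T -> R -> 'M[R]_(m, n)) (B : T -> R -> 'M[R]_(n, p)) :
  bigO k A -> bigO l B -> bigO (k + l) (fun d t => A d t *m B d t).
Proof.
move=> [C C0 H] [C' C'0 H']; exists (n%:R * (C * C')); first by rewrite !mulr_ge0.
apply: eventually_small2 H H' => d h h' t tt.
by rewrite (le_trans (mulmx_norm_le _ _))// -mulrA ler_wpM2l// exprD mulrACA ler_pM// ?h ?h'.
Qed.

Lemma bigO_bilin n k l j (A : T -> R -> 'M[R]_n) u v : bigO k A -> bigO l u -> bigO j v ->
  bigO (k + l + j) (fun d t => bilin (A d t) (u d t) (v d t) : R^o).
Proof.
move=> [C C0 H] [C' C'0 H'] [C'' C''0 H''].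
exists (n%:R ^+ 2 * (C * (C' * C''))); first by rewrite !mulr_ge0// exprn_ge0.
have := eventually_small2 (fun d => @conj _ _) H' H''.
apply: eventually_small2 H => d h [h' h''] t tt.
rewrite (le_trans (bilin_norm_le _ _ _))// -mulrA ler_wpM2l ?exprn_ge0//.
rewrite -addnA !exprD mulrACA ler_pM// ?mulr_ge0 ?h//.
by rewrite mulrACA ler_pM// ?h' ?h''.
Qed.

Lemma zero_in_range : -1 <= (0 : R) <= 2.
Proof. by rewrite lerN10 ler0n. Qed.

Lemma one_in_range : -1 <= (1 : R) <= 2.
Proof. by rewrite ler1n andbT; lra. Qed.

Lemma bigO_MVT m n k (F dF : T -> R -> 'M[R]_(m, n)) :
  eventually_small (fun d => forall t : R, -1 <= t <= 2 -> is_derive t 1 (F d) (dF d t)) ->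
  bigO k dF -> bigO k (fun d t => F d t - F d 0).
Proof.
move=> D [C C0 H]; exists (C * 2); first exact: mulr_ge0.
apply: eventually_small2 D H => d D H t tt.
have z := zero_in_range.
apply: (le_trans (MVT_norm D H z tt)); rewrite subr0 [leRHS]mulrAC ler_wpM2l//.
  by rewrite mulr_ge0// exprn_ge0.
by rewrite ler_norml; move: tt => /andP[? ?]; apply/andP; split; lra.
Qed.

Lemma bigO_MVT_scalar k (F dF : T -> R -> R) :
  eventually_small (fun d => forall t : R, -1 <= t <= 2 -> is_derive t 1 (F d) (dF d t)) ->
  bigO k (dF : T -> R -> R^o) -> bigO k ((fun d t => F d t - F d 0) : T -> R -> R^o).
Proof.
move=> D [C C0 H]; exists (C * 2); first exact: mulr_ge0.
apply: eventually_small2 D H => d D H t tt.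
apply: (le_trans (MVT_norm_scalar D H zero_in_range tt)).
rewrite subr0 [leRHS]mulrAC ler_wpM2l//.
  by rewrite mulr_ge0// exprn_ge0.
by rewrite ler_norml; move: tt => /andP[? ?]; apply/andP; split; lra.
Qed.

(** Along a geodesic parametrized by [0, 1], each time derivative gains a power of delta. The second
    clause records this gain without naming the next derivative; for a second derivative it replaces
    a bound on the third. *)
Definition stable (W : normedModType R) k (F : T -> R -> W) : Prop :=
  bigO k F /\ bigO k.+1 (fun d t => F d t - F d 0).

Section Stable.
Context {W : normedModType R}.
Implicit Types F : T -> R -> W.

Lemma stable_eq k F F' :
  eventually_small (fun d => forall t : R, -1 <= t <= 2 -> F d t = F' d t) ->
  stable k F -> stable k F'.
Proof.
move=> H [H1 H2]; split; first exact: bigO_eq H1.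
apply: bigO_eq H2; apply: eventually_smallS H => d h t tt.
by rewrite !h// zero_in_range.
Qed.

Lemma stableD k F F' : stable k F -> stable k F' -> stable k (fun d t => F d t + F' d t).
Proof.
move=> [H1 H2] [H1' H2']; split; first exact: bigOD.
apply: bigO_eq (bigOD H2 H2'); apply: eventually_smallT => d t _.
by rewrite opprD addrACA.
Qed.

Lemma stableB k F F' : stable k F -> stable k F' -> stable k (fun d t => F d t - F' d t).
Proof.
move=> [H1 H2] [H1' H2']; split; first exact: bigOB.
apply: bigO_eq (bigOB H2 H2'); apply: eventually_smallT => d t _.
by rewrite !opprD !opprK addrACA.
Qed.

Lemma stable_sum k (I : Type) (s : seq I) (F : I -> T -> R -> W) :
  (forall i, stable k (F i)) -> stable k (fun d t => \sum_(i <- s) F i d t).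
Proof.
move=> H; split; first by apply: bigO_sum => i; exact: (H i).1.
apply: bigO_eq (bigO_sum s (fun i => (H i).2)); apply: eventually_smallT => d t _.
by rewrite sumrB.
Qed.

Lemma stable_lip (W' : normedModType R) (g : W -> W') (z : W) F : lip_near z g ->
  bigO 1 (fun d t => F d t - z) -> stable 0 (fun d t => g (F d t)).
Proof.
move=> lg HF; have HF0 := bigO_at zero_in_range HF; split.
  have H : bigO 0 (fun d t => g (F d t) - g z).
    apply: (bigO_lip lg HF) => //; last exact: (bigO_le _ HF).
    by apply: bigO_eq (bigO0 1); apply: eventually_smallT => d t _; rewrite subrr.
  apply: bigO_eq (bigOD H (bigO_cst (g z))); apply: eventually_smallT => d t _.
  by rewrite subrK.
apply: (bigO_lip lg HF HF0).
apply: bigO_eq (bigOB HF HF0); apply: eventually_smallT => d t _.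
by rewrite opprB addrA subrK.
Qed.

Lemma stableZ k l (q : T -> R -> R) F : stable k (q : T -> R -> R^o) -> stable l F ->
  stable (k + l) (fun d t => q d t *: F d t).
Proof.
move=> [H1 H2] [H1' H2']; split; first exact: bigOZ.
have HA := bigOZ H2 H1'; have HB := bigOZ (bigO_at zero_in_range H1) H2'.
rewrite addSn in HA; rewrite addnS in HB; apply: bigO_eq (bigOD HA HB); apply: eventually_smallT => d t _.
by rewrite scalerBl scalerBr addrA subrK.
Qed.

End Stable.

Lemma stable_mulmx m n p k l (A : T -> R -> 'M[R]_(m, n)) (B : T -> R -> 'M[R]_(n, p)) :
  stable k A -> stable l B -> stable (k + l) (fun d t => A d t *m B d t).
Proof.
move=> [H1 H2] [H1' H2']; split; first exact: bigO_mulmx.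
have HA := bigO_mulmx H2 H1'; have HB := bigO_mulmx (bigO_at zero_in_range H1) H2'.
rewrite addSn in HA; rewrite addnS in HB; apply: bigO_eq (bigOD HA HB); apply: eventually_smallT => d t _.
by rewrite mulmxBl mulmxBr addrA subrK.
Qed.

Lemma stable_entry m n k (A : T -> R -> 'M[R]_(m, n)) i j :
  stable k A -> stable k (fun d t => A d t i j : R^o).
Proof.
move=> [H1 H2]; split.
  exact: bigO_entry.
apply: (bigO_dom ler01) H2; apply: eventually_smallT => d t _.
by rewrite mul1r; have := le_mx_norm (A d t - A d 0) i j; rewrite !mxE.
Qed.

(** The quadratic bound gives [ddx] order 2, so [dx] varies only to order 2 by the mean value
    inequality; with these, the Lipschitz bound on [F] shows that [ddx] varies to order 3. *)
Lemma stable_geodesic n (F : 'rV[R]_n -> 'rV[R]_n -> 'rV[R]_n) (p : 'rV[R]_n)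
    (x dx ddx : T -> R -> 'rV[R]_n) (r K : R) : 0 < r -> 0 <= K ->
  (forall x v, `|x - p| <= r -> `|F x v| <= K * `|v| ^+ 2) ->
  (forall x y v w, `|x - p| <= r -> `|y - p| <= r ->
    `|F x v - F y w| <= K * (`|x - y| * `|v| ^+ 2 + `|v - w| * (`|v| + `|w|))) ->
  (forall d (t : R), -1 <= t <= 2 -> is_derive t 1 (dx d) (ddx d t)) ->
  (forall d (t : R), -1 <= t <= 2 -> ddx d t = F (x d t) (dx d t)) ->
  bigO 1 (fun d t => x d t - p) -> bigO 1 dx -> stable 1 dx /\ stable 2 ddx.
Proof.
move=> r0 K0 Fb Fl Ddx Eddx Ox Odx.
have nr := bigO_near r0 (leqnn _) Ox.
have Oddx : bigO 2 ddx.
  have [C C0 H] := Odx; exists (K * C ^+ 2); first by rewrite mulr_ge0// exprn_ge0.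
  apply: eventually_small2 H nr => d h h' t tt.
  rewrite Eddx// (le_trans (Fb _ _ (ltW (h' t tt))))// -mulrA ler_wpM2l//.
  by rewrite -exprMn ler_pXn2r ?nnegrE ?mulr_ge0// (le_trans (h t tt))// expr1.
have Odx0 : bigO 2 (fun d t => dx d t - dx d 0).
  by apply: bigO_MVT Oddx; apply: eventually_smallT.
split; split => //.
have [C C0 H] := Odx; have [C' C'0 H'] := Odx0; have [C'' C''0 H''] := Ox.
exists (K * (2 * C'' * C ^+ 2 + C' * (2 * C))).
  by rewrite mulr_ge0// addr_ge0// !mulr_ge0// exprn_ge0.
have a1 := eventually_small2 (fun d => @conj _ _) H H'.
have a2 := eventually_small2 (fun d => @conj _ _) H'' nr.
apply: eventually_small2 a1 a2 => d [h1 h2] [h3 h4] t tt.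
have z := zero_in_range.
rewrite !Eddx// (le_trans (Fl _ _ _ _ (ltW (h4 t tt)) (ltW (h4 0 z))))//.
rewrite -mulrA ler_wpM2l//.
have b1 : `|x d t - x d 0| <= 2 * C'' * delta d.
  rewrite -(subrKA p) (le_trans (ler_normD _ _))//.
  have := h3 t tt; have := h3 0 z; rewrite [`|x d 0 - p|]distrC !expr1; lra.
have b2 := h2 t tt; have b3 := h1 t tt; have b4 := h1 0 z; rewrite !expr1 in b3 b4.
have d0 := delta0 d.
have c1 : `|x d t - x d 0| * `|dx d t| ^+ 2 <= 2 * C'' * delta d * (C * delta d) ^+ 2.
  by rewrite ler_pM// ?exprn_ge0// ler_pXn2r ?nnegrE ?mulr_ge0.
have c2 : `|dx d t - dx d 0| * (`|dx d t| + `|dx d 0|)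
    <= C' * delta d ^+ 2 * (C * delta d + C * delta d).
  by rewrite ler_pM// ?addr_ge0// lerD.
apply: le_trans (lerD c1 c2) _.
by rewrite le_eqVlt; apply/orP; left; apply/eqP; ring.
Qed.

End BigO.

(** * Tangent and normal parts, constancy of speed, and auxiliary derivatives *)

Section LinearAlgebra.
Context {R : realType}.

Lemma is_derive_scale (W : normedModType R) (q : R -> R) (t dq : R) (w : W) :
  is_derive t 1 q dq -> is_derive t 1 (fun s => q s *: w) (dq *: w).
Proof.
move=> Dq; have [d1 d2] := is_derive_line w (q t).
have Hd : differentiable (fun s : R => s *: w) (q t) by apply/derivable1_diffP.
apply: is_derive_ext (is_derive_comp_diff Dq Hd) _ _ => //.
by rewrite deriveE// -{1}[dq]mulr1 [LHS](linearZ_LR _ dq 1) -deriveE// d2.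
Qed.

Lemma is_derive_half_square (s : R) :
  is_derive s 1 (fun t : R => (t ^+ 2 - t) / 2) (s - 2^-1).
Proof.
have D := is_deriveZ (2^-1) (is_deriveB (is_deriveM (is_derive_id s 1) (is_derive_id s 1))
  (is_derive_id s (1 : R))).
apply: is_derive_ext D _ _ => [t|].
  by rewrite -[LHS]/(2^-1 * (t * t - t)) mulrC expr2.
by rewrite /GRing.scale /=; field.
Qed.

Lemma is_derive_centered_cube (s : R) :
  is_derive s 1 (fun t : R => (t - 2^-1) ^+ 3 / 3) ((s - 2^-1) ^+ 2).
Proof.
have D1 : is_derive s 1 (fun t : R => t - 2^-1) 1.
  apply: is_derive_ext (is_deriveB (is_derive_id s 1) (is_derive_cst (2^-1 : R) s 1)) _ _ => //.
  by rewrite subr0.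
have D := is_deriveZ (3^-1) (is_deriveM D1 (is_deriveM D1 D1)).
apply: is_derive_ext D _ _ => [t|].
  rewrite -[LHS]/(3^-1 * ((t - 2^-1) * ((t - 2^-1) * (t - 2^-1)))).
  by rewrite mulrC !exprS expr0 mulr1.
rewrite -[LHS]/(3^-1 * ((s - 2^-1) * ((s - 2^-1) * 1 + (s - 2^-1) * 1)
  + (s - 2^-1) * (s - 2^-1) * 1)).
by field.
Qed.

(** As multiplication by a fixed matrix at [x], the projection is visibly linear and preserves
    orders of magnitude. *)
Lemma tangentialE n (G : 'rV[R]_n -> 'M[R]_n) nu x v :
  tangential G nu x v = v *m (1%:M - G x *m (nu x)^T *m nu x).
Proof.
rewrite /tangential mulmxBr mulmx1 !mulmxA; congr (_ - _).
by rewrite -mul_scalar_mx /bilin -mx11_scalar.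
Qed.

Lemma lowered_acc_decomp n (G : 'rV[R]_n -> 'M[R]_n) x v a u w (c : R) :
  differentiable G x ->
  lowered_acc G x v a (u + c *: w) = lowered_acc G x v a u + c * lowered_acc G x v a w.
Proof.
move=> dG.
have E1 : 'D_(u + c *: w) G x = 'D_u G x + c *: 'D_w G x.
  by rewrite !deriveE// linearD linearZ.
rewrite /lowered_acc E1; move: ('D_v G x) ('D_u G x) ('D_w G x) => A B C.
by rewrite !bilinDr !bilinZr bilinDm bilinZm; ring.
Qed.

(** Codimension one enters here: the m independent rows of [J] and [nu] are m + 1 independent
    vectors, hence a basis. Pairing with [nu] identifies the normal coefficient. *)
Lemma tangent_normal_decomp m (A : 'M[R]_m.+1) (J : 'M[R]_(m, m.+1)) (nu : 'rV[R]_m.+1) :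
  row_free J -> bilin A nu nu = 1 -> (forall w, bilin A (w *m J) nu = 0) ->
  forall u, exists e, u = e *m J + bilin A u nu *: nu.
Proof.
move=> fJ nu1 nu0 u.
have F : row_free (col_mx J nu).
  rewrite -kermx_eq0; apply/eqP/row_matrixP => i; rewrite row0.
  have : row i (kermx (col_mx J nu)) *m col_mx J nu = 0 by rewrite -row_mul mulmx_ker row0.
  set k := row i _; rewrite -[k]hsubmxK mul_row_col => E.
  have E2 : rsubmx k *m nu = rsubmx k 0 0 *: nu.
    by rewrite {1}[rsubmx k]mx11_scalar mul_scalar_mx.
  have E3 : rsubmx k 0 0 = 0.
    have := congr1 (fun z => bilin A z nu) E.
    by rewrite bilinDl nu0 add0r E2 bilinZl nu1 mulr1 bilin0l.
  have E4 : rsubmx k = 0 by rewrite [rsubmx k]mx11_scalar E3 raddf0.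
  rewrite E4 mul0mx addr0 in E.
  have E5 : lsubmx k = 0 by apply: (row_free_inj fJ); rewrite E mul0mx.
  by rewrite E4 E5 row_mx0.
have full : (u <= col_mx J nu)%MS.
  apply: submx_full; rewrite /row_full eqn_leq rank_leq_col /=.
  by have /eqP -> := F; rewrite addn1.
have /submxP[k ->] := full.
rewrite -[k]hsubmxK mul_row_col.
have E2 : rsubmx k *m nu = rsubmx k 0 0 *: nu.
  by rewrite {1}[rsubmx k]mx11_scalar mul_scalar_mx.
exists (lsubmx k); rewrite bilinDl nu0 add0r E2 bilinZl nu1 mulr1.
by [].
Qed.

(** The derivative of the squared speed is twice the lowered acceleration on the velocity, which is
    0 for a solution. *)
Lemma const_speed n (G : 'rV[R]_n -> 'M[R]_n) (x dx ddx : R -> 'rV[R]_n) (a b : R) :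
  a <= 0 <= b ->
  (forall t, a <= t <= b -> [/\ differentiable G (x t), (G (x t))^T = G (x t) &
     G (x t) \in unitmx]) ->
  (forall t, a <= t <= b -> is_derive t 1 x (dx t)) ->
  (forall t, a <= t <= b -> is_derive t 1 dx (ddx t)) ->
  (forall t, a <= t <= b -> ddx t = geodesic_rhs G (x t) (dx t)) ->
  forall t, a <= t <= b -> bilin (G (x t)) (dx t) (dx t) = bilin (G (x 0)) (dx 0) (dx 0).
Proof.
move=> ab HG D1 D2 E t tt; apply/eqP; rewrite -subr_eq0 -normr_le0.
have D3 s : a <= s <= b -> is_derive s 1 (fun s => bilin (G (x s)) (dx s) (dx s)) 0.
  move=> ss; have [g1 g2 g3] := HG s ss.
  apply: is_derive_eq (is_derive_speed2 g1 g2 (D1 s ss) (D2 s ss)) _.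
  by rewrite E// lowered_acc_geodesic// mulr0.
have B s : a <= s <= b -> `|0 : R| <= 0 by rewrite normr0.
by have := MVT_norm_scalar D3 B ab tt; rewrite mul0r.
Qed.

End LinearAlgebra.

(** * Asymptotic comparison of the two geodesics in a pair of charts *)

Section Expansion.
Context {R : realType} {m : nat} {T : Type}.
Variables (D : set 'rV[R]_m) (E : set 'rV[R]_m.+1) (f : 'rV[R]_m -> 'rV[R]_m.+1)
  (G : 'rV[R]_m.+1 -> 'M[R]_m.+1) (nu : 'rV[R]_m.+1 -> 'rV[R]_m.+1) (y0 : 'rV[R]_m).
Hypotheses (oD : open D) (oE : open E) (fDE : forall y, D y -> E (f y)).
Hypotheses (sf : smooth_on D f) (sG : smooth_on E G) (Dy0 : D y0).
Hypotheses (symG : forall x, E x -> (G x)^T = G x) (posG : forall x, E x -> posdef (G x)).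
Hypothesis immf : forall y, D y -> row_free (partials_mx f y).

Lemma pullback_sym y : D y -> (pullback_metric f G y)^T = pullback_metric f G y.
Proof.
by move=> Dy; rewrite /pullback_metric !trmx_mul trmxK symG ?mulmxA//; exact: fDE.
Qed.

Lemma pullback_unitmx y : D y -> pullback_metric f G y \in unitmx.
Proof.
by move=> Dy; apply: posdef_unitmx; apply: posdef_pullback; [apply: posG; exact: fDE|exact: immf].
Qed.

Lemma pullback_estimates : exists r K : R, [/\ 0 < r, 0 <= K,
  forall x v, `|x - y0| <= r -> `|geodesic_rhs (pullback_metric f G) x v| <= K * `|v| ^+ 2 &
  forall x y v w, `|x - y0| <= r -> `|y - y0| <= r ->
    `|geodesic_rhs (pullback_metric f G) x v - geodesic_rhs (pullback_metric f G) y w|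
      <= K * (`|x - y| * `|v| ^+ 2 + `|v - w| * (`|v| + `|w|))].
Proof.
have [r r0 rD] := open_ball_in oD Dy0.
apply: (geodesic_rhs_estimates r0).
- by move=> x /rD Dx; exact: (diff_pullback_metric fDE sf sG).
- exact: (lip_pullback_metric oD oE fDE sf sG).
- by move=> i; exact: (lip_derive_pullback_metric oD oE fDE sf sG).
- exact: pullback_unitmx.
Qed.

Lemma ambient_estimates (p : 'rV[R]_m.+1) : E p -> exists r K : R, [/\ 0 < r, 0 <= K,
  forall x v, `|x - p| <= r -> `|geodesic_rhs G x v| <= K * `|v| ^+ 2 &
  forall x y v w, `|x - p| <= r -> `|y - p| <= r ->
    `|geodesic_rhs G x v - geodesic_rhs G y w|
      <= K * (`|x - y| * `|v| ^+ 2 + `|v - w| * (`|v| + `|w|))].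
Proof.
move=> Ep; have [r r0 rE] := open_ball_in oE Ep.
apply: (geodesic_rhs_estimates r0).
- by move=> x /rE Ex; exact: smooth_diff sG Ex.
- exact: smooth_lip_near oE Ep sG.
- by move=> i; apply: smooth_lip_near oE Ep _; exact: smooth_partial.
- by apply: posdef_unitmx; exact: posG.
Qed.

Hypotheses (dnu : differentiable nu (f y0))
  (nu_unit : bilin (G (f y0)) (nu (f y0)) (nu (f y0)) = 1)
  (nu_orth : forall y, D y -> forall w,
     bilin (G (f y)) (w *m partials_mx f y) (nu (f y)) = 0).

Variables (y1 : T -> 'rV[R]_m) (y dy ddy : T -> R -> 'rV[R]_m)
  (x dx ddx : T -> R -> 'rV[R]_m.+1) (delta : T -> R).
Hypotheses
  (hy : forall d, bvp_solution (geodesic_rhs (pullback_metric f G)) y0 (y1 d) (y d) (dy d) (ddy d))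
  (hx : forall d, bvp_solution (geodesic_rhs G) (f y0) (f (y1 d)) (x d) (dx d) (ddx d))
  (deltaE : forall d, delta d = `|y1 d - y0|).

Notation p := (f y0).
Notation J := (partials_mx f).
Notation bigO := (bigO delta).
Notation stable := (stable delta).
Notation eventually := (eventually_small delta).

Lemma delta_ge0 d : 0 <= delta d.
Proof. by rewrite deltaE. Qed.

Lemma ambient_base_point : E p. Proof. exact: fDE. Qed.

Lemma bigO_y1 : bigO 1 (fun d _ => y1 d - y0).
Proof.
by exists 1 => //; apply: eventually_smallT => d t _; rewrite mul1r expr1 deltaE.
Qed.

Lemma bigO_y : bigO 1 (fun d t => y d t - y0).
Proof.
exists 4 => //; apply: eventually_smallT => d t tt; rewrite expr1 deltaE.
by have [_ _ /(_ t tt)[]] := hy d.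
Qed.

Lemma bigO_dy : bigO 1 dy.
Proof.
exists 2 => //; apply: eventually_smallT => d t tt; rewrite expr1 deltaE.
by have [_ _ /(_ t tt)[]] := hy d.
Qed.

Lemma bigO_const_sub (W : normedModType R) k (z : W) : bigO k (fun _ _ => z - z).
Proof. by apply: bigO_eq (bigO0 _ k); apply: eventually_smallT => d t _; rewrite subrr. Qed.

Lemma bigO_fy1 : bigO 1 (fun d _ => f (y1 d) - p).
Proof.
apply: (bigO_lip delta_ge0 (smooth_lip_near oD Dy0 sf) bigO_y1); last exact: bigO_y1.
exact: bigO_const_sub.
Qed.

Lemma bigO_x : bigO 1 (fun d t => x d t - p).
Proof.
apply: (bigO_dom (C := 4)) bigO_fy1 => //.
apply: eventually_smallT => d t tt.
by have [_ _ /(_ t tt)[]] := hx d.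
Qed.

Lemma bigO_dx : bigO 1 dx.
Proof.
apply: (bigO_dom (C := 2)) bigO_fy1 => //.
apply: eventually_smallT => d t tt.
by have [_ _ /(_ t tt)[]] := hx d.
Qed.

Lemma eventually_in_D : eventually (fun d => forall t : R, -1 <= t <= 2 -> D (y d t)).
Proof.
have [r r0 rD] := open_ball_in oD Dy0.
apply: eventually_smallS (bigO_near delta_ge0 r0 (leqnn 1) bigO_y) => d h t tt.
by apply: rD; exact: h.
Qed.

Lemma eventually_in_E : eventually (fun d => forall t : R, -1 <= t <= 2 -> E (x d t)).
Proof.
have [r r0 rD] := open_ball_in oE ambient_base_point.
apply: eventually_smallS (bigO_near delta_ge0 r0 (leqnn 1) bigO_x) => d h t tt.
by apply: rD; exact: h.
Qed.

Lemma stable_y : stable 1 dy /\ stable 2 ddy.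
Proof.
have [r [K [r0 K0 B1 B2]]] := pullback_estimates.
apply: (stable_geodesic delta_ge0 r0 K0 B1 B2 _ _ bigO_y bigO_dy).
- by move=> d t tt; have [_ _ /(_ t tt)[]] := hy d.
- by move=> d t tt; have [_ _ /(_ t tt)[]] := hy d.
Qed.

Lemma stable_x : stable 1 dx /\ stable 2 ddx.
Proof.
have [r [K [r0 K0 B1 B2]]] := ambient_estimates ambient_base_point.
apply: (stable_geodesic delta_ge0 r0 K0 B1 B2 _ _ bigO_x bigO_dx).
- by move=> d t tt; have [_ _ /(_ t tt)[]] := hx d.
- by move=> d t tt; have [_ _ /(_ t tt)[]] := hx d.
Qed.

(** [img] is the curve X of the overview; [gap] below is w, and [ddgap d 0] is the constant vector
    W. The derivatives are spelled out by the chain rule so that their orders can be read off. *)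
Definition img d t := f (y d t).
Definition dimg d t := dy d t *m J (y d t).
Definition ddimg d t := ddy d t *m J (y d t) + dy d t *m 'D_(dy d t) J (y d t).

Lemma is_derive_img d : (forall t : R, -1 <= t <= 2 -> D (y d t)) ->
  forall t : R, -1 <= t <= 2 ->
    is_derive t 1 (img d) (dimg d t) /\ is_derive t 1 (dimg d) (ddimg d t).
Proof.
move=> HD t tt; have [_ _ /(_ t tt)[D1 D2 _ _ _]] := hy d.
have Dy := HD t tt; split.
  rewrite /dimg -derive_partials_mx; last exact: smooth_diff sf Dy.
  by apply: (is_derive_comp_diff D1); exact: smooth_diff sf Dy.
apply: is_derive_mulmx D2 _.
by apply: (is_derive_comp_diff D1); exact: (diff_partials_mx sf).
Qed.

Lemma stable_J : stable 0 (fun d t => J (y d t)).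
Proof. exact: (stable_lip delta_ge0 (lip_partials_mx oD sf Dy0) bigO_y). Qed.

Lemma stable_dimg : stable 1 dimg.
Proof. exact: (stable_mulmx stable_y.1 stable_J). Qed.

Lemma stable_ddimg : stable 2 ddimg.
Proof.
apply: stableD; first exact: (stable_mulmx stable_y.2 stable_J).
suff H : stable 1 (fun d t => 'D_(dy d t) J (y d t)).
  exact: (stable_mulmx stable_y.1 H).
apply: (stable_eq (F := fun d t => \sum_i dy d t 0 i *: 'D_(basis_vec i) J (y d t))).
  apply: eventually_smallS eventually_in_D => d HD t tt.
  by rewrite derive_partials//; apply: (diff_partials_mx sf); exact: HD.
apply: stable_sum => i.
apply: (stableZ (k := 1) (l := 0)).
  exact: (stable_entry _ _ stable_y.1).
exact: (stable_lip delta_ge0 (lip_derive_partials_mx oD sf i Dy0) bigO_y).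
Qed.

Definition gap d t := img d t - x d t.
Definition dgap d t := dimg d t - dx d t.
Definition ddgap d t := ddimg d t - ddx d t.

Lemma stable_ddgap : stable 2 ddgap.
Proof. exact: (stableB stable_ddimg stable_x.2). Qed.

Lemma is_derive_gap d : (forall t : R, -1 <= t <= 2 -> D (y d t)) ->
  forall t : R, -1 <= t <= 2 ->
    is_derive t 1 (gap d) (dgap d t) /\ is_derive t 1 (dgap d) (ddgap d t).
Proof.
move=> HD t tt; have [D1 D2] := is_derive_img HD tt.
have [_ _ /(_ t tt)[D1' D2' _ _ _]] := hx d.
by split; exact: is_deriveB.
Qed.

(** (t^2 - t) / 2 vanishes at 0 and 1 and has second derivative 1. Subtracting this multiple of
    [ddgap d 0] leaves a curve that vanishes at both ends and has a second derivative of order 3, to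
    which [two_point_bound] applies. *)
Lemma gap_expansion :
  bigO 3 (fun d t => dgap d t - (t - 2^-1) *: ddgap d 0) /\
  bigO 3 (fun d t => gap d t - ((t ^+ 2 - t) / 2) *: ddgap d 0).
Proof.
have [C C0 H] := stable_ddgap.2.
have z1 : (-1 : R) <= 0 by rewrite lerN10.
have z2 : (1 : R) <= 2 by rewrite ler1n.
have key : eventually (fun d => forall t : R, -1 <= t <= 2 ->
    `|dgap d t - (t - 2^-1) *: ddgap d 0| <= C * delta d ^+ 3 * (2 - -1) /\
    `|gap d t - ((t ^+ 2 - t) / 2) *: ddgap d 0| <= C * delta d ^+ 3 * (2 - -1) ^+ 2).
  apply: eventually_small2 H eventually_in_D => d h HD t tt.
  have [y00 y11 _] := hy d; have [x00 x11 _] := hx d.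
  have g0 : gap d 0 = 0 by rewrite /gap /img y00 x00 subrr.
  have g1 : gap d 1 = 0 by rewrite /gap /img y11 x11 subrr.
  apply: (@two_point_bound R 1 m.+1 (fun t => gap d t - ((t ^+ 2 - t) / 2) *: ddgap d 0)
   (fun t => dgap d t - (t - 2^-1) *: ddgap d 0) (fun t => ddgap d t - ddgap d 0)
   (-1) 2 _ z1 z2 _ _ _ _ h t tt).
  - by rewrite g0 expr0n /= subrr mul0r scale0r subrr.
  - by rewrite g1 expr1n subrr mul0r scale0r subrr.
  - move=> s ss; apply: is_deriveB; first exact: (is_derive_gap HD ss).1.
    apply: is_derive_scale.
    exact: is_derive_half_square.
  - move=> s ss; apply: is_deriveB; first exact: (is_derive_gap HD ss).2.
    apply: is_derive_ext (is_derive_scale (ddgap d 0)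
      (is_deriveB (is_derive_id s 1) (is_derive_cst (2^-1 : R) s 1))) _ _ => //.
    by rewrite subr0 scale1r.
split.
- exists (C * (2 - -1)); first by rewrite mulr_ge0//; lra.
  apply: eventually_smallS key => d h t tt; have [h1 _] := h t tt.
  by rewrite mulrAC.
- exists (C * (2 - -1) ^+ 2); first by rewrite mulr_ge0// exprn_ge0//; lra.
  apply: eventually_smallS key => d h t tt; have [_ h1] := h t tt.
  by rewrite mulrAC.
Qed.

Lemma bigO_time (q : R -> R) (B : R) : (forall t : R, -1 <= t <= 2 -> `|q t| <= B) ->
  bigO 0 ((fun _ t => q t) : T -> R -> R^o).
Proof.
move=> H; exists B; first by apply: le_trans (H 0 zero_in_range).
by apply: eventually_smallT => d t tt; rewrite expr0 mulr1; exact: H.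
Qed.

Lemma bigO_ddgap0 : bigO 2 (fun d _ => ddgap d 0).
Proof. exact: (bigO_at zero_in_range stable_ddgap.1). Qed.

Lemma bigO_linear_gap : bigO 2 (fun d t => (t - 2^-1) *: ddgap d 0).
Proof.
apply: (bigOZ (k := 0) (l := 2) _ bigO_ddgap0).
apply: (bigO_time (q := fun t => t - 2^-1) (B := 3)) => t /andP[? ?].
by rewrite ler_norml; apply/andP; split; lra.
Qed.

Lemma bigO_dgap : bigO 2 dgap.
Proof.
apply: bigO_eq (bigOD (bigO_le delta_ge0 (leqnSn 2) gap_expansion.1) bigO_linear_gap).
by apply: eventually_smallT => d t _; rewrite subrK.
Qed.

Lemma bigO_gap : bigO 2 gap.
Proof.
have H : bigO 2 (fun d t => ((t ^+ 2 - t) / 2) *: ddgap d 0).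
  apply: (bigOZ (k := 0) (l := 2) _ bigO_ddgap0).
  apply: (bigO_time (q := fun t => (t ^+ 2 - t) / 2) (B := 3)) => t /andP[? ?].
  by rewrite ler_norml; apply/andP; split; nra.
apply: bigO_eq (bigOD (bigO_le delta_ge0 (leqnSn 2) gap_expansion.2) H).
by apply: eventually_smallT => d t _; rewrite subrK.
Qed.

Lemma bigO_derive_metric k (u z : T -> R -> 'rV[R]_m.+1) : bigO k u ->
  bigO 1 (fun d t => z d t - p) -> bigO k (fun d t => 'D_(u d t) G (z d t)).
Proof.
move=> Hu Hz; have [r r0 rE] := open_ball_in oE ambient_base_point.
apply: (bigO_eq (F := fun d t => \sum_i u d t 0 i *: 'D_(basis_vec i) G (z d t))).
  apply: eventually_smallS (bigO_near delta_ge0 r0 (leqnn 1) Hz) => d h t tt.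
  by rewrite derive_partials//; apply: smooth_diff sG _; apply: rE; exact: h.
apply: bigO_sum => i; rewrite -[k]addn0.
apply: bigOZ; first exact: bigO_entry.
have lDG : lip_near p ('D_(basis_vec i) G).
  by apply: smooth_lip_near oE ambient_base_point _; exact: smooth_partial.
exact: (stable_lip delta_ge0 lDG Hz).1.
Qed.

Lemma speed2_img : eventually (fun d => forall t : R, -1 <= t <= 2 ->
  bilin (G (img d t)) (dimg d t) (dimg d t)
  = bilin (pullback_metric f G y0) (dy d 0) (dy d 0)).
Proof.
apply: eventually_smallS eventually_in_D => d HD t tt.
rewrite -bilin_mull; have [<- _ Hd] := hy d.
apply: (@const_speed R m (pullback_metric f G) (y d) (dy d) (ddy d) (-1) 2 zero_in_range _ _ _ _ t tt).
- move=> s ss; have Dy := HD s ss; split; last exact: pullback_unitmx.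
    exact: (diff_pullback_metric fDE sf sG).
  exact: pullback_sym.
- by move=> s ss; have [] := Hd s ss.
- by move=> s ss; have [] := Hd s ss.
- by move=> s ss; have [] := Hd s ss.
Qed.

Lemma ambient_regular z : E z -> [/\ differentiable G z, (G z)^T = G z & G z \in unitmx].
Proof.
move=> Ez; split; [exact: smooth_diff sG Ez|exact: symG|].
by apply: posdef_unitmx; exact: posG.
Qed.

Lemma speed2_x : eventually (fun d => forall t : R, -1 <= t <= 2 ->
  bilin (G (x d t)) (dx d t) (dx d t) = bilin (G p) (dx d 0) (dx d 0)).
Proof.
apply: eventually_smallS eventually_in_E => d HE t tt.
have [<- _ Hd] := hx d.
apply: (@const_speed R m.+1 G (x d) (dx d) (ddx d) (-1) 2 zero_in_range _ _ _ _ t tt).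
- by move=> s ss; apply: ambient_regular; exact: HE.
- by move=> s ss; have [] := Hd s ss.
- by move=> s ss; have [] := Hd s ss.
- by move=> s ss; have [] := Hd s ss.
Qed.

Lemma bigO_img : bigO 1 (fun d t => img d t - p).
Proof.
apply: (bigO_lip delta_ge0 (smooth_lip_near oD Dy0 sf) bigO_y); last exact: bigO_y.
exact: bigO_const_sub.
Qed.

(** The Taylor remainder is quadratic in [gap], which already has order 2. *)
Lemma bigO_metric_taylor : bigO 4 (fun d t =>
  G (img d t) - G (x d t) - 'D_(gap d t) G (x d t)).
Proof.
have [r [C [r0 C0 H]]] := taylor1 oE ambient_base_point sG.
have [C' C'0 H'] := bigO_gap.
exists (C * C' ^+ 2); first by rewrite mulr_ge0// exprn_ge0.
have N := eventually_small2 (fun d => @conj _ _) (bigO_near delta_ge0 r0 (leqnn 1) bigO_img)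
  (bigO_near delta_ge0 r0 (leqnn 1) bigO_x).
apply: eventually_small2 H' N => d h [h1 h2] t tt.
apply: (le_trans (H _ _ (h1 t tt) (h2 t tt))).
rewrite -mulrA ler_wpM2l// (exprM (delta d) 2 2) -exprMn.
by rewrite ler_pXn2r ?nnegrE ?mulr_ge0 ?exprn_ge0 ?delta_ge0//; exact: h.
Qed.

(** To be read with [A0], [A1], [Ap] the metric at x, X, p, with [W] its derivative along the gap,
    and with [w], [l] the gap velocity and its linear model. The left side groups the difference so
    that each term has order at least 5; the right side isolates the first variation and the main
    quadratic term. *)
Lemma speed2_variation (A0 A1 Ap W : 'M[R]_m.+1) (v V w l : 'rV[R]_m.+1) : A0^T = A0 -> V = v + w ->
  bilin (A1 - A0 - W) V V + bilin W w V + bilin W v w + bilin A0 (w - l) w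
    + bilin A0 l (w - l) + bilin (A0 - Ap) l l
  = bilin A1 V V - bilin A0 v v - bilin W v v - 2 * bilin A0 v w - bilin Ap l l.
Proof.
move=> sA ->; rewrite !bilinBm !bilinDl !bilinDr !bilinNl !bilinNr.
by rewrite [bilin A0 w v]bilin_sym//; ring.
Qed.

Definition energy_gap d : R :=
  bilin (pullback_metric f G y0) (dy d 0) (dy d 0) - bilin (G p) (dx d 0) (dx d 0).

(* The first variation of energy at the geodesic [x d] vanishes, so that the
   quadratic term in [dgap], which is linear in time to leading order, dominates. *)
Lemma energy_gap_expansion : bigO 5
  ((fun d _ => energy_gap d - 12^-1 * bilin (G p) (ddgap d 0) (ddgap d 0)) : T -> R -> R^o).
Proof.
pose L d t := (t - 2^-1) *: ddgap d 0.
pose B d := bilin (G p) (ddgap d 0) (ddgap d 0).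
have OG : bigO 0 (fun d t => G (x d t)).
  exact: (stable_lip delta_ge0 (smooth_lip_near oE ambient_base_point sG) bigO_x).1.
have ODG := bigO_derive_metric bigO_gap bigO_x.
have OdL : bigO 3 (fun d t => dgap d t - L d t) by exact: gap_expansion.1.
have OL : bigO 2 L := bigO_linear_gap.
have OGp : bigO 1 (fun d t => G (x d t) - G p).
  apply: (bigO_lip delta_ge0 (smooth_lip_near oE ambient_base_point sG) bigO_x _ bigO_x).
  exact: bigO_const_sub.
have OdX : bigO 1 dimg := stable_dimg.1.
pose dPsi d t : R := energy_gap d - bilin ('D_(gap d t) G (x d t)) (dx d t) (dx d t)
   - 2 * bilin (G (x d t)) (dx d t) (dgap d t) - (t - 2^-1) ^+ 2 * B d.
have OdPsi : bigO 5 (dPsi : T -> R -> R^o).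
  apply: (@bigO_eq R T delta R^o 5 (fun d t =>
    bilin (G (img d t) - G (x d t) - 'D_(gap d t) G (x d t)) (dimg d t) (dimg d t)
    + bilin ('D_(gap d t) G (x d t)) (dgap d t) (dimg d t)
    + bilin ('D_(gap d t) G (x d t)) (dx d t) (dgap d t)
    + bilin (G (x d t)) (dgap d t - L d t) (dgap d t)
    + bilin (G (x d t)) (L d t) (dgap d t - L d t)
    + bilin (G (x d t) - G p) (L d t) (L d t))).
    have H1 := eventually_small2 (fun d => @conj _ _) speed2_img speed2_x.
    apply: eventually_small2 H1 eventually_in_E => d [h1 h2] HE t tt.
    rewrite (@speed2_variation (G (x d t)) (G (img d t)) (G p) _ (dx d t)).
    - rewrite /dPsi /energy_gap h1// h2// /L bilinZl bilinZr /B; ring.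
    - by apply: symG; exact: HE.
    - by rewrite /dgap addrC subrK.
  do 5 ?apply: bigOD.
  - exact: (bigO_le delta_ge0 (leqnSn 5) (bigO_bilin bigO_metric_taylor OdX OdX)).
  - exact: (bigO_bilin ODG bigO_dgap OdX).
  - exact: (bigO_bilin ODG bigO_dx bigO_dgap).
  - exact: (bigO_bilin OG OdL bigO_dgap).
  - exact: (bigO_bilin OG OL OdL).
  - exact: (bigO_bilin OGp OL OL).
(* By the geodesic equation, the derivative of 2 g(x', w) is the whole first variation, so [Psi] has
   derivative [dPsi]. As w vanishes at times 0 and 1, the increment of [Psi] is the energy gap minus
   1/12 of the squared norm of W, taken at p. *)
pose Psi d t : R := t * energy_gap d - 2 * bilin (G (x d t)) (dx d t) (gap d t)
   - (t - 2^-1) ^+ 3 / 3 * B d.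
have DPsi : eventually (fun d => forall t : R, -1 <= t <= 2 -> is_derive t 1 (Psi d) (dPsi d t)).
  apply: eventually_small2 eventually_in_D eventually_in_E => d HD HE t tt.
  have [_ _ /(_ t tt)[D1 D2 Ex _ _]] := hx d.
  have [dG sGx uG] := ambient_regular (HE t tt).
  have Dg := (is_derive_gap HD tt).1.
  have DB := is_derive_bilin (is_derive_comp_diff D1 dG) D2 Dg.
  have D3 := is_deriveB (is_deriveB (is_derive_line (energy_gap d : R^o) t) (is_deriveZ 2 DB))
     (is_derive_scale (B d : R^o) (is_derive_centered_cube t)).
  apply: is_derive_ext D3 _ _ => //.
  rewrite /dPsi; congr (_ - _).
  have := lowered_acc_geodesic (dx d t) (gap d t) dG sGx uG.
  rewrite -Ex /lowered_acc /GRing.scale /= => h; lra.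
have := bigO_at one_in_range (bigO_MVT_scalar delta_ge0 DPsi OdPsi).
apply: bigO_eq; apply: eventually_smallT => d t tt.
have [y00 y11 _] := hy d; have [x00 x11 _] := hx d.
have g0 : gap d 0 = 0 by rewrite /gap /img y00 x00 subrr.
have g1 : gap d 1 = 0 by rewrite /gap /img y11 x11 subrr.
by rewrite /Psi g0 g1 !bilin0r /B; field.
Qed.

Definition second_form_at (v w : 'rV[R]_m.+1) : R := second_form G nu p v w.

(* The second derivative of the surface geodesic is normal, with coefficient [- K]. *)
Lemma lowered_acc_img : eventually (fun d => forall u,
  lowered_acc G p (dimg d 0) (ddimg d 0) u
  = - second_form_at (dimg d 0) (dimg d 0) * bilin (G p) u (nu p)).
Proof.
apply: eventually_smallS eventually_in_D => d HD u.
have [dG sGp uG] := ambient_regular ambient_base_point.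
have [y00 _ Hd] := hy d.
have [e ->] := tangent_normal_decomp (immf Dy0) nu_unit (nu_orth Dy0) u.
rewrite lowered_acc_decomp//.
have [D1 D2 Ey _ _] := Hd 0 zero_in_range.
have -> : lowered_acc G p (dimg d 0) (ddimg d 0) (e *m J y0) = 0.
  rewrite /dimg /ddimg y00 -(lowered_acc_pullback oD fDE sf sG)//.
  rewrite Ey y00; apply: lowered_acc_geodesic.
  - exact: (diff_pullback_metric fDE sf sG).
  - exact: pullback_sym.
  - exact: pullback_unitmx.
have img0 : img d 0 = p by rewrite /img y00.
have [DX DdX] := is_derive_img HD zero_in_range.
have -> : lowered_acc G p (dimg d 0) (ddimg d 0) (nu p)
    = - second_form_at (dimg d 0) (dimg d 0).
  apply: second_form_lowered_acc => //.
  - by apply: filterS symG _; exact: (open_near oE ambient_base_point).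
  - by rewrite /dimg y00 nu_orth.
  have dG0 : differentiable G (img d 0) by rewrite img0.
  have dn0 : differentiable nu (img d 0) by rewrite img0.
  have := is_derive_bilin (is_derive_comp_diff DX dG0) DdX (is_derive_comp_diff DX dn0).
  rewrite img0 => -[_ <-].
  (* Time 0 is interior to [-1, 2], so orthogonality to the normal holds on both sides of it and may
     be differentiated there. *)
  have N : \forall s \near (0 : R),
      bilin (G (img d s)) (dimg d s) (nu (img d s)) = cst 0 s.
    have : \forall s \near (0 : R), ball (0 : R) 1 s by exact: nbhsx_ballx.
    apply: filterS => s; rewrite -ball_normE /= sub0r normrN ltr_norml => /andP[s1 s2].
    by rewrite /dimg /img nu_orth//; apply: HD; apply/andP; split; lra.
  by rewrite (near_eq_derive _ N) derive_cst.
rewrite add0r bilinDl bilinZl nu_unit mulr1 nu_orth// add0r; ring.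
Qed.

(** The difference between the metric-derivative terms of [lowered_acc] for X and for x. Every term
    contains [dgap] once and a velocity once, hence the order 3. *)
Definition acc_defect d (u : 'rV[R]_m.+1) : R :=
  bilin ('D_(dgap d 0) G p) (dimg d 0) u + bilin ('D_(dx d 0) G p) (dgap d 0) u
  - 2^-1 * (bilin ('D_u G p) (dgap d 0) (dimg d 0) + bilin ('D_u G p) (dx d 0) (dgap d 0)).

Lemma bilin_ddgap0 : eventually (fun d => forall u, bilin (G p) (ddgap d 0) u
  = - second_form_at (dimg d 0) (dimg d 0) * bilin (G p) u (nu p) - acc_defect d u).
Proof.
apply: eventually_smallS lowered_acc_img => d H u.
have [dG sGp uG] := ambient_regular ambient_base_point.
have [x00 _ Hd] := hx d; have [D1 D2 Ex _ _] := Hd 0 zero_in_range.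
have := lowered_acc_geodesic (dx d 0) u dG sGp uG.
rewrite x00 in Ex; rewrite -Ex -(H u) {H}.
have Ev : dimg d 0 = dx d 0 + dgap d 0 by rewrite /dgap addrC subrK.
have ED : 'D_(dimg d 0) G p = 'D_(dx d 0) G p + 'D_(dgap d 0) G p.
  by rewrite !deriveE// Ev linearD.
rewrite /acc_defect /lowered_acc ED Ev /ddgap.
move: ('D_u G p) ('D_(dx d 0) G p) ('D_(dgap d 0) G p) => Gu Gv Gw.
rewrite !(bilinDm, bilinDl, bilinDr, bilinNl); lra.
Qed.

Lemma bigO_second_form a b (v w : T -> R -> 'rV[R]_m.+1) : bigO a v -> bigO b w ->
  bigO (a + b) ((fun d t => second_form_at (v d t) (w d t)) : T -> R -> R^o).
Proof.
move=> Hv Hw; pose P := 1%:M - G p *m (nu p)^T *m nu p.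
have Hc (z : T -> R -> 'rV[R]_m.+1) k : bigO k z -> bigO k (fun d t => z d t *m P).
  by move=> Hz; rewrite -[k]addn0; exact: bigO_mulmx Hz (bigO_cst _ P).
have := bigO_bilin (bigO_cst delta (\matrix_(i, j) (2^-1 *
  (cov_deriv G nu p i j + cov_deriv G nu p j i)))) (Hc _ _ Hv) (Hc _ _ Hw).
apply: bigO_eq; apply: eventually_smallT => d t _.
by rewrite /second_form_at /second_form !tangentialE.
Qed.

Lemma bigO_dgap0 : bigO 2 (fun d _ => dgap d 0).
Proof. exact: (bigO_at zero_in_range bigO_dgap). Qed.
Lemma bigO_dimg0 : bigO 1 (fun d _ => dimg d 0).
Proof. exact: (bigO_at zero_in_range stable_dimg.1). Qed.
Lemma bigO_dx0 : bigO 1 (fun d _ => dx d 0).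
Proof. exact: (bigO_at zero_in_range bigO_dx). Qed.

Lemma bigO_acc_defect k (u : T -> R -> 'rV[R]_m.+1) : bigO k u ->
  bigO (3 + k) ((fun d t => acc_defect d (u d t)) : T -> R -> R^o).
Proof.
move=> Hu.
have Dp j (v : T -> R -> 'rV[R]_m.+1) : bigO j v -> bigO j (fun d t => 'D_(v d t) G p).
  by move=> Hv; apply: (bigO_derive_metric Hv); exact: bigO_const_sub.
have H1 := bigO_bilin (Dp _ _ bigO_dgap0) bigO_dimg0 Hu.
have H2 := bigO_bilin (Dp _ _ bigO_dx0) bigO_dgap0 Hu.
have H3 := bigO_bilin (Dp _ _ Hu) bigO_dgap0 bigO_dimg0.
have H4 := bigO_bilin (Dp _ _ Hu) bigO_dx0 bigO_dgap0.
rewrite -addnA [(k + _)%N]addnC in H3; rewrite -addnA [(k + _)%N]addnC in H4.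
have H5 := bigOZ (k := 0) (bigO_cst delta (2^-1 : R^o)) (bigOD H3 H4).
exact: (bigOB (bigOD H1 H2) H5).
Qed.

(** The identity [bilin_ddgap0] is used twice. On W itself it expresses |W|^2 by the normal
    component of W up to order 5; on the normal it shows this component to be -K up to order 3, and
    it is multiplied by K, of order 2. *)
Lemma normal_term_expansion : bigO 5
  ((fun d _ => bilin (G p) (ddgap d 0) (ddgap d 0)
     - second_form_at (dimg d 0) (dimg d 0) ^+ 2) : T -> R -> R^o).
Proof.
have OK := bigO_second_form bigO_dimg0 bigO_dimg0.
have On := bigO_acc_defect (bigO_cst delta (nu p)).
have OW := bigO_acc_defect bigO_ddgap0.
apply: bigO_eq (bigOB (bigOZ OK On) OW).
apply: eventually_smallS bilin_ddgap0 => d H t _.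
have HW := H (ddgap d 0); have Hn := H (nu p).
rewrite nu_unit in Hn; rewrite Hn in HW.
move: HW; rewrite -[LHS in _ -> LHS = _]/(second_form_at (dimg d 0) (dimg d 0) * acc_defect d (nu p)
  - acc_defect d (ddgap d 0)).
move: (bilin (G p) _ _) (second_form_at _ _) (acc_defect d (nu p)) (acc_defect d (ddgap d 0)).
by move=> a b e1 e2 ->; ring.
Qed.

(** A difference of squares: the two values of the form differ to order 2 + 1, the orders of [dgap]
    and of a velocity, and their sum has order 2. *)
Lemma second_form_comparison : bigO 5
  ((fun d _ => second_form_at (dimg d 0) (dimg d 0) ^+ 2
     - second_form_at (dx d 0) (dx d 0) ^+ 2) : T -> R -> R^o).
Proof.
have H1 := bigO_second_form bigO_dgap0 bigO_dimg0.
have H2 := bigO_second_form bigO_dx0 bigO_dgap0.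
have H3 := bigO_second_form bigO_dimg0 bigO_dimg0.
have H4 := bigO_second_form bigO_dx0 bigO_dx0.
apply: bigO_eq (bigOZ (bigOD H1 H2) (bigOD H3 H4)).
apply: eventually_smallT => d t _.
rewrite /second_form_at /second_form !tangentialE.
have -> : dimg d 0 = dx d 0 + dgap d 0 by rewrite /dgap addrC subrK.
rewrite !mulmxDl !(bilinDl, bilinDr) /GRing.scale /=; ring.
Qed.

Definition length2_ambient d : R := bilin (G p) (dx d 0) (dx d 0).
Definition length2_surface d : R := bilin (pullback_metric f G y0) (dy d 0) (dy d 0).

Lemma length2_comparison : bigO 5 ((fun d _ => length2_surface d
  - (length2_ambient d + 12^-1 * second_form_at (dx d 0) (dx d 0) ^+ 2)) : T -> R -> R^o).
Proof.
have H := bigOZ (k := 0) (bigO_cst delta (12^-1 : R^o))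
  (bigOD normal_term_expansion second_form_comparison).
apply: bigO_eq (bigOD energy_gap_expansion H).
apply: eventually_smallT => d t _.
by rewrite /energy_gap /length2_surface /length2_ambient /GRing.scale /=; ring.
Qed.

(** Needed to turn powers of delta into powers of the ambient length. Up to order 2, the coordinate
    displacement is [dx d 0] times a right inverse of the Jacobian of the immersion, and coercivity
    bounds [dx d 0] by the length. For small delta the quadratic error is at most half of delta and
    is absorbed, whence the factor 2. *)
Lemma delta_le_length : exists2 C : R, 0 <= C &
  eventually (fun d => delta d <= C * Num.sqrt (length2_ambient d)).
Proof.
have [Pi JPi] := row_freeP (immf Dy0).
have O1 : bigO 2 (fun d _ => f (y1 d) - f y0 - (y1 d - y0) *m J y0).
  have [r [C [r0 C0 H]]] := taylor1 oD Dy0 sf.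
  exists C => //; apply: eventually_smallS (bigO_near delta_ge0 r0 (leqnn 1) bigO_y1) => d h t tt.
  rewrite -derive_partials_mx; last exact: smooth_diff sf Dy0.
  have yr := h t tt; have := H (y1 d) y0 yr; rewrite subrr normr0 => /(_ r0).
  by rewrite deltaE.
have O2 : bigO 2 (fun d (t : R) => x d t - t *: dx d 0 - (x d 0 - 0 *: dx d 0)).
  apply: (bigO_MVT delta_ge0 (dF := fun d t => dx d t - dx d 0)); last exact: stable_x.1.2.
  apply: eventually_smallT => d t tt; have [_ _ Hd] := hx d; have [D1 _ _ _ _] := Hd t tt.
  by apply: is_deriveB (is_derive_line _ _).
have O3 : bigO 2 (fun d _ => (y1 d - y0) - dx d 0 *m Pi).
  have := bigO_mulmx (bigOB (bigO_at one_in_range O2) O1) (bigO_cst _ Pi).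
  apply: bigO_eq; apply: eventually_smallT => d t _.
  have [x00 x11 _] := hx d; rewrite x00 x11 scale1r scale0r subr0.
  rewrite -[in RHS](mulmx1 (y1 d - y0)) -JPi mulmxA -mulmxBl; congr (_ *m _).
  by move: (f (y1 d)) (f y0) (dx d 0) (_ *m J y0) => a b c e; apply/rowP => i; rewrite !mxE; ring.
have [C C0 [eta eta0 H]] := O3.
have [l l0 Hl] := posdef_coercive (posG ambient_base_point).
have sl0 : 0 < Num.sqrt l by rewrite sqrtr_gt0.
exists (2 * m.+1%:R * `|Pi| / Num.sqrt l).
  by rewrite divr_ge0 ?mulr_ge0// ltW.
exists (Num.min eta (2 * (C + 1))^-1).
  by rewrite lt_min eta0 invr_gt0 mulr_gt0// ltr_wpDl.
move=> d; rewrite lt_min => /andP[d1 d2].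
have := H d d1 0 zero_in_range.
have -> : delta d ^+ 2 = delta d * delta d by rewrite expr2.
have d0 := delta_ge0 d.
have Cd : C * delta d <= 2^-1.
  have C2 : 0 < 2 * (C + 1) by rewrite mulr_gt0// ltr_wpDl.
  by move: d2; rewrite -[(2 * (C + 1))^-1]mul1r ltr_pdivlMr// => ?; nra.
have Hdx : `|dx d 0| <= Num.sqrt (length2_ambient d) / Num.sqrt l.
  rewrite ler_pdivlMr// -(ler_pXn2r (n := 2))// ?nnegrE ?sqrtr_ge0 ?mulr_ge0 ?sqrtr_ge0//.
  rewrite exprMn !sqr_sqrtr ?(ltW l0)//; last first.
    by apply: le_trans (Hl _); rewrite mulr_ge0 ?exprn_ge0// ltW.
  by rewrite mulrC; exact: Hl.
have := mulmx_norm_le (dx d 0) Pi => Hp Hq.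
have : delta d <= `|y1 d - y0 - dx d 0 *m Pi| + `|dx d 0 *m Pi|.
  by rewrite deltaE -{1}[y1 d - y0](subrK (dx d 0 *m Pi)) ler_normD.
have -> : 2 * m.+1%:R * `|Pi| / Num.sqrt l * Num.sqrt (length2_ambient d)
  = 2 * (m.+1%:R * (Num.sqrt (length2_ambient d) / Num.sqrt l * `|Pi|)) by ring.
have : m.+1%:R * (`|dx d 0| * `|Pi|) <=
   m.+1%:R * (Num.sqrt (length2_ambient d) / Num.sqrt l * `|Pi|).
  by rewrite ler_wpM2l// ler_wpM2r.
move: Hp Hq Cd d0; move: (`|_ - _ - _|) (`|dx d 0 *m Pi|) (m.+1%:R * _) (m.+1%:R * _) (delta d).
move=> a b c e k ? ? ? ? ? ?; nra.
Qed.

Lemma length_expansion : exists2 C : R, 0 <= C & eventually (fun d =>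
  `|length2_surface d
     - (length2_ambient d + 12^-1 * second_form_at (dx d 0) (dx d 0) ^+ 2)|
  <= C * Num.sqrt (length2_ambient d) ^+ 5).
Proof.
have [C C0 H] := length2_comparison; have [C' C'0 H'] := delta_le_length.
exists (C * C' ^+ 5); first by rewrite mulr_ge0// exprn_ge0.
apply: eventually_small2 H H' => d h h'.
apply: (le_trans (h 0 zero_in_range)).
rewrite -mulrA ler_wpM2l// -exprMn ler_pXn2r ?nnegrE ?delta_ge0//.
by rewrite mulr_ge0// sqrtr_ge0.
Qed.

End Expansion.

(** * Charts and changes of coordinates *)

Section Charts.
Context {R : realType} {M : topologicalType} {n : nat}.
Implicit Types (c : chart R M n).

Lemma paramK c x : cimg c x -> cmap c (param c x) = x.
Proof. by move=> [q cq <-]; rewrite (cmapK (mem_set cq)). Qed.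

Lemma cdom_param c x : cimg c x -> cdom c (param c x).
Proof. by move=> [q cq <-]; rewrite (cmapK (mem_set cq)). Qed.

Lemma cimg_cmap c q : cdom c q -> cimg c (cmap c q).
Proof. by move=> cq; exists q. Qed.

Lemma open_param_preimage c (W : set M) : open W -> open (cimg c `&` param c @^-1` W).
Proof.
move=> oW; rewrite openE => x [cx Wx]; apply: filterI.
  by apply: open_nbhs_nbhs; split; [exact: cimg_open|exact: cx].
by apply: (param_cont (mem_set cx)); apply: open_nbhs_nbhs; split.
Qed.

Lemma open_cmap_preimage c (W : set 'rV[R]_n) : open W -> open (cdom c `&` cmap c @^-1` W).
Proof.
move=> oW; rewrite openE => q [cq Wq]; apply: filterI.
  by apply: open_nbhs_nbhs; split; [exact: cdom_open|exact: cq].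
by apply: (cmap_cont (mem_set cq)); apply: open_nbhs_nbhs; split.
Qed.

Lemma near_cdom c q : cdom c q -> \forall r \near q, cdom c r.
Proof. by move=> cq; by apply: open_nbhs_nbhs; split; [exact: cdom_open|exact: cq]. Qed.

Lemma transition_diff (A : manifold R M n) c c' q : atlas A c -> atlas A c' ->
  cdom c q -> cdom c' q -> differentiable (cmap c' \o param c) (cmap c q).
Proof.
move=> Ac Ac' cq cq'; apply: smooth_diff (atlas_smooth Ac Ac') _.
by exists q.
Qed.

Lemma is_derive_change_chart (A : manifold R M n) c c' (gamma : R -> M) (t : R) v :
  atlas A c -> atlas A c' -> cdom c (gamma t) -> cdom c' (gamma t) ->
  {for t, continuous gamma} -> is_derive t 1 (cmap c \o gamma) v ->
  is_derive t 1 (cmap c' \o gamma) (v *m 'J (cmap c' \o param c) (cmap c (gamma t))).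
Proof.
move=> Ac Ac' ct ct' gt D.
have dT := transition_diff Ac Ac' ct ct'.
have := is_derive_comp_diff D dT; rewrite deriveEjacobian// => D'.
apply: near_eq_is_derive D'.
have : \forall s \near t, cdom c (gamma s) by apply: gt; exact: near_cdom.
by apply: filterS => s cs /=; rewrite (cmapK (mem_set cs)).
Qed.

(** The transformation law of [is_riemannian] on its own, so that the results on speed and length
    serve both [g] and the induced metric. *)
Definition tensorial (A : manifold R M n) (g : tensor2 R M n) : Prop :=
  forall c d q, atlas A c -> atlas A d -> cdom c q -> cdom d q ->
    let J := 'J (cmap d \o param c) (cmap c q) in
    g c (cmap c q) = J *m g d (cmap d q) *m J^T.

Lemma speed_change_chart (A : manifold R M n) g c c' (gamma : R -> M) (t : R) v :
  tensorial A g ->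
  atlas A c -> atlas A c' -> cdom c (gamma t) -> cdom c' (gamma t) ->
  {for t, continuous gamma} -> is_derive t 1 (cmap c \o gamma) v ->
  speed g c' gamma t = Num.sqrt (bilin (g c (cmap c (gamma t))) v v).
Proof.
move=> tg Ac Ac' ct ct' gt D; have [_ D'] := is_derive_change_chart Ac Ac' ct ct' gt D.
rewrite /speed /velocity derive1E D' (tg c c' (gamma t))//.
by congr (Num.sqrt _); rewrite /bilin !trmx_mul !mulmxA.
Qed.

End Charts.

(** * From boundary value solutions to geodesics and their lengths *)

Section Curves.
Context {R : realType}.

(* Also at the endpoints, where the derivatives agree as one-sided limits. *)
Lemma derive_eq_on_unit_interval (W : normedModType R) (f g : R -> W) (t : R) df dg :
  0 <= t <= 1 -> is_derive t 1 f df -> is_derive t 1 g dg ->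
  (forall s, 0 <= s <= 1 -> f s = g s) -> df = dg.
Proof.
move=> t01 Df Dg fg.
have [Dh Eh] := is_deriveB Df Dg.
apply/eqP; rewrite -subr_eq0 -normr_le0; apply/ler_addgt0Pl => e e0; rewrite addr0.
have C : (fun h => h^-1 *: (((f - g) \o shift t) (h *: 1) - (f - g) t)) @ 0^' --> df - dg.
  by rewrite -Eh; exact: Dh.
have /cvgrPdist_le/(_ e e0) := C.
move=> /nbhs_ballP[r /= r0 H].
have [h [h0 hr ht]] : exists h : R, [/\ h != 0, `|h| < r & 0 <= h + t <= 1].
  pose k := Num.min (r / 2) 2^-1.
  have k0 : 0 < k by rewrite lt_min divr_gt0//= invr_gt0 ltr0n.
  have k1 : k <= 2^-1 by rewrite ge_min lexx orbT.
  have kr : k < r by rewrite (@le_lt_trans _ _ (r / 2))// ?ge_min ?lexx// ltr_pdivrMr// ltr_pMr// ltr1n.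
  move: k0 k1 kr; move: (k) => {}k k0 k1 kr.
  move: t01 => /andP[t0 t1].
  have [tl|tl] := leP t 2^-1.
    exists k; rewrite gt_eqF// gtr0_norm//; split=> //; apply/andP; split; lra.
  exists (- k); rewrite oppr_eq0 gt_eqF// normrN gtr0_norm//; split=> //; apply/andP; split; lra.
have := H h; rewrite -ball_normE /= sub0r normrN => /(_ hr h0).
have -> : (f - g) (h *: 1 + t) = 0.
  rewrite -[LHS]/(f (h *: 1 + t) - g (h *: 1 + t)) [h *: 1]mulr1 fg ?subrr//.
have -> : (f - g) t = 0 by rewrite -[LHS]/(f t - g t) fg ?subrr.
by rewrite subrr scaler0 subr0.
Qed.

Context {M : topologicalType} {n : nat}.
Implicit Types (A : manifold R M n) (g : tensor2 R M n) (gamma : R -> M).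

(** The symbols contain derivatives, so agreement on a neighbourhood is what matters; this lets the
    pullback metric of a fixed ambient chart replace the induced metric. *)
Lemma christoffel_near (G G' : 'rV[R]_n -> 'M[R]_n) x :
  (\forall z \near x, G z = G' z) -> christoffel G x = christoffel G' x.
Proof.
move=> GG'; apply/funext => k; apply/funext => i; apply/funext => j.
rewrite /christoffel (nbhs_singleton GG'); congr (_ * _); apply: eq_bigr => l _.
have E a b e : 'D_(basis_vec e) (fun y => G y a b) x = 'D_(basis_vec e) (fun y => G' y a b) x.
  by apply: near_eq_derive; apply: filterS GG' => z ->.
by rewrite !E.
Qed.

Lemma geodesic_of_bvp A g c (G : 'rV[R]_n -> 'M[R]_n) (D : set 'rV[R]_n) (U : set M)
    x0 x1 x dx ddx : atlas A c -> open D -> D `<=` cimg c ->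
  (forall z, D z -> G z = g c z) -> (forall z, D z -> U (param c z)) ->
  bvp_solution (geodesic_rhs G) x0 x1 x dx ddx ->
  (forall t : R, -1 <= t <= 2 -> D (x t)) ->
  geodesic A g U (param c x0) (param c x1) (param c \o x).
Proof.
move=> Ac oD DC GD DU [x00 x11 Hx] HD; split.
- by rewrite /= x00.
- by rewrite /= x11.
- by move=> t /andP[t0 t1] /=; apply: DU; apply: HD; apply/andP; split; lra.
(* The solution lives on [-1, 2], which leaves a margin of 1 on each side of [0, 1]. *)
exists 1 => // t /andP[t1 t2].
have t12 : -1 <= t <= 2 by apply/andP; split; lra.
have N : \forall s \near t, -1 <= s <= 2.
  have : \forall s \near t, s \in `]-1, 2[ by apply: near_in_itvoo; rewrite in_itv /=; apply/andP; split; lra.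
  by apply: filterS => s; rewrite in_itv /= => /andP[s1 s2]; rewrite !ltW.
have Nx : \forall s \near t, x s = (cmap c \o (param c \o x)) s.
  by apply: filterS N => s ss /=; rewrite paramK//; apply: DC; exact: HD.
have [D1 D2 E _ _] := Hx t t12.
have cx : cimg c (x t) by apply: DC; exact: HD.
have Nv : \forall s \near t, dx s = velocity c (param c \o x) s.
  have N2 : \forall s \near t, \forall u \near s, x u = (cmap c \o (param c \o x)) u.
    exact: (near_join Nx).
  near=> s; rewrite /velocity derive1E.
  have ss : -1 <= s <= 2 by near: s.
  have Ns : \forall u \near s, x u = (cmap c \o (param c \o x)) u by near: s.
  have [Ds _ _ _ _] := Hx s ss.
  by have [_ <-] := near_eq_is_derive Ns Ds.
split.
  apply: continuous_comp; last exact: (param_cont (mem_set cx)).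
  apply/differentiable_continuous/derivable1_diffP.
  exact: (@ex_derive _ _ _ _ _ _ _ D1).
exists c; split=> //.
- exact: cdom_param.
- have N2 : \forall s \near t, \forall u \near s, x u = (cmap c \o (param c \o x)) u.
    exact: (near_join Nx).
  near=> s; have ss : -1 <= s <= 2 by near: s.
  have Ns : \forall u \near s, x u = (cmap c \o (param c \o x)) u by near: s.
  have [Ds _ _ _ _] := Hx s ss.
  by have [] := near_eq_is_derive Ns Ds.
- by have [] := near_eq_is_derive Nv D2.
move=> k; rewrite derive1E; have [_ ->] := near_eq_is_derive Nv D2.
rewrite -(nbhs_singleton Nv) /= (paramK cx).
have -> : christoffel (g c) (x t) = christoffel G (x t).
  apply: christoffel_near; apply: filterS (open_nbhs_nbhs (conj oD (HD t t12))) => z Dz.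
  by rewrite GD.
by rewrite E mxE addNr.
Unshelve. all: by end_near. Qed.

(** The given geodesic and the constructed curve are known to agree only on [0, 1]. The geodesic
    equation provides a two-sided derivative of the former, and one-sided agreement suffices to
    identify it, including at the endpoints. *)
Lemma geodesic_chart_curve A g U p q gamma c (x dx : R -> 'rV[R]_n) :
  geodesic A g U p q gamma -> atlas A c ->
  (forall t : R, 0 <= t <= 1 -> cimg c (x t)) ->
  (forall t : R, 0 <= t <= 1 -> is_derive t 1 x (dx t)) ->
  (forall t : R, 0 <= t <= 1 -> gamma t = param c (x t)) ->
  forall t : R, 0 <= t <= 1 -> is_derive t 1 (cmap c \o gamma) (dx t).
Proof.
move=> [_ _ _ [e e0 Hg]] Ac cx Dx gx t t01.
have te : - e < t < 1 + e by move: t01 => /andP[? ?]; apply/andP; split; lra.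
have [gc [c' [Ac' ct' Dn _ _]]] := Hg t te.
have D' := derivableP (nbhs_singleton Dn).
have ct : cdom c (gamma t) by rewrite gx//; apply: cdom_param; exact: cx.
have D := is_derive_change_chart Ac' Ac ct' ct gc D'.
have E := derive_eq_on_unit_interval t01 D (Dx t t01) _.
rewrite -E => // s s01 /=; rewrite gx// paramK//; exact: cx.
Qed.

(** [arc_length] measures each velocity in the chart selected at its point; by the tensor law the
    fixed chart [c] gives the same speed, here constant, over an interval of length 1. *)
Lemma arc_length_chart A g U p q gamma c (x dx : R -> 'rV[R]_n) (l2 : R) :
  tensorial A g -> geodesic A g U p q gamma -> atlas A c ->
  (forall t : R, 0 <= t <= 1 -> cimg c (x t)) ->
  (forall t : R, 0 <= t <= 1 -> is_derive t 1 x (dx t)) ->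
  (forall t : R, 0 <= t <= 1 -> gamma t = param c (x t)) ->
  (forall t : R, 0 <= t <= 1 -> bilin (g c (x t)) (dx t) (dx t) = l2) ->
  arc_length A g gamma = Num.sqrt l2.
Proof.
move=> tg Gg Ac cx Dx gx El; rewrite /arc_length.
rewrite (@eq_Rintegral _ _ _ _ _ (fun=> Num.sqrt l2)).
  rewrite Rintegral_cst//= lebesgue_measure_itv /= lte_fin ltr01 /=.
  by rewrite oppr0 addr0 mulr1.
move=> t; rewrite inE /= in_itv /= => t01.
have [_ _ _ [e e0 Hg]] := Gg.
have te : - e < t < 1 + e by move: t01 => /andP[? ?]; apply/andP; split; lra.
have [gc _] := Hg t te.
have ct : cdom c (gamma t) by rewrite gx//; apply: cdom_param; exact: cx.
have D := geodesic_chart_curve Gg Ac cx Dx gx t01.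
have := speed_change_chart tg Ac (chart_at_atlas A (gamma t)) ct (chart_at_dom A (gamma t)) gc D.
by move=> ->; rewrite gx// paramK ?El//; exact: cx.
Qed.

End Curves.

(** * The induced metric in arbitrary charts *)

Section Jacobian.
Context {R : realType}.

Lemma jacobian_factor m n k (h : 'rV[R]_m -> 'rV[R]_k) (F : 'rV[R]_n -> 'rV[R]_k)
    (tau : 'rV[R]_m -> 'rV[R]_n) x :
  differentiable h x -> differentiable tau x -> differentiable F (tau x) ->
  (\forall z \near x, h z = F (tau z)) -> 'J h x = 'J tau x *m 'J F (tau x).
Proof.
move=> dh dt dF N; apply/row_matrixP => i; rewrite !rowE mulmxA -!deriveEjacobian//.
rewrite (near_eq_derive _ N).
by have [_ ->] := is_derive_comp_diff (derivableP (diff_derivable (v := delta_mx 0 i) dt)) dF.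
Qed.

Context {M S : topologicalType} {n m : nat}.
Variables (A : manifold R M n) (B : manifold R S m) (g : tensor2 R M n) (iota : S -> M).
Hypotheses (hg : is_riemannian A g) (hiota : is_embedding A B iota).
Implicit Types (c : chart R M n) (d : chart R S m).

Definition local_embedding c d := cmap c \o iota \o param d.

Lemma embedding_regular c d s : atlas A c -> atlas B d -> cdom d s -> cdom c (iota s) ->
  differentiable (local_embedding c d) (cmap d s) /\
  row_free ('J (local_embedding c d) (cmap d s)).
Proof.
move=> Ac Bd ds cs; have [_ _ _ H] := hiota; have [H1 H2] := H c d Ac Bd.
have Ds : (cmap d @` (cdom d `&` iota @^-1` cdom c)) (cmap d s) by exists s.
by split; [exact: smooth_diff H1 Ds|exact: H2].
Qed.

Lemma local_embeddingE c d s : cdom d s -> local_embedding c d (cmap d s) = cmap c (iota s).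
Proof. by move=> ds; rewrite /local_embedding /= (cmapK (mem_set ds)). Qed.

Lemma near_local_embedding c d s : cdom d s -> cdom c (iota s) ->
  \forall z \near cmap d s, cdom c (iota (param d z)) /\ cimg d z.
Proof.
move=> ds cs; have [_ ci _ _] := hiota.
have oW : open (iota @^-1` cdom c) by move/continuousP : ci; apply; exact: cdom_open.
have Dz : (cimg d `&` param d @^-1` (iota @^-1` cdom c)) (cmap d s).
  by split; [exact: cimg_cmap|rewrite /= (cmapK (mem_set ds))].
have := open_nbhs_nbhs (conj (open_param_preimage (c := d) oW) Dz).
by apply: filterS => z [].
Qed.

Lemma induced_tensorial : tensorial B (induced_metric A g iota).
Proof.
move=> c d s Bc Bd cs ds /=.
have Ac1 := chart_at_atlas A (iota s); have cc1 := chart_at_dom A (iota s).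
rewrite /induced_metric !(cmapK (mem_set cs)) !(cmapK (mem_set ds)).
have [d1 _] := embedding_regular Ac1 Bc cs cc1.
have [d2 _] := embedding_regular Ac1 Bd ds cc1.
have dt := transition_diff Bc Bd cs ds.
have tE : (cmap d \o param c) (cmap c s) = cmap d s by rewrite /= (cmapK (mem_set cs)).
have -> : 'J (cmap (chart_at A (iota s)) \o iota \o param c) (cmap c s)
  = 'J (cmap d \o param c) (cmap c s) *m
    'J (cmap (chart_at A (iota s)) \o iota \o param d) (cmap d s).
  rewrite -tE; apply: jacobian_factor => //; first by rewrite tE.
  have : \forall z \near cmap c s, (cimg c `&` param c @^-1` cdom d) z.
    apply: open_nbhs_nbhs; split; first by apply: open_param_preimage; exact: cdom_open.
    by split; [exact: cimg_cmap|rewrite /= (cmapK (mem_set cs))].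
  by apply: filterS => z [cz dz] /=; rewrite (cmapK (mem_set dz)).
by rewrite !trmx_mul !mulmxA.
Qed.

(** [induced_metric] uses an ambient chart that varies with the point. The chain rule and the tensor
    law replace it by the fixed chart [c], in which the expansion is made. *)
Lemma induced_metric_pullback c d s : atlas A c -> atlas B d -> cdom d s -> cdom c (iota s) ->
  induced_metric A g iota d (cmap d s) = pullback_metric (local_embedding c d) (g c) (cmap d s).
Proof.
move=> Ac Bd ds cs; have [_ _ tg] := hg.
have Ac1 := chart_at_atlas A (iota s); have cc1 := chart_at_dom A (iota s).
rewrite /induced_metric !(cmapK (mem_set ds)).
have [d1 _] := embedding_regular Ac1 Bd ds cc1.
have [d2 _] := embedding_regular Ac Bd ds cs.
have dt := transition_diff Ac Ac1 cs cc1.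
rewrite /pullback_metric (partials_mxE d2) (local_embeddingE c ds) (tg _ _ _ Ac Ac1 cs cc1).
have -> : 'J (cmap (chart_at A (iota s)) \o iota \o param d) (cmap d s)
  = 'J (local_embedding c d) (cmap d s) *m
    'J (cmap (chart_at A (iota s)) \o param c) (cmap c (iota s)).
  rewrite -(local_embeddingE c ds); apply: jacobian_factor => //; first by rewrite local_embeddingE.
  apply: filterS (near_local_embedding ds cs) => z [cz _].
  by rewrite /local_embedding /= (cmapK (mem_set cz)).
by rewrite !trmx_mul !mulmxA.
Qed.

End Jacobian.

(** * Solvability of both problems together with the expansion, uniformly in the endpoint *)

Section ChartComparison.
Context {R : realType} {m : nat}.
Variables (D : set 'rV[R]_m) (E E' : set 'rV[R]_m.+1) (f : 'rV[R]_m -> 'rV[R]_m.+1)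
  (G : 'rV[R]_m.+1 -> 'M[R]_m.+1) (nu : 'rV[R]_m.+1 -> 'rV[R]_m.+1) (y0 : 'rV[R]_m).
Hypotheses (oD : open D) (oE : open E) (fDE : forall y, D y -> E (f y)).
Hypotheses (sf : smooth_on D f) (sG : smooth_on E G) (Dy0 : D y0).
Hypotheses (symG : forall x, E x -> (G x)^T = G x) (posG : forall x, E x -> posdef (G x)).
Hypothesis immf : forall y, D y -> row_free (partials_mx f y).
Hypotheses (dnu : differentiable nu (f y0))
  (nu_unit : bilin (G (f y0)) (nu (f y0)) (nu (f y0)) = 1)
  (nu_orth : forall y, D y -> forall w,
     bilin (G (f y)) (w *m partials_mx f y) (nu (f y)) = 0).
Hypotheses (oE' : open E') (E'E : E' `<=` E) (E'p : E' (f y0)).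

(* [l2] and [L2] are the squared lengths of the surface and the ambient geodesic. *)
Lemma chart_comparison : exists C eta : R, 0 < eta /\ forall y1, `|y1 - y0| < eta ->
  exists y dy ddy x dx ddx (l2 L2 : R),
  [/\ bvp_solution (geodesic_rhs (pullback_metric f G)) y0 y1 y dy ddy /\
      bvp_solution (geodesic_rhs G) (f y0) (f y1) x dx ddx,
      forall t : R, -1 <= t <= 2 -> D (y t),
      forall t : R, -1 <= t <= 2 -> E' (x t),
      forall t : R, -1 <= t <= 2 ->
        bilin (pullback_metric f G (y t)) (dy t) (dy t) = l2 /\
        bilin (G (x t)) (dx t) (dx t) = L2 &
      `|l2 - (L2 + 12^-1 * second_form G nu (f y0) (dx 0) (dx 0) ^+ 2)|
        <= C * Num.sqrt L2 ^+ 5].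
Proof.
have Ep := fDE Dy0.
have [rH [KH [rH0 KH0 H1 H2]]] := pullback_estimates oD oE fDE sf sG Dy0 posG immf.
have [rG [KG [rG0 KG0 G1 G2]]] := ambient_estimates oE sG posG Ep.
have [etaH etaH0 exH] := bvp_exists rH0 KH0 H1 H2.
have [etaG etaG0 exG] := bvp_exists rG0 KG0 G1 G2.
have [rD rD0 ballD] := open_ball_in oD Dy0.
have [rE rE0 ballE] := open_ball_in oE' E'p.
have [rf [Cf [rf0 Cf0 Hf]]] := smooth_lip_near oD Dy0 sf.
(* The index type of the expansion consists of an endpoint with a solution of each problem, so that
   [C] and [eta] are obtained before any endpoint is chosen. *)
pose P (q : 'rV[R]_m * ((R -> 'rV[R]_m) * (R -> 'rV[R]_m) * (R -> 'rV[R]_m)) *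
    ((R -> 'rV[R]_m.+1) * (R -> 'rV[R]_m.+1) * (R -> 'rV[R]_m.+1))) :=
  bvp_solution (geodesic_rhs (pullback_metric f G)) y0 q.1.1 q.1.2.1.1 q.1.2.1.2 q.1.2.2 /\
  bvp_solution (geodesic_rhs G) (f y0) (f q.1.1) q.2.1.1 q.2.1.2 q.2.2.
have [C C0 [eta eta0 HC]] := @length_expansion R m {q | P q} D E f G nu y0
  oD oE fDE sf sG Dy0 symG posG immf dnu nu_unit nu_orth
  (fun q => (sval q).1.1) (fun q => (sval q).1.2.1.1) (fun q => (sval q).1.2.1.2)
  (fun q => (sval q).1.2.2) (fun q => (sval q).2.1.1) (fun q => (sval q).2.1.2)
  (fun q => (sval q).2.2) (fun q => `|(sval q).1.1 - y0|)
  (fun q => (svalP q).1) (fun q => (svalP q).2) (fun q => erefl).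
(* The divisions by 4 keep solutions, which stray at most four times the distance of their
   endpoints, inside [D] and [E']. The factor [Cf + 1] bounds the ambient distance of the endpoints
   by the distance on the surface. *)
pose e := Num.min (Num.min eta etaH) (Num.min rf (Num.min (rD / 4)
   (Num.min (etaG / (Cf + 1)) (rE / 4 / (Cf + 1))))).
exists C, e; split.
  by rewrite !lt_min eta0 etaH0 rf0 !divr_gt0// ltr_wpDl.
move=> y1; rewrite !lt_min => /andP[/andP[d1 d2] /andP[d3 /andP[d4 /andP[d5 d6]]]].
have Cf1 : 0 < Cf + 1 by rewrite ltr_wpDl.
have fy1 : `|f y1 - f y0| <= (Cf + 1) * `|y1 - y0|.
  apply: (@le_trans _ _ (Cf * `|y1 - y0|)); first by apply: Hf => //; rewrite subrr normr0.
  by rewrite ler_wpM2r// lerDl.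
have fG : `|f y1 - f y0| < etaG.
  by apply: le_lt_trans fy1 _; rewrite mulrC -ltr_pdivlMr.
have fE : `|f y1 - f y0| < rE / 4.
  by apply: le_lt_trans fy1 _; rewrite mulrC -ltr_pdivlMr.
have [y [dy [ddy By]]] := exH y1 d2.
have [x [dx [ddx Bx]]] := exG (f y1) fG.
have yD t : -1 <= t <= 2 -> D (y t).
  move=> tt; apply: ballD; have [_ _ /(_ t tt)[_ _ _ h _]] := By.
  apply: le_lt_trans h _; move: d4; rewrite ltr_pdivlMr//; lra.
have xE t : -1 <= t <= 2 -> E' (x t).
  move=> tt; apply: ballE; have [_ _ /(_ t tt)[_ _ _ h _]] := Bx.
  apply: le_lt_trans h _; move: fE; rewrite ltr_pdivlMr//; lra.
exists y, dy, ddy, x, dx, ddx, (bilin (pullback_metric f G y0) (dy 0) (dy 0)),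
  (bilin (G (f y0)) (dx 0) (dx 0)); split=> //.
- move=> t tt; have [y00 _ Hy] := By; have [x00 _ Hx] := Bx; split.
    rewrite -y00; apply: (const_speed (ddx := ddy) zero_in_range _ _ _ _ tt).
    + move=> s ss; split.
      * exact: (diff_pullback_metric fDE sf sG (yD s ss)).
      * exact: (pullback_sym fDE symG (yD s ss)).
      * exact: (pullback_unitmx fDE posG immf (yD s ss)).
    + by move=> s ss; have [] := Hy s ss.
    + by move=> s ss; have [] := Hy s ss.
    + by move=> s ss; have [] := Hy s ss.
  rewrite -x00; apply: (const_speed (G := G) (x := x) (ddx := ddx) zero_in_range _ _ _ _ tt).
  + by move=> s ss; apply: (ambient_regular sG symG posG); apply: E'E; exact: xE.
  + by move=> s ss; have [] := Hx s ss.
  + by move=> s ss; have [] := Hx s ss.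
  + by move=> s ss; have [] := Hx s ss.
- have Pq : P (y1, (y, dy, ddy), (x, dx, ddx)) by split.
  exact: (HC (exist _ _ Pq)).
Qed.

End ChartComparison.

(** * The expansion on the manifold *)

Lemma posdef_ge0 {R : realType} n (A : 'M[R]_n) v : posdef A -> 0 <= bilin A v v.
Proof.
by move=> Ap; have [->|/Ap/ltW//] := eqVneq v 0; rewrite bilin0l.
Qed.

Lemma second_formZ {R : realType} n (G : 'rV[R]_n -> 'M[R]_n) nu x (a : R) v :
  second_form G nu x (a *: v) (a *: v) = a ^+ 2 * second_form G nu x v v.
Proof.
by rewrite /second_form !tangentialE -!scalemxAl bilinZl bilinZr expr2 mulrA.
Qed.

Theorem mainTheorem1 (R : realType) (m : nat) (M S : topologicalType)
    (A : manifold R M m.+1) (g : tensor2 R M m.+1) (hg : is_riemannian A g)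
    (B : manifold R S m) (iota : S -> M) (hiota : is_embedding A B iota)
    (p : S)
    (c : chart R M m.+1) (hc : atlas A c) (hcp : cdom c (iota p))
    (O : set 'rV[R]_m.+1) (nu : 'rV[R]_m.+1 -> 'rV[R]_m.+1)
    (hnu : local_unit_normal B g iota c O nu) (hO : O (cmap c (iota p)))
    (U : set M) (hU : open U) (hpU : U (iota p))
    (V : set S) (hV : open V) (hpV : V p) :
  let h := induced_metric A g iota in
  let K := second_form (g c) nu (cmap c (iota p)) in
  exists C : R, \forall q \near p^', forall (gamma : R -> M) (sigma : R -> S),
    unique_geodesic A g U (iota p) (iota q) gamma ->
    unique_geodesic B h V p q sigma ->
    let Lbar := arc_length A g gamma in
    let Ltilde := arc_length B h sigma in
    let v := unit_tangent g c gamma 0 in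
    `|Ltilde ^+ 2 - (Lbar ^+ 2 + 12^-1 * (K v v * Lbar ^+ 2) ^+ 2)|
      <= C * Lbar ^+ 5.
Proof.
move=> h K.
have [sg gsp tg] := hg.
have [_ ci _ emb] := hiota.
have [oO OC sO Hnu] := hnu.
pose d := chart_at B p; pose f := local_embedding iota c d; pose y0 := cmap d p.
have Bd : atlas B d by exact: chart_at_atlas.
have dp : cdom d p by exact: chart_at_dom.
(* The part of [V] whose image lies in the chart [c] and in the domain of the normal field; the
   surface geodesic is constructed inside it. *)
pose N := V `&` iota @^-1` (cdom c `&` cmap c @^-1` O).
have oN : open N.
  apply: openI => //; move/continuousP : ci; apply.
  exact: open_cmap_preimage.
pose D := cimg d `&` param d @^-1` N.
have oD : open D by exact: open_param_preimage.
have Dd y : D y -> [/\ y = cmap d (param d y), cdom d (param d y),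
    cdom c (iota (param d y)) & O (f y)].
  by move=> [dy [_ [cy Oy]]]; split=> //; [rewrite paramK|exact: cdom_param].
have fp : f y0 = cmap c (iota p) by exact: local_embeddingE.
have Dy0 : D y0.
  by split; [exact: cimg_cmap|rewrite /= (cmapK (mem_set dp))].
have fDE y : D y -> cimg c (f y) by move=> [_ [_ [cy _]]]; exact: cimg_cmap.
have sf : smooth_on D f.
  apply: smooth_on_sub (emb c d hc Bd).1 => y /Dd[yE dy cy _].
  by exists (param d y).
have regf y : D y -> differentiable f y /\ row_free ('J f y).
  move=> /Dd[yE dy cy _].
  by have := embedding_regular hiota hc Bd dy cy; rewrite -yE.
have immf y : D y -> row_free (partials_mx f y).
  by move=> /regf[df rf]; rewrite (partials_mxE df).
have dnu : differentiable nu (f y0) by rewrite fp; exact: smooth_diff sO hO.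
have nu_unit : bilin (g c (f y0)) (nu (f y0)) (nu (f y0)) = 1.
  by rewrite fp; have [] := Hnu p hcp hO.
have nu_orth y : D y -> forall w, bilin (g c (f y)) (w *m partials_mx f y) (nu (f y)) = 0.
  move=> Dy w; have [df _] := regf y Dy; have [yE dy cy Oy] := Dd y Dy.
  have [_ /(_ d Bd dy w)] := Hnu (param d y) cy Oy.
  by rewrite (partials_mxE df) -yE.
pose E' := cimg c `&` param c @^-1` U.
have oE' : open E' by exact: open_param_preimage.
have E'p : E' (f y0).
  by rewrite fp; split; [exact: cimg_cmap|rewrite /= (cmapK (mem_set hcp))].
have posg x : cimg c x -> posdef (g c x) by move=> cx; exact: (gsp c x hc cx).2.
have symg x : cimg c x -> (g c x)^T = g c x by move=> cx; exact: (gsp c x hc cx).1.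
have [C [eta [eta0 HC]]] := chart_comparison oD (@cimg_open _ _ _ c) fDE sf (sg c hc) Dy0 symg posg immf
  dnu nu_unit nu_orth oE' (@subIsetl _ _ _) E'p.
(* The estimate is established on a full neighbourhood of [p], and then restricted to the punctured
   one. *)
exists C; apply: cvg_within.
have near_q : \forall q \near p, cdom d q /\ `|cmap d q - y0| < eta.
  apply: filterI; first exact: near_cdom.
  have := cmap_cont (mem_set dp) => /cvgrPdist_lt/(_ eta eta0).
  by apply: filterS => q; rewrite distrC.
apply: filterS near_q => q [dq qeta] gamma sigma Hgamma Hsigma.
have [y [dy [ddy [x [dx [ddx [l2 [L2 [[By Bx] yD xE Hl est]]]]]]]]] := HC _ qeta.
have unit_in (t : R) : 0 <= t <= 1 -> -1 <= t <= 2.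
  by move=> /andP[t0 t1]; apply/andP; split; lra.
have hpull z : D z -> pullback_metric f (g c) z = h d z.
  move=> /Dd[zE dz cz _].
  by have := induced_metric_pullback hg hiota hc Bd dz cz; rewrite -zE.
have y1E : y 1 = cmap d q by have [] := By.
have Dq : D (cmap d q).
  by rewrite -y1E; apply: yD; apply: unit_in; rewrite ler01 lexx.
have cq : cdom c (iota q).
  by have [_ _ + _] := Dd _ Dq; rewrite (cmapK (mem_set dq)).
have geo_sigma : geodesic B h V p q (param d \o y).
  have := geodesic_of_bvp (A := B) (g := h) (U := V) Bd oD (fun z Dz => Dz.1) hpull
    (fun z Dz => Dz.2.1) By yD.
  by rewrite (cmapK (mem_set dp)) (cmapK (mem_set dq)).
have geo_gamma : geodesic A g U (iota p) (iota q) (param c \o x).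
  have := geodesic_of_bvp (A := A) (g := g) (U := U) hc oE' (fun z Ez => Ez.1)
    (fun z _ => erefl (g c z)) (fun z Ez => Ez.2) Bx xE.
  have fq : f (cmap d q) = cmap c (iota q) by exact: local_embeddingE.
  by rewrite fp fq (cmapK (mem_set hcp)) (cmapK (mem_set cq)).
have gammaE (t : R) : 0 <= t <= 1 -> gamma t = param c (x t).
  by move=> t01; rewrite -(Hgamma.2 _ geo_gamma t t01).
have sigmaE (t : R) : 0 <= t <= 1 -> sigma t = param d (y t).
  by move=> t01; rewrite -(Hsigma.2 _ geo_sigma t t01).
have xc (t : R) : 0 <= t <= 1 -> cimg c (x t) by move=> /unit_in/xE[].
have yd (t : R) : 0 <= t <= 1 -> cimg d (y t) by move=> /unit_in/yD[].
have Dx (t : R) : 0 <= t <= 1 -> is_derive t 1 x (dx t).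
  by move=> /unit_in tt; have [_ _ /(_ t tt)[]] := Bx.
have Dyt (t : R) : 0 <= t <= 1 -> is_derive t 1 y (dy t).
  by move=> /unit_in tt; have [_ _ /(_ t tt)[]] := By.
have z01 : 0 <= (0 : R) <= 1 by rewrite lexx ler01.
have EL : arc_length A g gamma = Num.sqrt L2.
  apply: (arc_length_chart (x := x) (dx := dx) tg Hgamma.1 hc xc Dx gammaE) => t t01.
  by have [] := Hl t (unit_in t t01).
have El : arc_length B h sigma = Num.sqrt l2.
  apply: (arc_length_chart (x := y) (dx := dy) (induced_tensorial g hiota) Hsigma.1 Bd yd
    Dyt sigmaE) => t t01.
  by have [<- _] := Hl t (unit_in t t01); rewrite (hpull _ (yD t (unit_in t t01))).
have [Hl0 HL0] := Hl 0 (unit_in 0 z01).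
have L2_ge0 : 0 <= L2.
  by rewrite -HL0; apply: posdef_ge0; apply: posg; exact: xc.
have l2_ge0 : 0 <= l2.
  rewrite -Hl0; apply: posdef_ge0; apply: posdef_pullback.
    by apply: posg; apply: fDE; apply: yD; exact: unit_in.
  by apply: immf; apply: yD; exact: unit_in.
have Dgamma := geodesic_chart_curve Hgamma.1 hc xc Dx gammaE z01.
have vE : unit_tangent g c gamma 0 = (Num.sqrt L2)^-1 *: dx 0.
  rewrite /unit_tangent /speed /velocity derive1E; have [_ ->] := Dgamma.
  by rewrite gammaE// (paramK (xc 0 z01)) HL0.
(* The speed of the parametrization is the square root of [L2], so quadratic homogeneity removes the
   normalization of the unit tangent. If [L2] is 0, definiteness forces [dx 0] to be 0 and both
   sides vanish. *)
have KE : K (unit_tangent g c gamma 0) (unit_tangent g c gamma 0) * L2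
    = second_form (g c) nu (f y0) (dx 0) (dx 0).
  rewrite vE /K -fp second_formZ; have [L0|L0] := eqVneq L2 0.
    have dx0 : dx 0 = 0.
      apply/eqP; apply: contraT => /(posg _ (xc 0 z01)).
      by rewrite HL0 L0 ltxx.
    by rewrite dx0 -[X in second_form _ _ _ X _](scale0r (0 : 'rV[R]_m.+1))
      -[X in second_form _ _ _ _ X](scale0r (0 : 'rV[R]_m.+1)) second_formZ expr0n /= !mul0r mulr0 mul0r.
  by rewrite exprVn sqr_sqrtr// mulrAC mulVf// mul1r.
by rewrite /= EL El !sqr_sqrtr// KE.
Qed.
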